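(* Let $B$ be a separable Banach space or $B=(\mathcal{D}[0,1],d_{\mathrm{sk}})$, and let $s>0$. Let $(X_n)_{n\ge0}$ be a sequence of $B$-valued random variables satisfying $$X_n\stackrel{d}{=}\sum_{r=1}^KA_r^{(n)}X^{(r)}_{I_r^{(n)}}+b^{(n)},\qquad n\ge n_0,$$ with the objects and independence assumptions described in the context. Assume: (C1) $\|X_0\|_s,\dots,\|X_{n_0-1}\|_s,\|A_r^{(n)}\|_s,\|b^{(n)}\|_s<\infty$ for all $r=1,\dots,K$, $n\ge0$, and there are random continuous linear operators $A_1,\dots,A_K$ on $B$ and a $B$-valued random variable $b$ such that, as $n\to\infty$, $$\gamma(n):=\|b^{(n)}-b\|_s+\sum_{r=1}^K\Bigl(\|A_r^{(n)}-A_r\|_s+\bigl\|\mathbf{1}_{\{I_r^{(n)}\le n_0\}}A_r^{(n)}\bigr\|_s\Bigr)\to0,$$ and for all $\ell\in\mathbb{N}$ and all $r$, $\mathbf{E}\bigl[\mathbf{1}_{\{I_r^{(n)}\in\{0,\dots,\ell\}\cup\{n\}\}}\|A_r^{(n)}\|_{\mathrm{op}}^s\bigr]\to0$. (C2) $L:=\sum_{r=1}^K\mathbf{E}[\|A_r\|_{\mathrm{op}}^s]<1$. (C3) The map $T:\mathcal{M}(B)\to\mathcal{M}(B)$, $T(\mu)=\mathcal{L}\bigl(\sum_{r=1}^KA_rZ^{(r)}+b\bigr)$, where $(A_1,\dots,A_K,b),Z^{(1)},\dots,Z^{(K)}$ are independent and each $Z^{(r)}$ has law $\mu$, has a fixed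 point $\eta\in\mathcal{M}_s(B)$ such that $\mathcal{L}(X_n)\in\mathcal{M}_s(\eta)$ for all $n\ge n_0$. Then, for $X$ with $\mathcal{L}(X)=\eta$, as $n\to\infty$, $$\zeta_s(X_n,X)\to0.$$
   Context: $\mathcal{D}[0,1]$: càdlàg functions $[0,1]\to\mathbb{R}$ with the Skorokhod metric $d_{\mathrm{sk}}$ ($d_{\mathrm{sk}}(f,g)$ is the infimum of all $\varepsilon>0$ such that for some increasing bijection $\tau$ of $[0,1]$ one has $|f(t)-g(\tau(t))|<\varepsilon$ and $|\tau(t)-t|<\varepsilon$ for all $t$) and its Borel $\sigma$-algebra. In the case $B=\mathcal{D}[0,1]$, $\|\cdot\|$ denotes the uniform norm $\|\cdot\|_\infty$, and boundedness, operator norms and Fréchet differentiability refer to it; a separable real Banach space $(B,\|\cdot\|)$ carries its Borel $\sigma$-algebra. Recurrence: $K\ge1$ and $n_0\in\mathbb{N}$ are fixed; $A_1^{(n)},\dots,A_K^{(n)}$ are random continuous linear operators on $B$; $b^{(n)}$ is a $B$-valued random variable; $I^{(n)}=(I_1^{(n)},\dots,I_K^{(n)})$ is a vector of random integers in $\{0,\dots,n\}$; $(X_n^{(1)})_{n\ge0},\dots,(X_n^{(K)})_{n\ge0}$ are distributed like $(X_n)_{n\ge0}$; and $(A_1^{(n)},\dots,A_K^{(n)},b^{(n)},I^{(n)})$, $(X_n^{(1)})_{n\ge0},\dots,(X_n^{(K)})_{n\ge0}$ are independent. $\stackrel{d}{=}$ is equality in distribution. Random continuous linear operators: for a separable Banach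 space $B$, random variables in the space of continuous linear maps $B\to B$ with the $\sigma$-algebra generated by the evaluations $a\mapsto a(x)\in B$, $x\in B$. For $B=\mathcal{D}[0,1]$, random variables in the space of linear maps $\mathcal{D}[0,1]\to\mathcal{D}[0,1]$ that are continuous both with respect to $\|\cdot\|_\infty$ and as maps $(\mathcal{D}[0,1],d_{\mathrm{sk}})\to(\mathcal{D}[0,1],d_{\mathrm{sk}})$, with the $\sigma$-algebra generated by $a\mapsto\|a\|_{\mathrm{op}}$ and the evaluations $a\mapsto a(x)$. $\|a\|_{\mathrm{op}}=\sup_{\|x\|\le1}\|a(x)\|$. For a random operator $A$, $\|A\|_s:=\mathbf{E}[\|A\|_{\mathrm{op}}^s]^{1\wedge(1/s)}$; for a $B$-valued random variable $X$, $\|X\|_s:=\mathbf{E}[\|X\|^s]^{1\wedge(1/s)}$. Spaces of measures: $\mathcal{M}(B)$ is the set of Borel probability measures on $B$; $\mathcal{M}_s(B)$ is the set of $\mu\in\mathcal{M}(B)$ with $\int\|x\|^s\,d\mu(x)<\infty$. Put $m=\lceil s\rceil-1$, $\alpha=s-m$. For $\nu\in\mathcal{M}_s(B)$, $\mathcal{M}_s(\nu)$ is the set of $\mu\in\mathcal{M}_s(B)$ with $\int f(x,\dots,x)\,d\mu(x)=\int f(x,\dots,x)\,d\nu(x)$ for every bounded $k$-linear form $f$ on $B$ and every $1\le k\le m$. Zolotarev metric: $\mathcal{F}_s$ is the set of $m$-times continuously Fréchet differentiable $f:B\to\mathbb{R}$ with $\|D^mf(x)-D^mf(y)\|\le\|x-y\|^\alpha$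 for all $x,y\in B$, where an $m$-linear form $g$ has norm $\sup_{\|h_i\|\le1}|g(h_1,\dots,h_m)|$. $\zeta_s(X,Y)=\zeta_s(\mathcal{L}(X),\mathcal{L}(Y))=\sup_f|\mathbf{E}[f(X)-f(Y)]|$, the supremum being over $f\in\mathcal{F}_s$ for a Banach space $B$ and over those $f\in\mathcal{F}_s$ that are Borel measurable with respect to $d_{\mathrm{sk}}$ for $B=\mathcal{D}[0,1]$. *)

(* Defs.v *)
From HB Require Import structures.
From mathcomp Require Import all_boot all_order all_algebra.
From mathcomp Require Import all_classical all_reals all_analysis.
From mathcomp Require Import measurable_realfun lra.
Set Implicit Arguments. Unset Strict Implicit. Unset Printing Implicit Defensive.
Import Order.TTheory GRing.Theory Num.Theory.
Import numFieldNormedType.Exports.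
Local Open Scope classical_set_scope.
Local Open Scope ring_scope.

Notation unitI R := (set_type (`[0, 1]%classic : set R)).

Section cadlag.
Context {R : realType}.
Implicit Types (f g : unitI R -> R) (t : unitI R).

Definition right_nbhs t : set_system (unitI R) :=
  within (fun x : unitI R => \val t < \val x) (nbhs t).
Definition left_nbhs t : set_system (unitI R) :=
  within (fun x : unitI R => \val x < \val t) (nbhs t).

(* At the endpoints one of the one-sided filters contains the empty set, and
   the corresponding condition is void. *)
Definition is_cadlag f :=
  forall t, (f x @[x --> right_nbhs t] --> f t) /\
            (exists l : R, f x @[x --> left_nbhs t] --> l).

Definition cadlag_pred : {pred unitI R -> R} := [pred f | `[< is_cadlag f >]].

Lemma cadlag_submod_closed : submod_closed cadlag_pred.
Proof.
split=> [|a f g].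
  by apply/asboolP => t; split; [|exists 0]; exact: cvg_cst.
move=> /asboolP cf /asboolP cg; apply/asboolP => t.
have [fr [lf fl]] := cf t; have [gr [lg gl]] := cg t; split.
  by apply: cvgD => //; apply: cvgZr.
by exists (a *: lf + lg); apply: cvgD => //; apply: cvgZr.
Qed.

HB.instance Definition _ :=
  GRing.isSubmodClosed.Build R (unitI R -> R) cadlag_pred cadlag_submod_closed.

Record cadlag := Cadlag {
  cadlag_fun :> unitI R -> R ;
  cadlagP : cadlag_fun \in cadlag_pred }.

HB.instance Definition _ := [isSub for cadlag_fun].
HB.instance Definition _ := [Choice of cadlag by <:].
HB.instance Definition _ := [SubChoice_isSubLmodule of cadlag by <:].

Lemma cadlag_bounded (f : cadlag) : exists M : R, forall t, `|f t| <= M.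
Proof.
have /asboolP cf := cadlagP f.
have := @segment_compact R 0 1.
move=> /compact_near_coveringP /(_ R (pinfty_nbhs R)
  (fun M x => forall t, \val t = x -> `|f t| <= M)) H.
have {}H : \forall M \near +oo%R,
    `[0, 1]%classic `<=` (fun x => forall t, \val t = x -> `|f t| <= M).
  apply: H => x x01.
  pose t0 : unitI R := exist _ x (mem_set x01).
  have [fr [l fl]] := cf t0.
  pose C := Num.max (`|f t0| + 1) (`|l| + 1).
  have near_t0 : \forall t \near t0, `|f t| <= C.
    have := @cvgr_dist_le _ _ _ _ _ _ _ fr 1 ltr01.
    have := @cvgr_dist_le _ _ _ _ _ _ _ fl 1 ltr01.
    rewrite !near_withinE => Hl Hr.
    near=> t.
    have ft1 : `|f t0| + 1 <= C by rewrite /C le_max lexx.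
    have l1 : `|l| + 1 <= C by rewrite /C le_max lexx orbT.
    have Hlt : \val t < \val t0 -> `|l - f t| <= 1 by near: t; exact: Hl.
    have Hrt : \val t0 < \val t -> `|f t0 - f t| <= 1 by near: t; exact: Hr.
    case: (ltgtP (\val t) (\val t0)) => [/Hlt {}Hlt|/Hrt {}Hrt|tt0].
    - by have := ler_distD l 0 (f t); rewrite !sub0r !normrN; lra.
    - by have := ler_distD (f t0) 0 (f t); rewrite !sub0r !normrN; lra.
    - by rewrite (_ : t = t0); [lra|exact: val_inj].
  have [W [[V oV VW] Wt0 WC]] : exists W : set (unitI R),
      [/\ open W, W t0 & W `<=` [set t | `|f t| <= C]].
    by have := near_t0; rewrite /prop_near1 nbhsE /= => -[W [oW Wt0] WC]; exists W.
  exists (V, [set M | C <= M]); first split.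
  - apply: open_nbhs_nbhs; split => //.
    by have := Wt0; rewrite -VW.
  - by apply: nbhs_pinfty_ge; exact: num_real.
  move=> [x' M] [/= Vx' CM] t tx'.
  apply: le_trans CM; apply: WC; rewrite -VW /=; by rewrite -tx' in Vx'.
have [M HM] := filter_ex H.
by exists M => t; apply: (HM (\val t)) => //; exact: set_valP.
Unshelve. all: by end_near.
Qed.

Definition unorm (f : cadlag) : R := sup (range (fun t => `|f t|)).

Let unit0 : unitI R.
Proof. by exists 0; apply/mem_set; rewrite /= in_itv /= lexx ler01. Qed.

Lemma unorm_ub (f : cadlag) t : `|f t| <= unorm f.
Proof.
have [M fM] := cadlag_bounded f.
by apply: ub_le_sup; [exists M => _ [u _ <-]; exact: fM | exists t].
Qed.

Lemma unorm_le (f : cadlag) M : (forall t, `|f t| <= M) -> unorm f <= M.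
Proof.
move=> fM; apply: ge_sup; first by exists `|f unit0|, unit0.
by move=> _ [t _ <-].
Qed.

Lemma unormD (f g : cadlag) : unorm (f + g) <= unorm f + unorm g.
Proof.
apply: unorm_le => t.
by apply: le_trans (ler_normD _ _) _; apply: lerD; exact: unorm_ub.
Qed.

Lemma unormZ (a : R) (f : cadlag) : unorm (a *: f) = `|a| * unorm f.
Proof.
apply/eqP; rewrite eq_le; apply/andP; split.
  by apply: unorm_le => t; rewrite normrM ler_wpM2l// unorm_ub.
have [->|a0] := eqVneq a 0.
  by rewrite normr0 mul0r (le_trans _ (unorm_ub _ unit0)).
rewrite -ler_pdivlMl ?normr_gt0//; apply: unorm_le => t.
rewrite ler_pdivlMl ?normr_gt0// -normrM.
exact: (unorm_ub (a *: f) t).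
Qed.

Lemma unorm_eq0 (f : cadlag) : unorm f = 0 -> f = 0.
Proof.
move=> f0; apply: val_inj; apply/funext => t /=.
by apply/eqP; rewrite -normr_le0 -f0; exact: unorm_ub.
Qed.

HB.instance Definition _ := Lmodule_isNormed.Build R cadlag unormD unormZ unorm_eq0.

End cadlag.
Arguments cadlag : clear implicits.

Section skorokhod.
Context {R : realType}.

Definition increasing_bijection (tau : unitI R -> unitI R) :=
  bijective tau /\ forall t u, \val t < \val u -> \val (tau t) < \val (tau u).

Definition sk_set (f g : cadlag R) : set R :=
  [set e | 0 < e /\ exists2 tau, increasing_bijection tau &
    forall t, `|f t - g (tau t)| < e /\ `|\val (tau t) - \val t| < e].

Definition d_sk (f g : cadlag R) : R := inf (sk_set f g).

Lemma inc_bij_inv tau : increasing_bijection tau ->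
  exists2 rho, increasing_bijection rho & cancel rho tau.
Proof.
move=> [[rho rhoK tauK] incr]; exists rho => //; split; first by exists tau.
move=> t u; rewrite -{1}(tauK t) -{1}(tauK u).
case: (ltgtP (\val (rho t)) (\val (rho u))) => // [/incr/ltW|/val_inj ->].
  by rewrite leNgt => /negbTE ->.
by rewrite ltxx.
Qed.

Lemma inc_bij_comp tau rho : increasing_bijection tau ->
  increasing_bijection rho -> increasing_bijection (rho \o tau).
Proof.
move=> [btau itau] [brho irho]; split; first exact: bij_comp.
by move=> t u /itau/irho.
Qed.

Lemma sk_set_neq0 f g : sk_set f g !=set0.
Proof.
exists (`|f - g| + 1); split; first by rewrite ltr_wpDl.
exists id; first by split => //; exists id.
move=> t; split.
  by rewrite (le_lt_trans (unorm_ub (f - g) t)) ?ltrDl.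
by rewrite subrr normr0 ltr_wpDl.
Qed.

Lemma sk_set_lb f g : has_lbound (sk_set f g).
Proof. by exists 0 => e [/ltW]. Qed.

Lemma sk_set_gt f g e e' : e <= e' -> sk_set f g e -> sk_set f g e'.
Proof.
move=> ee' [e0 [tau itau H]]; split; first exact: lt_le_trans ee'.
by exists tau => // t; have [? ?] := H t; split; apply: lt_le_trans ee'.
Qed.

Lemma d_sk_lt f g e : d_sk f g < e -> sk_set f g e.
Proof.
move=> /(inf_lt (sk_set_neq0 f g))[e' Se' /ltW e'e]; exact: sk_set_gt Se'.
Qed.

Lemma d_sk_le f g e : sk_set f g e -> d_sk f g <= e.
Proof. exact: (ge_inf (sk_set_lb f g)). Qed.

Lemma d_sk_xx f : d_sk f f = 0.
Proof.
apply/eqP; rewrite eq_le; apply/andP; split; last first.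
  by apply: lb_le_inf; [exact: sk_set_neq0|move=> e [/ltW]].
apply/ler_addgt0Pl => e e0; rewrite addr0; apply: d_sk_le; split => //.
exists id; first by split => //; exists id.
by move=> t; rewrite !subrr normr0.
Qed.

Lemma sk_set_sym f g e : sk_set f g e -> sk_set g f e.
Proof.
move=> [e0 [tau /inc_bij_inv[rho irho rhoK] H]]; split => //.
exists rho => // t; have [] := H (rho t).
by rewrite rhoK distrC => ? ?; rewrite (distrC (\val (rho t))).
Qed.

Lemma d_sk_sym f g : d_sk f g = d_sk g f.
Proof. by congr inf; apply/seteqP; split=> e; exact: sk_set_sym. Qed.

Lemma sk_set_triangle f g h e e' :
  sk_set f g e -> sk_set g h e' -> sk_set f h (e + e').
Proof.
move=> [e0 [tau itau H]] [e'0 [rho irho H']]; split; first exact: addr_gt0.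
exists (rho \o tau); first exact: inc_bij_comp.
move=> t; have [? ?] := H t; have [? ?] := H' (tau t); split.
  by rewrite (le_lt_trans (ler_distD (g (tau t)) _ _))// ltrD.
by rewrite (addrC e) (le_lt_trans (ler_distD (\val (tau t)) _ _))// ltrD.
Qed.

Lemma d_sk_triangle g f h : d_sk f h <= d_sk f g + d_sk g h.
Proof.
apply/ler_addgt0Pl => e e0.
have e20 : 0 < e / 2 by rewrite divr_gt0.
have /d_sk_lt H1 : d_sk f g < d_sk f g + e / 2 by rewrite ltrDl.
have /d_sk_lt H2 : d_sk g h < d_sk g h + e / 2 by rewrite ltrDl.
by have /d_sk_le := sk_set_triangle H1 H2; lra.
Qed.

Lemma unitI_ge0 (t : unitI R) : 0 <= \val t :> R.
Proof. by have := set_valP t; rewrite /= in_itv => /andP[]. Qed.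

Lemma unitI_le1 (t : unitI R) : \val t <= 1 :> R.
Proof. by have := set_valP t; rewrite /= in_itv => /andP[]. Qed.

Lemma right_cadlag (f : cadlag R) (t : unitI R) e : 0 < e -> exists2 d : R, 0 < d &
  forall u : unitI R, \val t < \val u -> \val u < \val t + d -> `|f t - f u| < e.
Proof.
move=> e0; have /asboolP/(_ t)[fr _] := cadlagP f.
have := @cvgr_dist_lt _ _ _ _ _ _ _ fr e e0.
rewrite near_withinE => H0.
have [d /= d0 H] := iffLR (@nbhs_ballP R (unitI R) _ _) (H0 _); exists d => // u tu ud.
by apply: H => //; change (`|\val t - \val u| < d); rewrite ltr_distlC ud andbT; apply: lt_trans tu; rewrite ltrBlDr ltrDl.
Qed.

Lemma d_sk_eq0 f g : d_sk f g = 0 -> f = g.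
Proof.
move=> fg0; apply: val_inj; apply/funext => t.
have fg e : 0 < e -> sk_set f g e by move=> e0; apply: d_sk_lt; rewrite fg0.
have t0 := unitI_ge0 t.
apply/eqP; rewrite -subr_eq0 -normr_le0; apply/ler_addgt0Pl => e e0.
rewrite addr0; have [t1|t1] := ltP (\val t) 1; last first.
  have [_ [tau [[rho rhoK tauK] incr] /(_ t)[H _]]] := fg _ e0.
  suff tE : tau t = t by move: H; rewrite tE => /ltW.
  have [tt|tt|tt] := ltgtP (\val (rho t)) (\val t); last first.
  - by rewrite -{1}(val_inj tt) tauK.
  - by have := le_lt_trans t1 tt; rewrite ltNge unitI_le1.
  - have := incr _ _ tt; rewrite tauK => tt'.
    by have := le_lt_trans t1 tt'; rewrite ltNge unitI_le1.
have e30 : 0 < e / 3 by rewrite divr_gt0.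
have [d1 d10 H1] := right_cadlag f t e30.
have [d2 d20 H2] := right_cadlag g t e30.
have [d [d0 dd1 dd2 dt]] : exists d : R,
    [/\ 0 < d, d <= d1, d <= d2 & d <= 1 - \val t].
  exists (Num.min (Num.min d1 d2) (1 - \val t)).
  by rewrite !lt_min d10 d20/= subr_gt0 !ge_min !lexx !orbT.
have x01 : \val t + d / 2 \in (`[0, 1]%classic : set R).
  apply/mem_set; rewrite /= in_itv /= addr_ge0 ?divr_ge0 ?(ltW d0)//= -lerBrDl.
  by apply: le_trans dt; lra.
pose x : unitI R := @exist R _ _ x01.
have xE : \val x = \val t + d / 2 by [].
have e'0 : 0 < Num.min (e / 3) (d / 2) by rewrite lt_min e30/= divr_gt0.
have [_ [tau _ /(_ x)[]]] := fg _ e'0.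
rewrite !lt_min => /andP[fx _] /andP[_]; rewrite ltr_distl => /andP[ux1 ux2].
have f1 : `|f t - f x| < e / 3 by apply: H1; rewrite xE ?ltrDl ?ltrD2l; lra.
have g1 : `|g t - g (tau x)| < e / 3.
  apply: H2; first by move: ux1; rewrite xE addrK.
  by move: ux2; rewrite xE -addrA -splitr => /lt_le_trans; apply; rewrite lerD2l.
have := ler_distD (f x) (f t) (g t).
have := ler_distD (g (tau x)) (f x) (g t).
rewrite (distrC (g (tau x))); lra.
Qed.
End skorokhod.

Definition skorokhod (R : realType) : Type := cadlag R.
HB.instance Definition _ (R : realType) := Choice.on (skorokhod R).
HB.instance Definition _ (R : realType) := isMetric.Build R (skorokhod R)
  d_sk_xx d_sk_eq0 d_sk_sym d_sk_triangle.

Definition separable (T : topologicalType) : Prop :=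
  exists2 S : set T, countable S & dense S.

Inductive ambient (R : realType) : Type :=
| Banach (V : completeNormedModType R) of separable V
| Skorokhod.
Arguments Skorokhod {R}.

Section ambient_space.
Context {R : realType}.
Implicit Type B : ambient R.

(* The norm and the Frechet calculus on D[0,1] are those of the uniform norm,
   while its Borel sets are those of the Skorokhod metric. *)
Definition ambient_normed B : normedModType R :=
  match B with Banach V _ => V | Skorokhod => cadlag R end.

Definition ambient_open B : set (set (ambient_normed B)) :=
  match B with
  | Banach V _ => @open V
  | Skorokhod => @open (skorokhod R)
  end.

Definition carrier B : Type := ambient_normed B.
HB.instance Definition _ B := NormedModule.copy (carrier B) (ambient_normed B).
HB.instance Definition _ B :=
  Measurable.copy (carrier B) (g_sigma_algebraType (@ambient_open B)).

Definition op_continuous B : (carrier B -> carrier B) -> Prop :=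
  match B return (carrier B -> carrier B) -> Prop with
  | Banach V _ => fun a => continuous (a : V -> V)
  | Skorokhod => fun a => continuous (a : cadlag R -> cadlag R) /\
                          continuous (a : skorokhod R -> skorokhod R)
  end.

Record operator B := Operator {
  op_fun :> carrier B -> carrier B ;
  op_linear : linear op_fun ;
  op_cont : op_continuous op_fun }.

Lemma op0_linear B : linear (fun _ : carrier B => 0 : carrier B).
Proof. by move=> a x y; rewrite scaler0 addr0. Qed.

Lemma op0_cont B : op_continuous (fun _ : carrier B => 0 : carrier B).
Proof.
case: B => [V sV|] /=; first by move=> x; exact: cvg_cst.
split=> x.
  exact: (@cvg_cst (cadlag R) (0 : cadlag R) (cadlag R) (nbhs x)).
exact: (@cvg_cst (skorokhod R) (0 : cadlag R) (skorokhod R)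
  (nbhs (x : skorokhod R))).
Qed.

HB.instance Definition _ B := gen_eqMixin (operator B).
HB.instance Definition _ B := gen_choiceMixin (operator B).
HB.instance Definition _ B :=
  isPointed.Build (operator B) (Operator (@op0_linear B) (@op0_cont B)).

(* Total in the map, since it is also applied to differences of operators. *)
Definition opnorm B (a : carrier B -> carrier B) : \bar R :=
  ereal_sup [set (`|a x|)%:E | x in [set x | `|x| <= 1]].

Definition evaluation_events B : set (set (operator B)) :=
  \bigcup_(x : carrier B)
    preimage_set_system setT (fun a : operator B => a x) measurable.

Definition opnorm_events B : set (set (operator B)) :=
  preimage_set_system setT (fun a : operator B => opnorm a) measurable.

Definition operator_events B : set (set (operator B)) :=
  match B with
  | Banach _ _ => @evaluation_events B
  | Skorokhod => @evaluation_events B `|` @opnorm_events B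
  end.
HB.instance Definition _ B :=
  Measurable.copy (operator B) (g_sigma_algebraType (@operator_events B)).

End ambient_space.

Section zolotarev.
Context {R : realType}.

Definition kform (V : normedModType R) (k : nat) := ('I_k -> V) -> R.

Definition multilinear (V : normedModType R) k (g : kform V k) : Prop :=
  forall (i : 'I_k) (v : 'I_k -> V) (a : R) (x y : V),
    let ins z := fun j => if j == i then z else v j in
    g (ins (a *: x + y)) = a * g (ins x) + g (ins y).

Definition formnorm (V : normedModType R) k (g : kform V k) : \bar R :=
  ereal_sup [set (`|g h|)%:E | h in [set h | forall i, `|h i| <= 1]].

Definition bounded_form (V : normedModType R) k (g : kform V k) : Prop :=
  multilinear g /\ (formnorm g < +oo)%E.

Definition vcons (V : Type) k (h : V) (v : 'I_k -> V) : 'I_k.+1 -> V :=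
  fun i => if unlift ord0 i is Some j then v j else h.

(* [D k x] is the [k]-th Frechet derivative at [x], seen as a bounded
   [k]-linear form through L(V, L^k(V, R)) = L^(k+1)(V, R). *)
Definition derivative_tower (V : normedModType R) (m : nat) (f : V -> R)
    (D : forall k, V -> kform V k) : Prop :=
  [/\ forall x v, D 0%N x v = f x,
      forall k x, (k <= m)%N -> bounded_form (D k x),
      forall k x e, (k < m)%N -> 0 < e -> \forall h \near (0 : V),
        (formnorm (fun v => D k (x + h)%R v - D k x v - D k.+1 x (vcons h v))%R
           <= (e * `|h|)%:E)%E &
      forall x e, 0 < e -> \forall y \near x,
        (formnorm (fun v => D m y v - D m x v)%R <= e%:E)%E].

(* [s = m + alpha] with [m] a natural number and [0 < alpha <= 1]. *)
Definition zorder (s : R) : nat := `|Num.ceil s|%N.-1.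
Definition zexponent (s : R) : R := s - (zorder s)%:R.

Definition zolotarev_class (V : normedModType R) (s : R) : set (V -> R) :=
  [set f | exists2 D, derivative_tower (zorder s) f D &
    forall x y, (formnorm (fun v => D (zorder s) x v - D (zorder s) y v)%R
                 <= (`|x - y| `^ zexponent s)%:E)%E].

Variable B : ambient R.

Definition test_functions (s : R) : set (carrier B -> R) :=
  match B return set (carrier B -> R) with
  | Banach V _ => @zolotarev_class V s
  | Skorokhod => [set f | @zolotarev_class (cadlag R) s f /\
                   measurable_fun [set: carrier Skorokhod] f]
  end.

Definition zeta (s : R) (mu nu : probability (carrier B) R) : \bar R :=
  ereal_sup [set `| \int[mu]_x (f x)%:E - \int[nu]_x (f x)%:E |%E
            | f in test_functions s].

Definition Ms (s : R) : set (probability (carrier B) R) :=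
  [set mu : probability (carrier B) R | (\int[mu]_x (`|x| `^ s)%:E < +oo)%E].

Definition Ms_at (s : R) (nu : probability (carrier B) R) :
    set (probability (carrier B) R) :=
  [set mu : probability (carrier B) R | Ms s mu /\
    forall k (g : kform (carrier B) k), (1 <= k <= zorder s)%N ->
      bounded_form g ->
      (\int[mu]_x (g (fun=> x))%:E = \int[nu]_x (g (fun=> x))%:E)%E].

End zolotarev.

Section iid.
Context {d} {T : measurableType d} {R : realType}.

Definition tcons n (p : T * n.-tuple T) : n.+1.-tuple T := [tuple of p.1 :: p.2].

Lemma measurable_tcons n : measurable_fun setT (@tcons n).
Proof. exact: measurable_cons. Qed.

HB.instance Definition _ n := isMeasurableFun.Build _ _ _ _ (@tcons n)
  (@measurable_tcons n).

Fixpoint iid_law (mu : probability T R) (n : nat) :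
    probability (n.-tuple T) R :=
  match n with
  | 0 => \d_[tuple]
  | n'.+1 => distribution (mu \x iid_law mu n')%E (@tcons n')
  end.
End iid.

Section random_objects.
Context {R : realType} {B : ambient R}.
Context {d} {T : measurableType d} (P : probability T R).
Local Open Scope ereal_scope.

(* The moments, operator norms and suprema below are extended reals, so that no
   finiteness is hidden in a default value. *)
Definition norm_s (s : R) (X : T -> carrier B) : \bar R :=
  (\int[P]_w (`|X w| `^ s)%:E) `^ (Num.min 1 s^-1)%R.

Definition opnorm_s (s : R) (A : T -> carrier B -> carrier B) : \bar R :=
  (\int[P]_w (opnorm (A w) `^ s)) `^ (Num.min 1 s^-1)%R.

(* Mutual independence of a finite family of sigma-algebras. *)
Definition independent (I : finType) (F : I -> set (set T)) : Prop :=
  forall (J : {set I}) (E : I -> set T), (forall i, F i (E i)) ->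
    P (\bigcap_(i in [set` J]) E i) = \prod_(i in J) P (E i).

Definition process_events (X : nat -> {RV P >-> carrier B}) : set (set T) :=
  <<s \bigcup_n preimage_set_system setT (X n) measurable >>.

Definition coefficient_events (K : nat) (A : 'I_K -> {RV P >-> operator B})
    (b : {RV P >-> carrier B}) (I : 'I_K -> {RV P >-> nat}) : set (set T) :=
  <<s (\bigcup_r preimage_set_system setT (A r) measurable) `|`
      preimage_set_system setT b measurable `|`
      (\bigcup_r preimage_set_system setT (I r) measurable) >>.

Definition path_events : set (set (nat -> carrier B)) :=
  <<s \bigcup_n preimage_set_system setT
        (fun x : nat -> carrier B => x n) measurable >>.

Definition same_process_law (X Y : nat -> {RV P >-> carrier B}) : Prop :=
  forall E, path_events E ->
    P [set w | E (fun n => X n w)] = P [set w | E (fun n => Y n w)].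

(* The law of [\sum_r A_r Z^(r) + b] with [(A_1, ..., A_K, b)], [Z^(1)], ...,
   [Z^(K)] independent and [Z^(r)] of law [mu], realised on the product space
   [T * carrier B ^ K], as a function on the Borel sets. *)
Definition smoothing (K : nat) (A : 'I_K -> {RV P >-> operator B})
    (b : {RV P >-> carrier B}) (mu : probability (carrier B) R) :
    set (carrier B) -> \bar R :=
  fun U => (P \x iid_law mu K)
    [set p | U (\sum_(r < K) A r p.1 (tnth p.2 r) + b p.1)%R].

Definition recursion_rhs (K : nat) (A : 'I_K -> {RV P >-> operator B})
    (b : {RV P >-> carrier B}) (I : 'I_K -> {RV P >-> nat})
    (X : 'I_K -> nat -> {RV P >-> carrier B}) (w : T) : carrier B :=
  (\sum_(r < K) A r w (X r (I r w) w) + b w)%R.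

Definition coefficient_distance (s : R) (n0 K : nat)
    (An : 'I_K -> {RV P >-> operator B}) (bn : {RV P >-> carrier B})
    (In : 'I_K -> {RV P >-> nat})
    (A : 'I_K -> {RV P >-> operator B}) (b : {RV P >-> carrier B}) : \bar R :=
  norm_s s (fun w => bn w - b w)%R +
  \sum_(r < K)
    (opnorm_s s (fun w x => An r w x - A r w x)%R +
     opnorm_s s (fun w x => \1_[set w | (In r w <= n0)%N] w *: An r w x)%R).

End random_objects.

(* Main.v *)
(* Replace the X^(r)_{I_r} with I_r >= n0 one after the other by independent
   variables of law eta. Since f (a x + k) / |a|^s is a test function whenever f is
   one, the r-th replacement changes E f by at most E[|A_r|^s z_{I_r}], where
   z_i = zeta_s(X_i, X). The final sum Q_n is coupled with the fixed-point equation
   of eta, and E|Q_n - X|^s -> 0. For f in F_s the Taylor remainder R at 0 satisfies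
   |R x - R y| <= e|y|^s + C|x - y|^s with C depending only on e and s, while the
   polynomial parts have equal means, because finiteness of zeta_s(X_n, Q_n) forces
   equality of all Taylor moments (scale f by t -> 0). Hence
   z_n <= sum_{i<=n} a_{n,i} z_i + o(1), where the rows have sums eventually below
   some q < 1 and a_{n,i} -> 0 for fixed i; this gives z_n -> 0.
   In D[0,1] addition is not continuous for the Skorokhod metric; its measurability
   comes from step-function approximations on a grid. *)

Require Import Defs.
From HB Require Import structures.
From mathcomp Require Import all_boot all_order all_algebra.
From mathcomp Require Import all_classical all_reals all_analysis.
From mathcomp Require Import measurable_realfun lra ring.
Set Implicit Arguments. Unset Strict Implicit. Unset Printing Implicit Defensive.
Import Order.TTheory GRing.Theory Num.Theory.
Import numFieldNormedType.Exports.
Local Open Scope classical_set_scope.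
Local Open Scope ring_scope.

(** * Measurability in the ambient space *)

(** Only indices i >= n0 are replaced because below n0 nothing but a finite s-th moment is known:
    the moments need not match those of eta, and zeta_s(X_i, X) may be infinite. These terms stay in
    Q_n, where the index condition makes them small. The index I_r is random and may depend on the
    coefficients, so each factor of the product space carries a whole path of (X_n) together with
    one point of law eta. All intermediate sums then live on the same space, and one factor can be
    integrated out by Fubini. In D[0,1] norm and Borel sets belong to different topologies.
    Evaluation at a time, addition and the Taylor forms of a test function are not d_sk-continuous
    in general; their measurability is obtained by countable approximation. The operator norm of
    A_r^(n) - A_r need not be measurable. Its integral is a lower integral, hence not additive, so
    in the estimates it stands only on the larger side and is compared with a measurable
    minorant. *)

Lemma measurable_fun_countable_switch d d' (T : measurableType d)
    (T' : measurableType d') (I : countType) (N : T -> I) (F : I -> T -> T') :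
  (forall i, measurable (N @^-1` [set i])) ->
  (forall i, measurable_fun setT (F i)) ->
  measurable_fun setT (fun w => F (N w) w).
Proof.
move=> mN mF _ Y mY; rewrite setTI.
rewrite (_ : _ @^-1` Y = \bigcup_i (N @^-1` [set i] `&` F i @^-1` Y)); last first.
  apply/seteqP; split=> [w Yw|w [i _ [/= <-]]//]; by exists (N w).
apply: countable_bigcupT_measurable => [|i]; first exact: countableP.
apply: measurableI; first exact: mN.
by rewrite -[_ @^-1` _]setTI; exact: mF.
Qed.

Section ambient_distance.
Context {R : realType}.
Implicit Type B : ambient R.

(* A metric inducing the topology that generates the Borel sets of B. *)
Definition amb_dist B : carrier B -> carrier B -> R :=
  match B return carrier B -> carrier B -> R with
  | Banach V _ => fun x y : V => `|x - y|
  | Skorokhod => d_sk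
  end.

Lemma amb_dist_sym B (x y : carrier B) : amb_dist x y = amb_dist y x.
Proof. by case: B x y => [V sV|] x y /=; [rewrite distrC|exact: d_sk_sym]. Qed.

Lemma amb_dist_triangle B (y x z : carrier B) :
  amb_dist x z <= amb_dist x y + amb_dist y z.
Proof.
by case: B y x z => [V sV|] y x z /=; [exact: ler_distD|exact: d_sk_triangle].
Qed.

Lemma ambient_openP B (U : set (carrier B)) : ambient_open U <->
  forall x, U x -> exists2 e, 0 < e & forall y, amb_dist x y < e -> U y.
Proof.
case: B U => [V sV|] U /=; rewrite openE /interior.
  split=> H x /H.
    by move/nbhs_ballP => [e /= e0 xe]; exists e => // y; rewrite -ball_normE /= in xe *; exact: xe.
  by move=> [e e0 xe]; apply/nbhs_ballP; exists e => //=; rewrite -ball_normE.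
split=> H x /H.
  move=> /(@nbhs_ballP R (skorokhod R))[e /= e0 xe].
  by exists e => // y; exact: xe.
by move=> [e e0 xe]; apply/(@nbhs_ballP R (skorokhod R)); exists e.
Qed.

Lemma ambient_open_measurable B (U : set (carrier B)) :
  (forall x, U x -> exists2 e, 0 < e & forall y, amb_dist x y < e -> U y) ->
  measurable U.
Proof. by move=> /ambient_openP; exact: sub_sigma_algebra. Qed.

Lemma measurable_amb_ball B (x : carrier B) e :
  measurable [set y | amb_dist x y < e].
Proof.
apply: ambient_open_measurable => y /= xy.
exists (e - amb_dist x y); first by rewrite subr_gt0.
by move=> z yz; have := amb_dist_triangle y x z; lra.
Qed.

Lemma measurable_fun_ambient d (T : measurableType d) B (F : T -> carrier B) :
  (forall U : set (carrier B), ambient_open U -> measurable (F @^-1` U)) ->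
  measurable_fun setT F.
Proof.
move=> H; apply: (@measurability _ _ T (carrier B) setT F (@ambient_open R B)).
  by [].
move=> _ [U oU <-]; by rewrite setTI; exact: H.
Qed.

(** The sets [W k] exhaust the open set U and are open themselves, because the radius is only asked
    to exceed 1/(k+1). Hence G w lies in U iff, for some k, F n w lies in [W k] for all large n. *)
Lemma measurable_fun_amb_lim d (T : measurableType d) B
    (F : nat -> T -> carrier B) (G : T -> carrier B) :
  (forall n, measurable_fun setT (F n)) ->
  (forall w e, 0 < e -> \forall n \near \oo, amb_dist (G w) (F n w) < e) ->
  measurable_fun setT G.
Proof.
move=> mF FG; apply: measurable_fun_ambient => U /ambient_openP oU.
pose W k := [set x : carrier B | exists2 e, k.+1%:R^-1 < e &
   forall y, amb_dist x y < e -> U y].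
have mW k : measurable (W k).
  apply: ambient_open_measurable => x [e]; rewrite /W /=.
  move: (k.+1%:R^-1 : R) => a ke xU.
  exists (e - (a + e) / 2); first lra.
  move=> y xy; exists ((a + e) / 2); first lra.
  by move=> z yz; apply: xU; have := amb_dist_triangle y x z; lra.
rewrite (_ : _ @^-1` U =
    \bigcup_k \bigcup_N \bigcap_(n in [set n | (N <= n)%N]) F n @^-1` W k).
  apply: bigcupT_measurable => k; apply: bigcupT_measurable => N.
  apply: bigcap_measurable => [|n _]; first by exists N => /=.
  by rewrite -[_ @^-1` _]setTI; exact: mF.
apply/seteqP; split => w /=.
  move=> /oU[e e0 GU].
  have [k ke] : exists k, k.+1%:R^-1 < e / 2.
    have e20 : 0 < e / 2 by lra.
    have [k _ H] := near_infty_natSinv_lt (PosNum e20).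
    by exists k; apply: (H k) => /=.
  have [|N _ HN] := FG w (e / 2); first lra.
  exists k => //; exists N => // n /HN /= GF; exists (e / 2) => // y Fy.
  by apply: GU; have := amb_dist_triangle (F n w) (G w) y; lra.
move=> [k _ [N _ H]].
have [M _ HM] := FG w k.+1%:R^-1 ltac:(by rewrite invr_gt0).
have [e ke] := H (maxn N M) (leq_maxl _ _); apply.
by rewrite amb_dist_sym; apply: lt_trans ke; apply: HM; exact: leq_maxr.
Qed.

Lemma measurable_fun_amb_continuous B B' (F : carrier B -> carrier B') :
  (forall x e, 0 < e -> exists2 r, 0 < r &
     forall y, amb_dist x y < r -> amb_dist (F x) (F y) < e) ->
  measurable_fun setT F.
Proof.
move=> cF; apply: measurable_fun_ambient => U /ambient_openP oU.
apply: ambient_open_measurable => x /oU[e e0 xU].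
by have [r r0 H] := cF x e e0; exists r => // y /H/xU.
Qed.

(** In D[0,1] the sublevel sets are d_sk-open: a time change does not alter the supremum, so
    d_sk-close functions have close uniform norms. *)
Lemma measurable_fun_norm B : measurable_fun setT (fun x : carrier B => `|x|).
Proof.
apply: (measurability _ (RGenInftyO.measurableE R)) => _ [_ [r ->] <-].
rewrite setTI; apply: ambient_open_measurable => x.
rewrite /= in_itv /= => xr.
exists ((r - `|x|) / 2); first lra.
move=> y; rewrite in_itv /=; case: B x xr y => [V sV|] x xr y /=.
  have := lerB_dist (y : V) x; rewrite distrC => + xy.
  lra.
move=> /d_sk_lt[_ [tau [[rho rhoK tauK] _] H]].
have {}xr : unorm x < r := xr; change (unorm y < r).
apply: (@le_lt_trans _ _ ((r + unorm x) / 2)); last lra.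
apply: unorm_le => t; have [] := H (rho t).
rewrite tauK distrC => + _.
change (`|y t - x (rho t)| < (r - unorm x) / 2 -> `|y t| <= (r + unorm x) / 2).
by have := lerB_dist (y t) (x (rho t)); have := unorm_ub x (rho t); lra.
Qed.

Lemma measurable_fun_ambZ B (c : R) :
  measurable_fun setT (fun x : carrier B => c *: x).
Proof.
apply: measurable_fun_amb_continuous => x e e0.
have c0 : 0 < `|c| + 1 by rewrite ltr_wpDl.
have e1 : 0 < e / (`|c| + 1) by rewrite divr_gt0.
case: B x => [V sV|] x.
  exists (e / (`|c| + 1)) => // y xy; change (`|c *: x - c *: y : V| < e).
  rewrite -scalerBr normrZ; move: xy; rewrite ltr_pdivlMr//=.
  by apply: le_lt_trans; rewrite mulrC ler_wpM2l// lerDl.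
exists (Num.min e (e / (`|c| + 1)) / 2); first by rewrite divr_gt0// lt_min e0.
move=> y /= /d_sk_lt[_ [tau itau H]].
have : sk_set (c *: x : cadlag R) (c *: y) (e / 2).
  split; first lra.
  exists tau => // t; have [H1 H2] := H t; split.
    change (`|c * x t - c * y (tau t)| < e / 2); rewrite -mulrBr normrM.
    have : Num.min e (e / (`|c| + 1)) / 2 <= e / 2 / (`|c| + 1).
      by rewrite mulrAC ler_pM2r// ge_min lexx orbT.
    move=> /(lt_le_trans H1); rewrite ltr_pdivlMr//=.
    by apply: le_lt_trans; rewrite mulrC ler_wpM2l// lerDl.
  by apply: (lt_le_trans H2); rewrite ler_pM2r// ge_min lexx.
by move/d_sk_le => /le_lt_trans; apply; lra.
Qed.

End ambient_distance.

(** * Step-function approximation in the Skorokhod metric *)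

Section step_functions.
Context {R : realType}.

Lemma clamp_subproof (x : R) : Num.max 0 (Num.min x 1) \in (`[0, 1]%classic : set R).
Proof.
by apply/mem_set; rewrite /= in_itv /= le_max lexx/= ge_max ler01 ge_min lexx orbT.
Qed.

(** Total, so that real grid points serve as times without a membership proof. *)
Definition clamp (x : R) : unitI R := @exist R _ _ (clamp_subproof x).

Lemma val_clamp (x : R) : 0 <= x <= 1 -> \val (clamp x) = x.
Proof. by move=> /andP[x0 x1]; rewrite /= (min_idPl x1) (max_idPr x0). Qed.

Lemma clampK (t : unitI R) : clamp (\val t) = t.
Proof. by apply: val_inj; apply: val_clamp; rewrite unitI_ge0 unitI_le1. Qed.

Lemma near_unitI (t : unitI R) (P : set (unitI R)) (e : R) : 0 < e ->
  (forall u : unitI R, `|\val t - \val u| < e -> P u) -> nbhs t P.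
Proof.
move=> e0 H; apply: (iffRL (@nbhs_ballP R (unitI R) _ _)).
by exists e => //= u tu; apply: H.
Qed.

(** The time 1 forms a cell of its own, so a step function on this grid has n+2 values. *)
Definition step_val n (c : int -> R) (t : unitI R) : R :=
  c (Num.floor (n.+1%:R * \val t)).

Lemma step_val_cadlag n c : step_val n c \in cadlag_pred.
Proof.
apply/asboolP => t; set N : R := n.+1%:R.
have N0 : 0 < N by rewrite ltr0n.
split.
  apply: cvg_near_cst; rewrite near_withinE.
  have /andP[k1 k2] := floor_itv (N * \val t).
  set k := Num.floor _ in k1 k2.
  apply: (@near_unitI _ _ ((k + 1)%:~R / N - \val t)).
    by rewrite subr_gt0 ltr_pdivlMr// mulrC.
  move=> u; rewrite distrC ltr_distl => /andP[_ uk] tu; rewrite /step_val; congr c.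
  apply: floor_def; apply/andP; split.
    by apply: (le_trans k1); rewrite ler_pM2l// ltW.
  by rewrite mulrC -ltr_pdivlMr//; move: uk; rewrite addrC subrK.
have /andP[k1 k2] := ceil_itv (N * \val t).
set k := Num.ceil _ in k1 k2.
(* Just to the left of t the floor of N u is the ceiling of N t minus 1, also when N t is an
   integer. *)
exists (c (k - 1)); apply: cvg_near_cst; rewrite near_withinE.
apply: (@near_unitI _ _ (\val t - (k - 1)%:~R / N)).
  by rewrite subr_gt0 ltr_pdivrMr// mulrC.
move=> u; rewrite ltr_distlC => /andP[uk _] ut; rewrite /step_val; congr c.
apply: floor_def; rewrite subrK; apply/andP; split.
  by move: uk; rewrite subKr ltr_pdivrMr// mulrC => /ltW.
by apply: lt_le_trans k2; rewrite ltr_pM2l.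
Qed.

Definition step n c : cadlag R := Cadlag (step_val_cadlag n c).

Definition grid_step n (f : cadlag R) : cadlag R :=
  step n (fun k => f (clamp (k%:~R / n.+1%:R))).

(** Time changes are built on the whole line, where they can be prolonged piece by piece, and
    restricted to [0,1] only in [grid_step_near]. *)
Definition increasing_map (g : R -> R) :=
  (forall x y, x < y -> g x < g y) /\ (forall y, exists x, g x = y).

Lemma increasing_map_glue (g : R -> R) x y u v : increasing_map g -> g x = u ->
  x < y -> u < v -> exists2 h, increasing_map h &
  [/\ forall t, t <= x -> h t = g t, h y = v &
      forall t, x <= t -> h t = u + (t - x) * ((v - u) / (y - x))].
Proof.
move=> [gi gs] gx xy uv.
have s0 : 0 < (v - u) / (y - x) by rewrite divr_gt0// subr_gt0.
set s := (v - u) / (y - x) in s0 *.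
exists (fun t => if t <= x then g t else u + (t - x) * s); last first.
  split=> [t ->//| |t].
    by rewrite leNgt xy/= /s mulrC divfK ?subrKC// gt_eqF// subr_gt0.
  rewrite le_eqVlt => /predU1P[<-|xt]; first by rewrite lexx subrr mul0r addr0.
  by rewrite leNgt xt.
split.
  move=> a b ab; case: (leP a x) => ax; case: (leP b x) => bx.
  - exact: gi.
  - apply: (@le_lt_trans _ _ u); last by rewrite ltrDl mulr_gt0// subr_gt0.
    by move: ax; rewrite le_eqVlt => /predU1P[->|/gi/ltW]; rewrite gx.
  - by have := lt_trans ab (le_lt_trans bx ax); rewrite ltxx.
  - by rewrite ltrD2l ltr_pM2r// ltrD2r.
move=> w; have [wu|uw] := leP w u.
  have [z gz] := gs w; exists z; case: (leP z x) => // xz.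
  by move: (gi _ _ xz); rewrite gx gz ltNge wu.
exists (x + (w - u) / s); case: leP => [|_].
  by rewrite gerDl leNgt divr_gt0// subr_gt0.
by rewrite (addrC x) addrK divfK ?subrKC// gt_eqF.
Qed.

Definition grid_ceil n (x : R) : R := (Num.ceil (n.+1%:R * x))%:~R / n.+1%:R.

Lemma grid_ceil_bounds n (x : R) : x <= grid_ceil n x < x + n.+1%:R^-1.
Proof.
have N0 : 0 < n.+1%:R :> R by rewrite ltr0n.
have /andP[k1 k2] := ceil_itv (n.+1%:R * x).
rewrite /grid_ceil ler_pdivlMr// mulrC k2/= ltr_pdivrMr// mulrDl mulVf ?gt_eqF//.
by move: k1; rewrite intrD mulrC ltrBlDr.
Qed.

Section convergence.
Variables (f : cadlag R) (e : R).
Hypothesis e0 : 0 < e.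

Let F (x : R) : R := f (clamp x).

(** [g] is a time change under which f, read on [0, x), is within e of its grid step function. It
    moves x to the next grid point, so that a jump of f at x becomes a cell boundary and a new piece
    can start there. *)
Definition matched n x (g : R -> R) := [/\ increasing_map g, g 0 = 0,
  g x = grid_ceil n x, forall t, 0 <= t <= x -> t <= g t <= t + n.+1%:R^-1 &
  forall t, 0 <= t < x ->
    `|F t - F ((Num.floor (n.+1%:R * g t))%:~R / n.+1%:R)| < e].

(* [matchable 1] is obtained by real induction: matchability extends to the
   right of x as long as f oscillates by less than e there. *)
Definition matchable x :=
  0 <= x <= 1 /\ \forall n \near \oo, exists g, matched n x g.

Lemma matchable0 : matchable 0.
Proof.
split; first by rewrite lexx ler01.
near=> n; exists id; split => //.
- by split => // y; exists y.
- by rewrite /grid_ceil mulr0 ceil0 mul0r.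
- move=> t /andP[t0 t1]; rewrite lexx/= lerDl invr_ge0 ler0n//.
- by move=> t /andP[t0 /(le_lt_trans t0)]; rewrite ltxx.
Unshelve. all: by end_near. Qed.

Lemma matchable_step x y : matchable x -> x < y -> y <= 1 ->
  (forall t u, x <= t < y -> x <= u < y -> `|F t - F u| < e) -> matchable y.
Proof.
move=> [/andP[x0 x1] mx] xy y1 osc; split; first by rewrite y1 (le_trans x0)// ltW.
have yx0 : 0 < y - x by rewrite subr_gt0.
near=> n.
have N0 : 0 < n.+1%:R :> R by rewrite ltr0n.
have nyx : n.+1%:R^-1 < y - x.
  by near: n; exact: (near_infty_natSinv_lt (PosNum yx0)).
have [g [ig g0 gx gt gF]] : exists g, matched n x g by near: n.
have /andP[sx1 sx2] := grid_ceil_bounds n x.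
have /andP[sy1 sy2] := grid_ceil_bounds n y.
have sxy : grid_ceil n x < grid_ceil n y.
  by apply: (lt_le_trans sx2); apply: le_trans sy1; rewrite -lerBrDl ltW.
have [h ih [hg hy hl]] := increasing_map_glue ig gx xy sxy.
exists h; split => //.
- by rewrite hg.
- move=> t /andP[t0 ty]; have [tx|/ltW xt] := leP t x.
    by rewrite hg//; apply: gt; rewrite t0.
  rewrite hl//.
  set u := grid_ceil n x in sx1 sx2 sxy *; set v := grid_ceil n y in sy1 sy2 sxy *.
  set a := n.+1%:R^-1 in sx2 sy2 *.
  (* On [x, y] the shift h t - t is a convex combination of the shifts u - x and v - y at the ends,
     both in [0, a). *)
  pose l := (t - x) / (y - x).
  have l0 : 0 <= l by rewrite divr_ge0 ?subr_ge0// ltW.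
  have l1 : l <= 1 by rewrite ler_pdivrMr// mul1r lerD2r.
  have tE : t = x + l * (y - x) by rewrite divfK ?subrKC// gt_eqF.
  rewrite (_ : (t - x) * _ = l * (v - u)); last by rewrite /l mulrA mulrAC.
  rewrite tE; nra.
- move=> t /andP[t0 ty]; have [tx|xt] := ltP t x.
    by rewrite hg ?ltW//; apply: gF; rewrite t0.
  (* The grid point just below h t is at least grid_ceil x >= x and, since h t < grid_ceil y, it is
     below y: it lies in [x, y) like t. *)
  apply: osc; first by rewrite xt.
  have h1 : grid_ceil n x <= h t.
    by rewrite hl// lerDl mulr_ge0 ?subr_ge0// divr_ge0 ?subr_ge0// ltW.
  have h2 : h t < grid_ceil n y by rewrite -hy; exact: ih.1.
  rewrite ler_pdivlMr// ltr_pdivrMr//; apply/andP; split.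
    apply: le_trans (_ : (Num.ceil (n.+1%:R * x))%:~R <= _).
      by rewrite mulrC; exact: ceil_ge.
    rewrite ler_int floor_ge_int; move: h1.
    by rewrite /grid_ceil ler_pdivrMr// [leRHS]mulrC.
  rewrite [ltRHS]mulrC -ceil_gt_int -(ltr_int R); apply: (le_lt_trans (ge_floor _)).
  by rewrite (mulrC _ (h t)) -ltr_pdivlMr.
Unshelve. all: by end_near. Qed.

Lemma left_cadlag (t : unitI R) (r : R) : 0 < r -> exists l, exists2 d : R, 0 < d &
  forall u : unitI R, \val t - d < \val u -> \val u < \val t -> `|l - f u| < r.
Proof.
move=> r0; have /asboolP/(_ t)[_ [l fl]] := cadlagP f; exists l.
have := @cvgr_dist_lt _ _ _ _ _ _ _ fl r r0.
rewrite near_withinE => H0.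
have [d /= d0 H] := iffLR (@nbhs_ballP R (unitI R) _ _) (H0 _); exists d => // u ud ut.
by apply: H => //; change (`|\val t - \val u| < d); rewrite ltr_distlC ud/=; lra.
Qed.

Lemma matchable1 : matchable 1.
Proof.
pose S := [set x | matchable x].
have S0 : S 0 by exact: matchable0.
have uS : has_ubound S by exists 1 => x [/andP[]].
have c0 : 0 <= sup S by exact: ub_le_sup.
have c1 : sup S <= 1 by apply: ge_sup; [exists 0|move=> x [/andP[]]].
set c := sup S in c0 c1.
have e20 : 0 < e / 2 by rewrite divr_gt0.
have cc : \val (clamp c) = c by rewrite val_clamp ?c0.
(* The left limit at c gives oscillation below e on some [x, c) with x in S, so the supremum is
   attained. *)
have Sc : S c.
  have [l [d d0 H]] := left_cadlag (clamp c) e20.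
  have [x Sx xc] := sup_adherent d0 (conj (ex_intro _ _ S0) uS).
  have x01 := Sx.1.
  have : x <= c := ub_le_sup uS Sx.
  rewrite le_eqVlt => /predU1P[<-//|{}xc'].
  apply: (matchable_step Sx) => // t u /andP[xt tc] /andP[xu uc].
  have Hc v : x <= v -> v < c -> `|l - F v| < e / 2.
    move: x01 xc c1 => /andP[x0 _]; rewrite -/S -/c => xc c1 xv vc.
    have v01 : 0 <= v <= 1 by apply/andP; split; lra.
    by apply: H; rewrite ?cc (val_clamp v01)//; lra.
  apply: (le_lt_trans (ler_distD l _ _)); rewrite (splitr e).
  by rewrite (distrC (F t)); apply: ltrD; exact: Hc.
have [c1'|c1'] := ltP c 1; last first.
  by rewrite (_ : 1 = c)//; apply/eqP; rewrite eq_le c1 c1'.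
(* If c < 1, right continuity at c prolongs the match beyond c, against the choice of c as a
   supremum. *)
have [d d0 H] := right_cadlag f (clamp c) e20.
rewrite cc in H.
pose y := Num.min 1 (c + d / 2).
have yc : c < y by rewrite lt_min c1' ltrDl divr_gt0.
have yd : y <= c + d / 2 by rewrite ge_min lexx orbT.
have y1 : y <= 1 by rewrite ge_min lexx.
have Sy : S y.
  apply: (matchable_step Sc) => // t u /andP[ct ty] /andP[cu uy].
  have Hc v : c <= v -> v < y -> `|F c - F v| < e / 2.
    rewrite le_eqVlt => /predU1P[<- _|cv vy]; first by rewrite subrr normr0.
    have v01 : 0 <= v <= 1 by apply/andP; split; lra.
    by apply: H; rewrite ?cc (val_clamp v01)//; lra.
  apply: (le_lt_trans (ler_distD (F c) _ _)); rewrite (splitr e).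
  by rewrite (distrC (F t)); apply: ltrD; exact: Hc.
by have := ub_le_sup uS Sy; rewrite leNgt yc.
Qed.

Lemma grid_step_near : \forall n \near \oo, sk_set f (grid_step n f) e.
Proof.
have [_ m1] := matchable1.
near=> n.
have N0 : 0 < n.+1%:R :> R by rewrite ltr0n.
have ne : n.+1%:R^-1 < e.
  by near: n; exact: (near_infty_natSinv_lt (PosNum e0)).
have [g [[gi gs] g0 g1 gt gF]] : exists g, matched n 1 g by near: n.
have {}g1 : g 1 = 1 by rewrite g1 /grid_ceil mulr1 pmulrn intrKceil divff// -pmulrn gt_eqF.
have gle : {mono g : x y / x <= y} by apply: le_mono => x y; exact: gi.
have g01 x : (0 <= g x <= 1) = (0 <= x <= 1) by rewrite -{1}g0 -{1}g1 !gle.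
have I01 (t : unitI R) : 0 <= \val t <= 1 by rewrite unitI_ge0 unitI_le1.
pose tau (t : unitI R) := clamp (g (\val t)).
have tauE t : \val (tau t) = g (\val t) by rewrite val_clamp// g01.
have tauI t u : \val t < \val u -> \val (tau t) < \val (tau u).
  by rewrite !tauE; exact: gi.
have [rho rhoE] : exists rho : unitI R -> unitI R, forall t, g (\val (rho t)) = \val t.
  have /choice[r rE] : forall t : unitI R, exists x : R, g x = \val t by move=> t; exact: gs.
  exists (fun t => clamp (r t)) => t.
  have r01 : 0 <= r t <= 1 by rewrite -g01 rE I01.
  by rewrite (val_clamp r01) rE.
have rhoK : cancel rho tau by move=> t; apply: val_inj; rewrite tauE.
have tauK : cancel tau rho.
  move=> t; apply: val_inj; have := rhoE (tau t); rewrite tauE.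
  by case: (ltgtP (\val (rho (tau t))) (\val t)) => // /gi; move=> /[swap] ->; rewrite ltxx.
split => //; exists tau; first by split => //; exists rho.
move=> t; split; last first.
  rewrite tauE; have /andP[] := gt _ (I01 t).
  move=> tg gn; rewrite ger0_norm ?subr_ge0// ltrBlDl.
  by apply: (le_lt_trans gn); rewrite ltrD2l.
change (`|f t - f (clamp ((Num.floor (n.+1%:R * \val (tau t)))%:~R / n.+1%:R))| < e).
rewrite tauE -{1}(clampK t).
(* The last clause of [matched] says nothing at t = 1; there g fixes 1, which is itself a grid
   point. *)
have := unitI_le1 t; rewrite le_eqVlt => /predU1P[t1|t1]; last first.
  by apply: gF; rewrite unitI_ge0.
rewrite t1 g1 mulr1 pmulrn intrKfloor divff -?pmulrn ?gt_eqF//.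
by rewrite subrr normr0.
Unshelve. all: by end_near. Qed.

End convergence.

End step_functions.

(** * Measurability of evaluations and approximation of sums in D[0,1] *)

Section skorokhod_measurability.
Context {R : realType}.
Notation D := (carrier (@Skorokhod R)).

(** Evaluation at p < 1 need not be d_sk-continuous, but by right continuity f p >= a iff, for all m
    and j, f exceeds a - 1/(j+1) somewhere in (p, p + 1/(m+1)), and each of these conditions is
    d_sk-open. Every time change fixes 1, so evaluation at 1 is continuous. *)
Lemma measurable_fun_skorokhod_eval (p : unitI R) :
  measurable_fun setT (fun f : D => (f : cadlag R) p).
Proof.
have [p1|p1] := ltP (\val p) 1; last first.
  apply: (measurability _ (RGenOInfty.measurableE R)) => _ [_ [a ->] <-].
  rewrite setTI; apply: ambient_open_measurable => f /=.
  rewrite in_itv /= andbT => af; exists (f p - a); first by rewrite subr_gt0.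
  move=> g /d_sk_lt[_ [tau [[rho rhoK tauK] incr] /(_ p)[H _]]].
  have tE : tau p = p.
    have [tt|tt|tt] := ltgtP (\val (rho p)) (\val p); last first.
    - by rewrite -{1}(val_inj tt) tauK.
    - by have := le_lt_trans p1 tt; rewrite ltNge unitI_le1.
    - have := incr _ _ tt; rewrite tauK => tt'.
      by have := le_lt_trans p1 tt'; rewrite ltNge unitI_le1.
  move: H; rewrite tE ltr_distlC => /andP[H _].
  by rewrite /= in_itv /= andbT; apply: le_lt_trans H; rewrite subKr.
apply: (measurability _ (RGenCInfty.measurableE R)) => _ [_ [a ->] <-].
pose U (m j : nat) := [set f : D | exists2 u : unitI R,
  \val p < \val u < \val p + m.+1%:R^-1 & a - j.+1%:R^-1 < (f : cadlag R) u].
have mU m j : measurable (U m j).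
  apply: ambient_open_measurable => f [u /andP[pu up] fu].
  pose e := Num.min (f u - (a - j.+1%:R^-1))
    (Num.min (\val u - \val p) (\val p + m.+1%:R^-1 - \val u)).
  exists e; first by rewrite !lt_min !subr_gt0 fu pu up.
  move=> g /d_sk_lt[_ [tau _ /(_ u)]]; rewrite /e !lt_min !ltr_distl.
  move=> [/andP[/andP[_ h1]] _] /andP[_ /andP[/andP[h2 _] /andP[_ h3]]].
  exists (tau u); last by move: h1; rewrite -ltrBlDr subKr.
  by move: h2 h3; rewrite subKr addrC subrK => -> ->.
rewrite (_ : _ `&` _ = \bigcap_m \bigcap_j U m j); last first.
  rewrite setTI; apply/seteqP; split => [f /=|f Uf].
    rewrite in_itv /= andbT => af m _ j _.
    have j0 : 0 < j.+1%:R^-1 :> R by rewrite invr_gt0.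
    have m0 : 0 < m.+1%:R^-1 :> R by rewrite invr_gt0.
    have [d d0 H] := right_cadlag f p j0.
    pose x := \val p + Num.min (d / 2) (Num.min (m.+1%:R^-1 / 2) (1 - \val p)).
    have px : \val p < x by rewrite ltrDl !lt_min !divr_gt0//= subr_gt0.
    have xd : x < \val p + d.
      by rewrite ltrD2l gt_min ltr_pdivrMr// mulr_natr mulr2n ltrDl d0.
    have xm : x < \val p + m.+1%:R^-1.
      rewrite ltrD2l !gt_min; apply/orP; right; apply/orP; left.
      by rewrite ltr_pdivrMr// mulr_natr mulr2n ltrDl.
    have x1 : x <= 1 by rewrite /x -lerBrDl !ge_min lexx !orbT.
    have xE : \val (clamp x) = x.
      by rewrite val_clamp// x1 andbT (le_trans (unitI_ge0 p))// ltW.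
    exists (clamp x); first by rewrite xE px.
    have := H (clamp x); rewrite xE => /(_ px xd); rewrite ltr_distl => /andP[_ fpx].
    by move: af fpx; move: (j.+1%:R^-1 : R) => b; change (cadlag_fun f p) with ((f : cadlag R) p); lra.
  rewrite /= in_itv /= andbT; apply/ler_addgt0Pl => e e0.
  have e20 : 0 < e / 2 by rewrite divr_gt0.
  have [d d0 H] := right_cadlag f p e20.
  have [m _ Hm] := near_infty_natSinv_lt (PosNum d0).
  have [j _ Hj] := near_infty_natSinv_lt (PosNum e20).
  have [u /andP[pu um] fu] := Uf m I j I.
  have {}Hm : m.+1%:R^-1 < d := Hm m (leqnn m).
  have {}Hj : j.+1%:R^-1 < e / 2 := Hj j (leqnn j).
  have := H u pu; rewrite ltr_distl.
  move: (m.+1%:R^-1 : R) (j.+1%:R^-1 : R) um fu Hm Hj => a1 a2 um fu Hm Hj.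
  have ud : \val u < \val p + d by apply: (lt_trans um); rewrite ltrD2l.
  move=> /(_ ud)/andP[H1 _]; lra.
by apply: bigcapT_measurable => m; exact: bigcapT_measurable.
Qed.

(** Grid values rounded down to multiples of 1/(n+1): the code has countably many values and
    measurable fibres, at the cost of a uniform error 1/(n+1). *)
Definition sk_code n (f : D) : {ffun 'I_n.+2 -> int} :=
  [ffun k : 'I_n.+2 => Num.floor (n.+1%:R * (f : cadlag R) (clamp (k%:R / n.+1%:R)))].

Definition sk_decode n (v : {ffun 'I_n.+2 -> int}) : D :=
  step n (fun k => (v (inord `|k|%N))%:~R / n.+1%:R).

Lemma sk_code_measurable n v : measurable (@sk_code n @^-1` [set v]).
Proof.
rewrite (_ : _ @^-1` _ = \bigcap_(k : 'I_n.+2)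
   (fun f : D => (f : cadlag R) (clamp (k%:R / n.+1%:R))) @^-1`
     [set x | (v k)%:~R <= n.+1%:R * x < (v k + 1)%:~R]).
  apply: fin_bigcap_measurable => // k _.
  rewrite -[X in measurable X]setTI; apply: measurable_fun_skorokhod_eval => //.
  rewrite (_ : [set x | _] = `[(v k)%:~R / n.+1%:R, (v k + 1)%:~R / n.+1%:R[%classic); first exact: measurable_itv.
  apply/seteqP; split => x /=; rewrite in_itv /= ler_pdivrMr ?ltr_pdivlMr ?ltr0n//;
  by rewrite (mulrC x).
apply/seteqP; split => f /=.
  by move=> <- k _ /=; rewrite ffunE floor_itv.
by move=> H; apply/ffunP => k; rewrite ffunE; apply: floor_def; exact: H.
Qed.

Lemma sk_decode_code n (f : D) t :
  `|grid_step n (f : cadlag R) t - (sk_decode (sk_code n f) : cadlag R) t| <= n.+1%:R^-1.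
Proof.
have N0 : 0 < n.+1%:R :> R by rewrite ltr0n.
rewrite /= /step_val.
set k := Num.floor _.
have k0 : 0 <= k by rewrite floor_ge0 mulr_ge0 ?unitI_ge0// ltW.
have kn : k <= n.+1%:Z.
  rewrite -(ler_int R); apply: (le_trans (ge_floor _)).
  by rewrite -pmulrn ger_pMr// unitI_le1.
have kE : (`|k|%N%:Z) = k by rewrite gez0_abs.
rewrite ffunE inordK; last by rewrite ltnS -lez_nat kE.
rewrite (_ : `|k|%:R = k%:~R :> R); last by rewrite -[in RHS]kE pmulrn.
set y := f _.
have /andP[h1 h2] := floor_itv (n.+1%:R * y).
move: h1 h2; rewrite intrD; set z := (Num.floor _)%:~R => h1 h2.
have -> : y - z / n.+1%:R = (n.+1%:R * y - z) / n.+1%:R.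
  by rewrite mulrBl (mulrC n.+1%:R y) mulfK ?gt_eqF.
rewrite ger0_norm ?divr_ge0 ?subr_ge0 ?(ltW N0)// ler_pdivrMr// mulVf ?gt_eqF//.
by rewrite lerBlDl ltW.
Qed.

Lemma sk_set_uniform (f g h : cadlag R) e r : 0 <= r ->
  sk_set f g e -> (forall t, `|g t - h t| <= r) -> sk_set f h (e + r).
Proof.
move=> r0 [e0 [tau it H]] gh; split; first by rewrite ltr_wpDr.
exists tau => // t; have [H1 H2] := H t; split; last by rewrite ltr_wpDr.
by rewrite (le_lt_trans (ler_distD (g (tau t)) _ _))// ltr_leD.
Qed.

Lemma sk_approx (f : D) e : 0 < e ->
  \forall n \near \oo, amb_dist f (sk_decode (sk_code n f)) < e.
Proof.
move=> e0; have e20 : 0 < e / 4 by rewrite divr_gt0.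
near=> n.
have ne : n.+1%:R^-1 < e / 4.
  by near: n; exact: (near_infty_natSinv_lt (PosNum e20)).
have H : sk_set (f : cadlag R) (grid_step n (f : cadlag R)) (e / 4).
  by near: n; exact: grid_step_near.
have /d_sk_le := sk_set_uniform (ltW e20) H
  (fun t => le_trans (sk_decode_code n f t) (ltW ne)).
by move/le_lt_trans; apply; lra.
Unshelve. all: by end_near. Qed.

(** [grid_step n] is additive, since f and g are sampled on one fixed grid. The sum of the decoded
    functions is therefore uniformly within 2/(n+1) of [grid_step n (f + g)], which converges to f +
    g. The time changes that suit f and g may differ, but only the one of f + g enters. *)
Lemma sk_approxD (f g : D) e : 0 < e -> \forall n \near \oo,
  amb_dist (f + g) (sk_decode (sk_code n f) + sk_decode (sk_code n g)) < e.
Proof.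
move=> e0; have e20 : 0 < e / 4 by rewrite divr_gt0.
near=> n.
have ne : n.+1%:R^-1 < e / 4.
  by near: n; exact: (near_infty_natSinv_lt (PosNum e20)).
have H : sk_set (f + g : cadlag R) (grid_step n (f + g : cadlag R)) (e / 4).
  by near: n; exact: grid_step_near.
have H2 : sk_set (f + g : cadlag R)
    (sk_decode (sk_code n f) + sk_decode (sk_code n g) : cadlag R) (e / 4 + (e / 4 + e / 4)).
  apply: sk_set_uniform H _; first lra.
  move=> t.
  have -> : grid_step n (f + g : cadlag R) t = grid_step n (f : cadlag R) t + grid_step n (g : cadlag R) t by [].
  have -> : (sk_decode (sk_code n f) + sk_decode (sk_code n g) : cadlag R) t =
    (sk_decode (sk_code n f) : cadlag R) t + (sk_decode (sk_code n g) : cadlag R) t by [].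
  rewrite opprD addrACA (le_trans (ler_normD _ _))// lerD//;
  by apply: le_trans (ltW ne); exact: sk_decode_code.
by have /d_sk_le/le_lt_trans := H2; apply; lra.
Unshelve. all: by end_near. Qed.

End skorokhod_measurability.

Section ambient_measurability.
Context {R : realType}.
Implicit Type B : ambient R.

Lemma separable_enum (V : completeNormedModType R) : separable V ->
  exists s : nat -> V, forall x e, 0 < e -> exists k, `|x - s k| < e.
Proof.
move=> [S /countable_injP[f fi] dS].
exists (fun k => xget 0 [set x | S x /\ f x = k]) => x e e0.
have [|y [/= xy Sy]] := dS (ball x e) _ (ball_open x e).
  by exists x; exact: ballxx.
move: xy; rewrite -ball_normE /= => xy.
exists (f y); case: xgetP => [z _ [Sz zy]|/(_ y)]; last by move=> [].
by rewrite (fi z y)// inE.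
Qed.

(* Countably valued measurable approximations; addition is not continuous for
   the Skorokhod metric, so convergence of sums is part of the statement. *)
Lemma ambient_approx B : exists (J : nat -> countType)
    (c : forall n, carrier B -> J n) (q : forall n, J n -> carrier B),
  [/\ forall n j, measurable (c n @^-1` [set j]),
      forall x e, 0 < e -> \forall n \near \oo, amb_dist x (q n (c n x)) < e &
      forall x y e, 0 < e -> \forall n \near \oo,
        amb_dist (x + y) (q n (c n x) + q n (c n y)) < e].
Proof.
case: B => [V sV|]; last first.
  exists (fun n => {ffun 'I_n.+2 -> int} : countType), sk_code, sk_decode; split.
  - exact: sk_code_measurable.
  - exact: sk_approx.
  - exact: sk_approxD.
have [s Hs] := separable_enum sV.
have ex n x : exists k, `|x - s k| < n.+1%:R^-1 by apply: Hs; rewrite invr_gt0.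
(* Taking the least index makes each fibre a ball minus finitely many balls. *)
pose c n x := ex_minn (ex n x).
have cE n x : `|x - s (c n x)| < n.+1%:R^-1 by rewrite /c; case: ex_minnP.
exists (fun=> nat : countType), c, (fun=> s); split.
- move=> n j.
  rewrite (_ : _ @^-1` _ = [set x : carrier (Banach sV) | amb_dist (s j : carrier (Banach sV)) x < n.+1%:R^-1] `&`
    \bigcap_(i in `I_j) ~` [set x : carrier (Banach sV) | amb_dist (s i : carrier (Banach sV)) x < n.+1%:R^-1]).
    apply: measurableI; first exact: measurable_amb_ball.
    by apply: bigcap_measurableType => i _; apply: measurableC; exact: measurable_amb_ball.
  apply/seteqP; split => x /=.
    rewrite /c; case: ex_minnP => k xk mk <-; split; first by rewrite distrC.
    by move=> i /= ik; rewrite distrC => /mk; rewrite leqNgt ik.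
  move=> [xj H]; rewrite /c; case: ex_minnP => k xk mk.
  apply/eqP; rewrite eqn_leq mk 1?distrC//= leqNgt; apply/negP => kj.
  by apply: (H k kj); rewrite /= distrC.
- move=> x e e0; near=> n; apply: (lt_trans (cE n x)).
  by near: n; exact: (near_infty_natSinv_lt (PosNum e0)).
- move=> x y e e0; have e20 : 0 < e / 2 by rewrite divr_gt0.
  near=> n; rewrite /= opprD addrACA (le_lt_trans (ler_normD _ _))//.
  have ne : n.+1%:R^-1 < e / 2.
    by near: n; exact: (near_infty_natSinv_lt (PosNum e20)).
  rewrite (splitr e) ltrD//; first exact: lt_trans (cE n x) ne.
  exact: lt_trans (cE n y) ne.
Unshelve. all: by end_near. Qed.

End ambient_measurability.

(** * Measurability of addition, operator evaluation and operator norm *)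

Section ambient_operations.
Context {R : realType}.
Implicit Type B : ambient R.

Lemma measurable_fun_amb_add B :
  measurable_fun setT (fun p : carrier B * carrier B => p.1 + p.2).
Proof.
have [J [c [q [mc _ qD]]]] := ambient_approx B.
apply: (@measurable_fun_amb_lim _ _ _ _
  (fun n p => q n (c n p.1) + q n (c n p.2))); last by move=> p e; exact: qD.
move=> n.
apply: (@measurable_fun_countable_switch _ _ _ _ (J n * J n)%type
  (fun p => (c n p.1, c n p.2)) (fun ij _ => q n ij.1 + q n ij.2)) => // -[i j].
rewrite (_ : _ @^-1` _ = (c n @^-1` [set i]) `*` (c n @^-1` [set j])).
  exact: measurableX.
by apply/seteqP; split => -[x y] /=; [case=> -> ->|case=> -> ->].
Qed.

Lemma measurable_funD_amb d (T : measurableType d) B (f g : T -> carrier B) :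
  measurable_fun setT f -> measurable_fun setT g ->
  measurable_fun setT (fun w => f w + g w).
Proof.
move=> mf mg; apply: (@measurableT_comp _ _ _ _ _ _
  (fun p : carrier B * carrier B => p.1 + p.2) setT (fun w => (f w, g w))).
  exact: measurable_fun_amb_add.
exact: measurable_fun_pair.
Qed.

Lemma measurable_funZ_amb d (T : measurableType d) B (f : T -> carrier B) a :
  measurable_fun setT f -> measurable_fun setT (fun w => a *: f w).
Proof. by move=> mf; apply: (measurableT_comp (@measurable_fun_ambZ R B a)). Qed.

Lemma measurable_funB_amb d (T : measurableType d) B (f g : T -> carrier B) :
  measurable_fun setT f -> measurable_fun setT g ->
  measurable_fun setT (fun w => f w - g w).
Proof.
move=> mf mg; under eq_fun do rewrite -scaleN1r.
by apply: measurable_funD_amb => //; exact: measurable_funZ_amb.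
Qed.

Lemma measurable_fun_sum_amb d (T : measurableType d) B (I : Type) (r : seq I)
    (P : pred I) (f : I -> T -> carrier B) :
  (forall i, measurable_fun setT (f i)) ->
  measurable_fun setT (fun w => \sum_(i <- r | P i) f i w).
Proof.
move=> mf; elim: r => [|i r IH].
  by under eq_fun do rewrite big_nil; exact: measurable_cst.
under eq_fun do rewrite big_cons; case: (P i) => //.
exact: measurable_funD_amb.
Qed.

Lemma measurable_fun_norm_comp d (T : measurableType d) B (f : T -> carrier B) :
  measurable_fun setT f -> measurable_fun setT (fun w => `|f w|).
Proof. by move=> mf; apply: (measurableT_comp (@measurable_fun_norm R B)). Qed.

Lemma op_amb_continuous B (a : operator B) x e : 0 < e -> exists2 r, 0 < r &
  forall y, amb_dist x y < r -> amb_dist (a x) (a y) < e.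
Proof.
move=> e0; have := op_cont a; case: B a x => [V sV|] a x /=.
  move=> /(_ x)/cvgr_dist_lt/(_ e e0)/nbhs_ballP[r /= r0 H].
  by exists r => // y xy; apply: H; rewrite -ball_normE.
move=> [_ /(_ x) ca].
have : nbhs (a x : skorokhod R) [set z : skorokhod R | d_sk (a x) z < e].
  by apply/(@nbhs_ballP R (skorokhod R)); exists e.
by move=> /ca/(@nbhs_ballP R (skorokhod R))[r r0 H]; exists r.
Qed.

Lemma measurable_op_eval_pt B (x : carrier B) :
  measurable_fun setT (fun a : operator B => a x).
Proof.
move=> _ U mU; apply: sub_sigma_algebra.
have evx : @evaluation_events R B (setT `&` (fun a : operator B => a x) @^-1` U).
  by exists x => //; exists U.
by case: B x U mU evx => [V sV|] x U mU evx //=; left.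
Qed.

(** The sigma-algebra on operators provides measurability of evaluations at fixed points. Replacing
    the argument by its countably valued approximation reduces the joint map to those, and
    continuity of each operator for [amb_dist] gives the convergence. *)
Lemma measurable_op_eval B :
  measurable_fun setT (fun p : operator B * carrier B => p.1 p.2).
Proof.
have [J [c [q [mc qx _]]]] := ambient_approx B.
apply: (@measurable_fun_amb_lim _ _ (operator B * carrier B)%type _
  (fun n p => p.1 (q n (c n p.2))) (fun p => p.1 p.2)).
  move=> n; apply: (@measurable_fun_countable_switch _ _
    (operator B * carrier B)%type _ (J n)
    (fun p => c n p.2) (fun j p => p.1 (q n j))) => j.
    rewrite (_ : _ @^-1` _ = snd @^-1` (c n @^-1` [set j]))//.
    by rewrite -[X in measurable X]setTI; exact: measurable_snd.
  apply: (@measurableT_comp _ _ _ _ _ _ (fun a : operator B => a (q n j))) => //.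
  exact: measurable_op_eval_pt.
move=> [a x] e /= /(op_amb_continuous a x)[r r0 H].
by apply: filterS (qx x r r0) => n; exact: H.
Qed.

Lemma measurable_fun_op_app d (T : measurableType d) B (A : T -> operator B)
    (f : T -> carrier B) : measurable_fun setT A -> measurable_fun setT f ->
  measurable_fun setT (fun w => A w (f w)).
Proof.
move=> mA mf; apply: (@measurableT_comp _ _ _ _ _ _
  (fun p : operator B * carrier B => p.1 p.2) setT (fun w => (A w, f w))).
  exact: measurable_op_eval.
exact: measurable_fun_pair.
Qed.

Lemma op_norm_continuous B (a : operator B) :
  continuous (op_fun a : ambient_normed B -> ambient_normed B).
Proof. by have := op_cont a; case: B a => [V sV|] a //= []. Qed.

Lemma opD B (a : operator B) x y : a (x + y) = a x + a y.
Proof. by have := op_linear a 1 x y; rewrite !scale1r. Qed.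

Lemma op0 B (a : operator B) : a 0 = 0.
Proof. by have := op_linear a (-1) 0 0; rewrite !scaleN1r oppr0 addr0 addNr. Qed.

Lemma opZ B (a : operator B) c x : a (c *: x) = c *: a x.
Proof. by have := op_linear a c x 0; rewrite !addr0 op0 addr0. Qed.

Lemma opN B (a : operator B) x : a (- x) = - a x.
Proof. by rewrite -scaleN1r opZ scaleN1r. Qed.

Lemma opB B (a : operator B) x y : a (x - y) = a x - a y.
Proof. by rewrite opD opN. Qed.

Lemma opnorm_ge0 B (a : carrier B -> carrier B) : (0 <= opnorm a)%E.
Proof.
apply: (@le_trans _ _ (`|a 0|)%:E); first by rewrite lee_fin.
by apply: ereal_sup_ubound; exists 0 => //=; rewrite normr0.
Qed.

Lemma le_opnorm B (a : carrier B -> carrier B) x :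
  (forall c y, a (c *: y) = c *: a y) -> (`|a x|%:E <= opnorm a * `|x|%:E)%E.
Proof.
move=> aZ; have [->|x0] := eqVneq x 0.
  by rewrite -{1}(scale0r (0 : carrier B)) aZ scale0r !normr0 mule0.
have nx : 0 < `|x| by rewrite normr_gt0.
rewrite -lee_pdivrMr// -EFinM; apply: ereal_sup_ubound.
exists (`|x|^-1 *: x) => /=; first by rewrite normrZ normfV normr_id mulVf ?gt_eqF.
by rewrite aZ normrZ normfV normr_id mulrC.
Qed.

Lemma op_bounded B (a : operator B) :
  exists2 M, 0 <= M & forall x, `|a x| <= M * `|x|.
Proof.
have := @op_norm_continuous B a 0.
move=> /cvgr_dist_lt/(_ 1 ltr01)/nbhs_ballP[r /= r0 H].
exists (2 / r); first by rewrite divr_ge0// ltW.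
move=> x; have [->|x0] := eqVneq x 0; first by rewrite op0 !normr0 mulr0.
have nx : 0 < `|x| by rewrite normr_gt0.
have c0 : 0 < r / 2 / `|x| by rewrite !divr_gt0.
have := H ((r / 2 / `|x|) *: x); rewrite op0 sub0r normrN opZ normrZ.
rewrite gtr0_norm// -ball_normE /= sub0r normrN normrZ gtr0_norm// divfK ?gt_eqF//.
have rr : r / 2 < r by rewrite ltr_pdivrMr// mulr_natr mulr2n ltrDl.
move=> /(_ rr); rewrite -ltr_pdivlMl// => /ltW/le_trans; apply.
by rewrite mulr1 !invfM !invrK (mulrC r^-1).
Qed.

Definition opn B (a : operator B) : R := fine (opnorm a).

Lemma opn_ge0 B (a : operator B) : 0 <= opn a.
Proof. exact/fine_ge0/opnorm_ge0. Qed.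

Lemma opnormE B (a : operator B) : opnorm a = (opn a)%:E.
Proof.
rewrite /opn fineK// ge0_fin_numE ?opnorm_ge0//.
have [M M0 aM] := op_bounded a.
apply: (@le_lt_trans _ _ M%:E); last exact: ltry.
apply: ge_ereal_sup => _ [x /= x1 <-]; rewrite lee_fin.
by apply: (le_trans (aM x)); rewrite ler_piMr.
Qed.

Lemma le_opn B (a : operator B) x : `|a x| <= opn a * `|x|.
Proof. by rewrite -lee_fin EFinM -opnormE; apply: le_opnorm; exact: opZ. Qed.

Lemma opn_le B (a : operator B) M : 0 <= M ->
  (forall x, `|a x| <= M * `|x|) -> opn a <= M.
Proof.
move=> M0 aM; rewrite -lee_fin -opnormE; apply: ge_ereal_sup => _ [x /= x1 <-].
by rewrite lee_fin (le_trans (aM x))// ler_piMr.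
Qed.

(** In the separable case the bound opn a <= r can be tested on a dense sequence, by continuity of
    a; in D[0,1] the operator norm is among the generators of the sigma-algebra. *)
Lemma measurable_opn B : measurable_fun setT (@opn B).
Proof.
case: B => [V sV|]; last first.
  apply: (measurableT_comp (fine_measurable measurableT)) => //.
  move=> _ U mU; apply: sub_sigma_algebra => /=; right.
  by exists U.
have [s Hs] := separable_enum sV.
apply: (measurability _ (RGenOInfty.measurableE R)) => _ [_ [r ->] <-].
rewrite setTI -[X in measurable X]setCK; apply: measurableC.
have [r0|r0] := ltP r 0.
  rewrite (_ : ~` _ = set0)//; apply/seteqP; split => // a /=.
  by rewrite in_itv /= andbT (lt_le_trans r0 (opn_ge0 _)).
rewrite (_ : ~` _ = \bigcap_k [set a : operator (Banach sV) | `|a (s k)| <= r * `|s k|]).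
  apply: bigcapT_measurable => k.
  rewrite (_ : [set a : operator (Banach sV) | _] = (fun a : operator (Banach sV) => `|a (s k)|) @^-1` `]-oo, r * `|s k|]); last first.
    by apply/seteqP; split => a /=; rewrite in_itv.
  rewrite -[X in measurable X]setTI; apply: measurable_fun_norm_comp => //.
  exact: measurable_op_eval_pt.
apply/seteqP; split => a /=; rewrite in_itv /= andbT => H.
  move/negP : H; rewrite -leNgt => ar k _ /=.
  by apply: (le_trans (le_opn a _)); rewrite ler_wpM2r.
apply/negP; rewrite -leNgt; apply: opn_le => // x.
apply/ler_addgt0Pl => e e0.
(* Passing from x to a nearby s k costs at most opn a |x - s k| on the left and r |x - s k| on the
   right; the 1 keeps the divisor positive. *)
have c0 : 0 < opn a + r + 1 by rewrite ltr_wpDl// addr_ge0 ?opn_ge0.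
have [k xk] := Hs x (e / (opn a + r + 1)) (divr_gt0 e0 c0).
rewrite ltr_pdivlMr// in xk.
have h1 : `|a x| <= `|a (s k)| + opn a * `|x - s k|.
  rewrite -[x in a x](subrKC (s k)) opD (le_trans (ler_normD _ _))// lerD2l.
  exact: le_opn.
have h2 : r * `|s k| <= r * `|x| + r * `|x - s k|.
  by rewrite -mulrDr ler_wpM2l// -lerBlDl distrC; exact: lerB_dist.
have h3 := H k I; rewrite /= in h3.
have := normr_ge0 (x - s k); move: (`|x - s k|) xk h1 h2 => y xk h1 h2 y0.
by rewrite mulrDr mulr1 mulrDr in xk; rewrite (mulrC r y) (mulrC (opn a) y) in h1 h2; lra.
Qed.

Lemma measurable_fun_opn_comp d (T : measurableType d) B (A : T -> operator B) :
  measurable_fun setT A -> measurable_fun setT (fun w => opn (A w)).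
Proof. by move=> mA; apply: (measurableT_comp (@measurable_opn B)). Qed.

End ambient_operations.

(** * Taylor expansion of the test functions *)

Section one_variable.
Context {R : realType}.

Lemma is_derive_estimate (f : R -> R) (t l : R) :
  (forall e, 0 < e -> \forall h \near 0, `|f (t + h) - f t - h * l| <= e * `|h|) ->
  is_derive t 1 f l.
Proof.
move=> H.
have fl : (fun h => h^-1 *: ((f \o shift t) (h *: 1) - f t)) @ 0^' --> l.
  apply/cvgrPdist_le => e e0; rewrite near_withinE.
  apply: filterS (H e e0) => h; rewrite mulrC => Hh h0.
  rewrite mulrC in Hh.
  rewrite /= distrC (addrC _ t) [h%:A]mulr1.
  have -> : h^-1 *: (f (t + h) - f t) - l = h^-1 * (f (t + h) - f t - h * l).
    by rewrite mulrBr mulKf.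
  by rewrite normrM normfV ler_pdivrMl ?normr_gt0// (mulrC `|h|).
apply: DeriveDef; first by apply/cvg_ex; exists l.
exact: cvg_lim.
Qed.

Definition taylor_sum m (c : nat -> R) (t : R) := \sum_(j < m.+1) c j / j`!%:R * t ^+ j.

Lemma taylor_sumE m c t :
  taylor_sum m c t = (\poly_(j < m.+1) (c j / j`!%:R)).[t].
Proof. by rewrite horner_poly. Qed.

Lemma is_derive_taylor_sum m (c : nat -> R) (t : R) :
  is_derive t 1 (taylor_sum m.+1 c) (taylor_sum m (fun j => c j.+1) t).
Proof.
pose p := \poly_(j < m.+2) (c j / j`!%:R).
have -> : taylor_sum m.+1 c = fun t => p.[t] by apply/funext => u; rewrite taylor_sumE.
have -> : taylor_sum m (fun j => c j.+1) t = p^`().[t].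
  rewrite taylor_sumE; congr (_.[t]); apply/polyP => i.
  rewrite coef_deriv !coef_poly !ltnS; case: leqP => // _; last by rewrite mul0rn.
  by rewrite factS natrM invfM -mulrnAr -mulrnAl -(mulr_natl _ i.+1) mulfV ?mul1r// pnatr_eq0.
exact: is_derive_poly.
Qed.

(** Induction on m applied to the derived chain, then the mean value theorem on [0, t] with t <= 1.
    The factorial gain in the remainder is given up: later only the existence of a constant
    matters. *)
Lemma taylor_bound m (phi : nat -> R -> R) (C : R) :
  (forall k (t : R), (k < m)%N -> is_derive t 1 (phi k) (phi k.+1 t)) ->
  (forall t, 0 <= t <= 1 -> `|phi m t - phi m 0| <= C) ->
  forall t, 0 <= t <= 1 -> `|phi 0%N t - taylor_sum m (phi^~ 0) t| <= C.
Proof.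
elim: m phi => [|m IH] phi dphi bphi t t01.
  by rewrite /taylor_sum big_ord1 fact0 divr1 mulr1; exact: bphi.
have {IH}H := IH (fun k => phi k.+1) (fun k t km => dphi k.+1 t km) bphi.
pose chi t := phi 0%N t - taylor_sum m.+1 (phi^~ 0) t.
have dchi (u : R) : is_derive u 1 chi (phi 1%N u - taylor_sum m (fun j => phi j.+1 0) u).
  have := dphi 0%N u isT; have := is_derive_taylor_sum m (phi^~ 0) u.
  by move=> ? ?; apply: is_deriveB.
have chi0 : chi 0 = 0.
  rewrite /chi /taylor_sum big_ord_recl/= fact0 divr1 mulr1 big1 ?addr0 ?subrr//.
  by move=> i _; rewrite exprS mul0r mulr0.
have C0 : 0 <= C by apply: le_trans (bphi 0 _); rewrite ?lexx ?ler01.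
move: t01 => /andP[]; rewrite le_eqVlt => /predU1P[<- _|t0 t1].
  by rewrite -/(chi 0) chi0 normr0.
have [|c] := MVT t0 (fun x _ => dchi x).
  by apply: derivable_within_continuous => x _; apply: ex_derive.
rewrite in_itv /= => /andP[c0 ct]; rewrite chi0 !subr0 -/(chi t) => ->.
rewrite normrM (gtr0_norm t0) -[leRHS]mulr1; apply: ler_pM => //.
  exact: ltW.
by apply: H; rewrite (ltW c0)/= (le_trans (ltW ct)).
Qed.

End one_variable.

Section multilinear_forms.
Context {R : realType} {V : normedModType R}.

Lemma multilinearB k (g h : kform V k) : multilinear g -> multilinear h ->
  multilinear (fun v => g v - h v).
Proof. by move=> lg lh i v a x y /=; rewrite lg lh mulrBr opprD addrACA. Qed.

Definition ins k (i : 'I_k) (v : 'I_k -> V) (z : V) : 'I_k -> V :=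
  fun j => if j == i then z else v j.

Lemma insE k (i : 'I_k) (v : 'I_k -> V) : ins i v (v i) = v.
Proof. by apply/funext => j; rewrite /ins; case: eqP => // ->. Qed.

Lemma multilinear_insZ k (g : kform V k) i v a x : multilinear g ->
  g (ins i v (a *: x)) = a * g (ins i v x).
Proof.
move=> lg; have := lg i v 0 0 0; rewrite /= scale0r addr0 mul0r add0r -/(ins i v 0).
have := lg i v a x 0; rewrite /= addr0 -/(ins i v (a *: x)) -/(ins i v x) -/(ins i v 0) => -> _.
have := lg i v (-1) 0 0; rewrite /= scaler0 addr0 -/(ins i v 0) mulN1r addNr => ->.
by rewrite addr0.
Qed.

Lemma multilinear_insB k (g : kform V k) i v x y : multilinear g ->
  g (ins i v x) - g (ins i v y) = g (ins i v (x - y)).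
Proof.
move=> lg; have := lg i v (-1) y x; rewrite /= scaleN1r mulN1r (addrC (- y)).
by rewrite (addrC (- _)) /ins => ->.
Qed.

Lemma multilinear_scale k (g : kform V k) (c : 'I_k -> R) v : multilinear g ->
  g (fun i => c i *: v i) = (\prod_i c i) * g v.
Proof.
move=> lg.
have H (r : seq 'I_k) : uniq r ->
    g (fun i => if i \in r then c i *: v i else v i) = (\prod_(i <- r) c i) * g v.
  elim: r => [_|i r IH /= /andP[ir ur]].
    by rewrite big_nil mul1r.
  rewrite big_cons -mulrA -IH//.
  pose w j := if j \in r then c j *: v j else v j.
  have wi : w i = v i by rewrite /w (negbTE ir).
  rewrite -[X in c i * g X](insE i w) wi.
  rewrite -multilinear_insZ//; congr g.
  by apply/funext => j; rewrite /ins inE; case: eqP => //= ->.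
rewrite -(H (index_enum 'I_k)) ?index_enum_uniq//; congr g.
by apply/funext => j; rewrite mem_index_enum.
Qed.

Lemma multilinear_bound k (g : kform V k) C v : multilinear g ->
  (formnorm g <= C%:E)%E -> `|g v| <= C * \prod_i `|v i|.
Proof.
move=> lg gC.
have C0 : 0 <= C.
  have : ((`|g (fun=> 0)|)%:E <= C%:E)%E.
    apply: le_trans gC; apply: ereal_sup_ubound; exists (fun=> 0) => //= i.
    by rewrite normr0.
  by rewrite lee_fin; exact: le_trans.
(* Normalising each argument also works for v i = 0, where the inverse of the norm is 0 by
   convention. *)
rewrite (_ : v = fun i => `|v i| *: (`|v i|^-1 *: v i)); last first.
  apply/funext => i; rewrite scalerA; have [->|v0] := eqVneq (v i) 0.
    by rewrite scaler0.
  by rewrite mulfV ?normr_eq0// scale1r.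
rewrite (multilinear_scale (fun i => `|v i|))// normrM mulrC.
rewrite (ger0_norm (prodr_ge0 _ _))//.
rewrite [in leRHS](eq_bigr (fun i => `|v i|)); last first.
  move=> i _; rewrite scalerA; have [->|v0] := eqVneq (v i) 0.
    by rewrite scaler0.
  by rewrite mulfV ?normr_eq0// scale1r.
rewrite ler_wpM2r ?prodr_ge0// -lee_fin; apply: le_trans gC.
apply: ereal_sup_ubound; exists (fun i => `|v i|^-1 *: v i) => //= i.
rewrite normrZ normfV normr_id; have [->|v0] := eqVneq (v i) 0.
  by rewrite normr0 mulr0.
by rewrite mulVf ?normr_eq0.
Qed.

Lemma multilinear_diag_bound k (g : kform V k) C x : multilinear g ->
  (formnorm g <= C%:E)%E -> `|g (fun=> x)| <= C * `|x| ^+ k.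
Proof.
move=> lg gC; have := multilinear_bound (fun=> x) lg gC.
by rewrite prodr_const card_ord.
Qed.

(** Arguments are changed from x to y one at a time; each of the k changes costs C |x - y|
    M^(k-1). *)
Lemma multilinear_diag_lipschitz k (g : kform V k) C M x y : multilinear g ->
  (formnorm g <= C%:E)%E -> `|x| <= M -> `|y| <= M ->
  `|g (fun=> x) - g (fun=> y)| <= k%:R * (C * `|x - y| * M ^+ k.-1).
Proof.
move=> lg gC xM yM.
have M0 : 0 <= M by apply: le_trans xM.
pose h (j : nat) (i : 'I_k) := if (i < j)%N then y else x.
have h0 : h 0%N = (fun=> x) by [].
have hk : h k = (fun=> y) by apply/funext => i; rewrite /h ltn_ord.
rewrite -h0 -hk.
have H j : (j <= k)%N -> `|g (h 0%N) - g (h j)| <= j%:R * (C * `|x - y| * M ^+ k.-1).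
  elim: j => [_|j IH jk]; first by rewrite subrr normr0 mul0r.
  apply: (le_trans (ler_distD (g (h j)) _ _)).
  rewrite -natr1 mulrDl mul1r lerD//; first exact/IH/ltnW.
  pose i := Ordinal jk.
  have -> : h j = ins i (h j) x.
    by rewrite -[LHS](insE i); congr ins; rewrite /h /= ltnn.
  have -> : h j.+1 = ins i (h j) y.
    apply/funext => l; rewrite /ins /h ltnS leq_eqVlt -val_eqE /=.
    by case: eqP.
  rewrite multilinear_insB//; apply: (le_trans (multilinear_bound _ lg gC)).
  rewrite (bigD1 i)//= {1}/ins eqxx mulrA ler_wpM2l//.
    rewrite mulr_ge0//.
    have : ((`|g (fun=> 0)|)%:E <= C%:E)%E.
      apply: le_trans gC; apply: ereal_sup_ubound; exists (fun=> 0) => //= l.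
      by rewrite normr0.
    by rewrite lee_fin; exact: le_trans.
  rewrite (_ : k.-1 = #|[pred l : 'I_k | l != i]|); last first.
    by rewrite cardC1 card_ord.
  rewrite -prodr_const; apply: ler_prod => l li; rewrite normr_ge0/= /ins.
  by rewrite (negbTE li) /h; case: ifP.
exact: H.
Qed.

Lemma vcons_diag k (h : V) : vcons h (fun _ : 'I_k => h) = fun=> h.
Proof. by apply/funext => i; rewrite /vcons; case: unliftP. Qed.

Lemma vconsE k (h : V) (v : 'I_k -> V) : vcons h v = ins ord0 (vcons 0 v) h.
Proof.
by apply/funext => i; rewrite /vcons /ins; case: unliftP => [j ->|->]; rewrite ?eqxx// (negbTE (neq_lift _ _)).
Qed.

Lemma multilinear_vconsZ k (g : kform V k.+1) a h v : multilinear g ->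
  g (vcons (a *: h) v) = a * g (vcons h v).
Proof. by move=> lg; rewrite vconsE multilinear_insZ// -vconsE. Qed.

Lemma multilinear_vcons k (g : kform V k.+1) h : multilinear g ->
  multilinear (fun v => g (vcons h v)).
Proof.
move=> lg i v a x y /=.
have E z : vcons h (fun j => if j == i then z else v j) =
    ins (lift ord0 i) (vcons h v) z.
  apply/funext => j; rewrite /vcons /ins; case: unliftP => [l ->|->].
    by rewrite (inj_eq lift_inj).
  by rewrite (negbTE (neq_lift _ _)).
by rewrite !E /ins; exact: lg.
Qed.

End multilinear_forms.

Lemma zorderE (R : realType) (s : R) : 0 < s ->
  [/\ s = (zorder s)%:R + zexponent s, 0 < zexponent s & zexponent s <= 1].
Proof.
move=> s0; rewrite /zexponent subrKC subr_gt0 lerBlDl natr1; split => //;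
rewrite /zorder.
  have c0 : 0 < Num.ceil s by rewrite ceil_gt0.
  have -> : (`|Num.ceil s|%N.-1)%:R = (Num.ceil s - 1)%:~R :> R.
    by rewrite pmulrn -subn1 -subzn ?absz_gt0 ?gt_eqF// gez0_abs// ltW.
  by have /andP[] := ceil_itv s.
rewrite prednK ?absz_gt0 ?gt_eqF ?ceil_gt0// pmulrn gez0_abs ?ceil_ge//.
by rewrite ltW// ceil_gt0.
Qed.

Section taylor_remainder.
Context {R : realType} {V : normedModType R}.
Variables (s : R) (f : V -> R) (D : forall k, V -> kform V k).
Arguments D : clear implicits.
Hypothesis s0 : 0 < s.
Local Notation m := (zorder s).
Local Notation al := (zexponent s).
Hypothesis Df : derivative_tower m f D.
Hypothesis Dhol : forall x y, (formnorm (fun v => D m x v - D m y v)%R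
                 <= (`|x - y| `^ al)%:E)%E.

Lemma tower_multilinear k x : (k <= m)%N -> multilinear (D k x).
Proof. by case: Df => _ H _ _ km; case: (H k x km). Qed.

Definition taylor_term j (x : V) : R := D j 0 (fun=> x) / j`!%:R.

Definition taylor_rem (x : V) : R := f x - \sum_(j < m.+1) taylor_term j x.

Lemma taylor_termZ j t x : (j <= m)%N -> taylor_term j (t *: x) = t ^+ j * taylor_term j x.
Proof.
move=> jm; rewrite /taylor_term mulrA; congr (_ / _).
rewrite (multilinear_scale (fun=> t) (fun=> x)); last exact: tower_multilinear.
by rewrite prodr_const card_ord.
Qed.

Lemma taylor_term_bound j : (j <= m)%N ->
  exists2 C, 0 <= C & forall x, `|taylor_term j x| <= C * `|x| ^+ j.
Proof.
move=> jm; have [_ /(_ j 0 jm)[lD bD] _ _] := Df.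
have n0 : (0 <= formnorm (D j 0%R))%E.
  apply: (@le_trans _ _ (`|D j 0 (fun=> 0)|%R)%:E); first by rewrite lee_fin.
  by apply: ereal_sup_ubound; exists (fun=> 0) => //= i; rewrite normr0.
exists (fine (formnorm (D j 0)) / j`!%:R).
  by rewrite divr_ge0// fine_ge0.
move=> x; rewrite normrM normfV normr_nat mulrAC ler_wpM2r ?invr_ge0//.
by apply: multilinear_diag_bound => //; rewrite fineK// ge0_fin_numE.
Qed.

Lemma is_derive_ray k (x : V) (t : R) : (k < m)%N ->
  is_derive t 1 (fun u => D k (u *: x) (fun=> x)) (D k.+1 (t *: x) (fun=> x)).
Proof.
move=> km; apply: is_derive_estimate => e e0.
have [_ _ H _] := Df.
(* Exponent k+1: one power of |x| comes from the increment h x, and k from evaluating the form at x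
   in every argument. *)
have c0 : 0 < `|x| ^+ k.+1 + 1 by rewrite ltr_wpDl// exprn_ge0.
have N0 := H k (t *: x) _ km (divr_gt0 e0 c0).
have lim0 : h *: x @[h --> (0 : R)] --> (0 : V).
  by rewrite -[X in _ --> X](scale0r x); apply: cvgZl; exact: cvg_id.
have lDk := tower_multilinear _ (ltnW km).
have lDk1 := tower_multilinear (t *: x) km.
near=> h.
have bh : (formnorm (fun v : 'I_k -> V => (D k (t *: x + h *: x)%R v -
    D k (t *: x)%R v - D k.+1 (t *: x)%R (vcons (h *: x)%R v))%R) <=
    (e / (`|x| ^+ k.+1 + 1) * `|h *: x|)%:E)%E.
  by near: h; exact: (lim0 _ N0).
have := multilinear_diag_bound x
  (multilinearB (multilinearB (lDk _) (lDk _)) (multilinear_vcons _ lDk1)) bh.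
rewrite /= multilinear_vconsZ// vcons_diag -scalerDl => /le_trans; apply.
rewrite normrZ.
have E (a c r q : R) : e * a * (c * r) * q = e * c * (r * q * a) by ring.
rewrite E -exprS.
by rewrite ler_piMr ?mulr_ge0 ?(ltW e0)// ler_pdivrMr// mul1r lerDl.
Unshelve. all: by end_near. Qed.

(* One-variable Taylor expansion of u |-> f (u x) - f (u y), so that the symmetry
   of the derivatives is never needed. *)
Lemma taylor_rem_diff x y :
  `|taylor_rem x - taylor_rem y| <=
  (1 + m%:R) * (`|x - y| `^ al * (`|x| + `|x - y|) ^+ m).
Proof.
have [_ al0 al1] := zorderE s0.
set h := `|x - y|; set M := `|x| + h.
have h0 : 0 <= h by exact: normr_ge0.
have hM : h <= M by rewrite /M lerDr.
have xM : `|x| <= M by rewrite /M lerDl.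
have yM : `|y| <= M.
  by rewrite /M /h distrC -[y in `|y|](subrKC x) (le_trans (ler_normD _ _)).
have M0 : 0 <= M by apply: le_trans hM.
pose phi k t := D k (t *: x) (fun=> x) - D k (t *: y) (fun=> y).
have dphi k (t : R) : (k < m)%N -> is_derive t 1 (phi k) (phi k.+1 t).
  move=> km; have := is_derive_ray x t km; have := is_derive_ray y t km.
  by move=> ? ?; apply: is_deriveB.
have powle u : 0 <= u -> u <= M -> u `^ al <= M `^ al.
  by move=> u0 uM; rewrite ge0_ler_powR// ?nnegrE// ltW.
(* One factor h is split as h^al h^(1 - al), and h^(1 - al) <= M^(1 - al) because h <= M and al <=
   1. *)
have lipM : m%:R * (M `^ al * h * M ^+ m.-1) <= m%:R * (h `^ al * M ^+ m).
  case: (m) => [|n] /=; first by rewrite !mul0r.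
  rewrite ler_wpM2l//.
  rewrite exprS mulrA ler_wpM2r ?exprn_ge0//.
  have pw u : 0 <= u -> u = u `^ al * u `^ (1 - al).
    move=> u0; rewrite -powRD ?subrKC ?powRr1//.
    by rewrite oner_eq0.
  rewrite [in leLHS](pw h)// [in leRHS](pw M)// mulrCA ler_wpM2l ?powR_ge0//.
  by rewrite ler_wpM2l ?powR_ge0// ge0_ler_powR ?nnegrE// subr_ge0.
have bphi t : 0 <= t <= 1 ->
    `|phi m t - phi m 0| <= (1 + m%:R) * (h `^ al * M ^+ m).
  move=> /andP[t0 t1].
  have lD z : multilinear (D m z) := tower_multilinear z (leqnn m).
  rewrite /phi !scale0r.
  (* Changing the base point from t x to t y costs at most |x - y|^al by the Hoelder condition; the
     remaining form D m (t y) - D m 0 has norm at most |t y|^al, and its diagonal is Lipschitz on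
     bounded sets. *)
  have -> : D m (t *: x) (fun=> x) - D m (t *: y) (fun=> y) -
      (D m 0 (fun=> x) - D m 0 (fun=> y)) =
    (D m (t *: x) (fun=> x) - D m (t *: y) (fun=> x)) +
    ((D m (t *: y) (fun=> x) - D m 0 (fun=> x)) -
     (D m (t *: y) (fun=> y) - D m 0 (fun=> y))).
    by lra.
  rewrite (le_trans (ler_normD _ _))// mulrDl mul1r lerD//.
    apply: (le_trans (multilinear_diag_bound x (multilinearB (lD _) (lD _)) (Dhol _ _))).
    rewrite -scalerBr normrZ ger0_norm// ler_pM ?powR_ge0 ?exprn_ge0//.
      apply: ge0_ler_powR; rewrite ?nnegrE ?mulr_ge0 ?(ltW al0)//.
      exact: ler_piMl.
    by rewrite lerXn2r ?nnegrE.
  apply: le_trans lipM.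
  apply: (le_trans (multilinear_diag_lipschitz (multilinearB (lD _) (lD _)) (Dhol _ _) xM yM)).
  rewrite ler_wpM2l// ler_wpM2r ?exprn_ge0// ler_wpM2r//.
  rewrite subr0 normrZ ger0_norm// powle ?mulr_ge0//.
  by apply: le_trans yM; rewrite ler_piMl.
have := taylor_bound dphi bphi (t := 1); rewrite ler01 lexx => /(_ isT).
congr (`|_| <= _).
rewrite /taylor_rem /phi !scale1r; have [fE _ _ _] := Df; rewrite !fE.
have -> : taylor_sum m
    (fun j => D j (0 *: x) (fun=> x) - D j (0 *: y) (fun=> y)) 1 =
    \sum_(j < m.+1) taylor_term j x - \sum_(j < m.+1) taylor_term j y.
  rewrite -sumrB; apply: eq_bigr => j _.
  by rewrite !scale0r expr1n mulr1 mulrBl.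
have E (a b c d : R) : a - b - (c - d) = a - c - (b - d) by ring.
exact: E.
Qed.

Lemma taylor_rem0 : taylor_rem 0 = 0.
Proof.
rewrite /taylor_rem big_ord_recl big1 => [|j _].
  have [fE _ _ _] := Df.
  by rewrite /taylor_term fE fact0 divr1 addr0 subrr.
rewrite -(scale0r (0 : V)) taylor_termZ; last by rewrite lift0.
by rewrite lift0 exprS !mul0r.
Qed.

Lemma taylor_rem_bound x : `|taylor_rem x| <= (1 + m%:R) * `|x| `^ s.
Proof.
have [sE al0 _] := zorderE s0.
have := taylor_rem_diff 0 x; rewrite taylor_rem0 !sub0r !normrN normr0 add0r.
rewrite -powR_mulrn// -powRD ?(addrC al) -?sE//.
by rewrite (gt_eqF s0).
Qed.

Lemma taylor_growth : exists2 C, 0 <= C & forall x, `|f x| <= C * (1 + `|x| `^ s).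
Proof.
have [sE al0 _] := zorderE s0.
have H j : (j < m.+1)%N -> exists C, 0 <= C /\
    forall x, `|taylor_term j x| <= C * (1 + `|x| `^ s).
  rewrite ltnS => jm; have [C C0 HC] := taylor_term_bound jm; exists C; split => // x.
  apply: (le_trans (HC x)); rewrite ler_wpM2l//.
  have [x1|/ltW x1] := leP `|x| 1.
    by rewrite (le_trans (_ : _ <= 1)) ?lerDl ?powR_ge0// exprn_ile1.
  rewrite -powR_mulrn// (@le_trans _ _ (`|x| `^ s))//; last by rewrite lerDr.
  by rewrite ler_powR// sE (le_trans (_ : _ <= m%:R)) ?ler_nat// lerDl ltW.
have [C HC] : exists C : 'I_m.+1 -> R, forall j, 0 <= C j /\
    forall x, `|taylor_term j x| <= C j * (1 + `|x| `^ s).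
  have {}H (j : 'I_m.+1) := H j (ltn_ord j).
  by have [C HC] := choice H; exists C.
exists (1 + m%:R + \sum_j C j).
  by rewrite !addr_ge0// sumr_ge0// => j _; case: (HC j).
move=> x; have -> : f x = taylor_rem x + \sum_(j < m.+1) taylor_term j x.
  by rewrite subrK.
rewrite (le_trans (ler_normD _ _))// mulrDl lerD//.
  by rewrite (le_trans (taylor_rem_bound x))// ler_wpM2l// lerDr.
rewrite (le_trans (ler_norm_sum _ _ _))// mulr_suml ler_sum// => j _.
by case: (HC j).
Qed.

Lemma tower_continuous : continuous f.
Proof.
move=> x; have [fE bD D3 D4] := Df.
have fn0 (g : kform V 0) C : (formnorm g <= C%:E)%E -> forall v, `|g v| <= C.
  move=> gC v; rewrite -lee_fin; apply: le_trans gC.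
  by apply: ereal_sup_ubound; exists v => // -[].
pose v0 (i : 'I_0) : V := 0.
apply/cvgrPdist_le => e e0; case: (posnP m) => [m0|m0].
  have := D4 x e e0; rewrite m0; apply: filterS => y /fn0/(_ v0).
  by rewrite !fE distrC.
have [C C0 HC] : exists2 C, 0 <= C & forall h, `|D 1%N x (fun=> h)| <= C * `|h|.
  have [lD b1] := bD 1%N x m0.
  have f0 : (0 <= formnorm (D 1%N x))%E.
    apply: (@le_trans _ _ (`|D 1%N x (fun=> 0)|%R)%:E); first by rewrite lee_fin.
    by apply: ereal_sup_ubound; exists (fun=> 0) => //= i; rewrite normr0.
  exists (fine (formnorm (D 1%N x))); first exact: fine_ge0.
  move=> h; have := multilinear_diag_bound h lD; rewrite expr1; apply.
  by rewrite fineK// ge0_fin_numE.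
have N1 := D3 0%N x 1 m0 ltr01.
have c0 : 0 < e / (1 + C) by rewrite divr_gt0// ltr_wpDr.
have N2 : \forall h \near (0 : V), `|h| < e / (1 + C).
  apply/nbhs_ballP; exists (e / (1 + C)) => // h.
  by rewrite -ball_normE /= sub0r normrN.
have N : \forall h \near (0 : V), `|f (x + h) - f x| <= e.
  near=> h.
  have h1 : `|f (x + h) - f x - D 1%N x (fun=> h)| <= 1 * `|h|.
    have : (formnorm (fun v => D 0%N (x + h)%R v - D 0%N x v - D 1%N x (vcons h v))%R
      <= (1 * `|h|)%:E)%E by near: h.
    move=> /fn0/(_ v0); rewrite !fE (_ : vcons h v0 = fun=> h)//.
    by apply/funext => i; rewrite /vcons; case: unliftP => // -[].
  have h2 : `|h| < e / (1 + C) by near: h.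
  have h3 := HC h.
  rewrite ltr_pdivlMr ?ltr_wpDr// in h2.
  have := ler_normD (f (x + h) - f x - D 1%N x (fun=> h)) (D 1%N x (fun=> h)).
  rewrite subrK => /le_trans; apply; apply: le_trans (ltW h2).
  by rewrite mul1r in h1; rewrite mulrDr mulr1 lerD// mulrC.
have /nbhs_ballP[r /= r0 Hr] := N.
apply/nbhs_ballP; exists r => // y xy; rewrite /= distrC.
have := Hr (y - x); rewrite /= subrKC; apply.
by move: xy; rewrite -!ball_normE /= sub0r normrN distrC.
Unshelve. all: by end_near. Qed.

End taylor_remainder.

(** * Power inequalities, rescaling of test functions and expansions in powers *)

Section power_inequalities.
Context {R : realType}.

Lemma powRD_le (s a h : R) : 0 < s -> 0 <= a -> 0 <= h ->
  (a + h) `^ s <= 2 `^ s * (a `^ s + h `^ s).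
Proof.
move=> s0 a0 h0; have [ah|/ltW ah] := leP a h.
  apply: (@le_trans _ _ ((2 * h) `^ s)).
    by rewrite ge0_ler_powR ?nnegrE ?addr_ge0 ?mulr_ge0 ?(ltW s0)// mulr_natl mulr2n lerD2r.
  by rewrite powRM// ler_wpM2l ?powR_ge0// lerDr powR_ge0.
apply: (@le_trans _ _ ((2 * a) `^ s)).
  by rewrite ge0_ler_powR ?nnegrE ?addr_ge0 ?mulr_ge0 ?(ltW s0)// mulr_natl mulr2n lerD2l.
by rewrite powRM// ler_wpM2l ?powR_ge0// lerDl powR_ge0.
Qed.

(** With delta^al = e / ((1 + m) 2^s), either h <= delta (a + h), and the left side is at most (1 +
    m) delta^al (a + h)^s <= e (a^s + h^s), or a + h < h / delta, and it is at most (1 + m)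
    delta^(-m) h^s. As C depends only on e and s, the coupling estimate becomes uniform over test
    functions. *)
Lemma remainder_young (s e : R) : 0 < s -> 0 < e -> exists2 C, 0 <= C &
  forall a h : R, 0 <= a -> 0 <= h ->
    (1 + (zorder s)%:R) * (h `^ zexponent s * (a + h) ^+ zorder s) <=
    e * a `^ s + C * h `^ s.
Proof.
move=> s0 e0; have [sE al0 al1] := zorderE s0.
set m := zorder s in sE *; set al := zexponent s in sE al0 al1 *.
have c0 : 0 < 1 + m%:R :> R by rewrite ltr_wpDr.
have p2 : 0 < 2 `^ s :> R by rewrite powR_gt0.
pose q := e / ((1 + m%:R) * 2 `^ s).
have q0 : 0 < q by rewrite divr_gt0// mulr_gt0.
pose de := q `^ al^-1.
have de0 : 0 < de by rewrite powR_gt0.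
have deal : de `^ al = q by rewrite -powRrM mulVf ?gt_eqF// powRr1// ltW.
have pw M : 0 <= M -> M `^ al * M ^+ m = M `^ s.
  by move=> M0; rewrite -powR_mulrn// -powRD ?(addrC al) -?sE// (gt_eqF s0).
exists (e + (1 + m%:R) * de^-1 ^+ m).
  by rewrite addr_ge0 ?(ltW e0)// mulr_ge0 ?(ltW c0)// exprn_ge0// invr_ge0 ltW.
move=> a h a0 h0; have M0 : 0 <= a + h by rewrite addr_ge0.
have [hM|Mh] := leP h (de * (a + h)).
  apply: (@le_trans _ _ (e * (a `^ s + h `^ s))); last first.
    rewrite mulrDr lerD2l ler_wpM2r ?powR_ge0// lerDl mulr_ge0 ?(ltW c0)//.
    by rewrite exprn_ge0// invr_ge0 ltW.
  apply: (@le_trans _ _ ((1 + m%:R) * (q * (a + h) `^ s))).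
    rewrite ler_wpM2l ?(ltW c0)// -pw// mulrA ler_wpM2r ?exprn_ge0//.
    rewrite -deal -powRM ?(ltW de0)// ge0_ler_powR ?nnegrE ?(ltW al0)//.
    by rewrite mulr_ge0// ltW.
  apply: (@le_trans _ _ ((1 + m%:R) * (q * (2 `^ s * (a `^ s + h `^ s))))).
    by rewrite ler_wpM2l ?(ltW c0)// ler_wpM2l ?(ltW q0)// powRD_le.
  have E (b c p r : R) : b * (c * (p * r)) = c * (b * p) * r by ring.
  by rewrite E /q divfK// gt_eqF// mulr_gt0.
apply: (@le_trans _ _ ((1 + m%:R) * de^-1 ^+ m * h `^ s)); last first.
  by rewrite (mulrDl e) addrA lerDr addr_ge0// mulr_ge0 ?powR_ge0// ltW.
rewrite -mulrA ler_wpM2l ?(ltW c0)// -pw// mulrCA ler_wpM2l ?powR_ge0//.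
rewrite -exprMn lerXn2r ?nnegrE ?mulr_ge0 ?invr_ge0 ?(ltW de0)//.
by rewrite ler_pdivlMl// ltW.
Qed.

End power_inequalities.

Section affine_substitution.
Context {R : realType} {V : normedModType R}.

Lemma formnorm_le k (g : kform V k) (C : R) :
  (forall v, (forall i, `|v i| <= 1) -> `|g v| <= C) -> (formnorm g <= C%:E)%E.
Proof.
by move=> H; apply: ge_ereal_sup => _ [v v1 <-]; rewrite lee_fin; exact: H.
Qed.

Lemma formnorm_comp k (g : kform V k) (a : V -> V) (lam C : R) : multilinear g ->
  (formnorm g <= C%:E)%E -> 0 <= lam -> (forall x, `|a x| <= lam * `|x|) ->
  (formnorm (fun v => g (fun i => a (v i))) <= (C * lam ^+ k)%:E)%E.
Proof.
move=> lg gC lam0 alam; apply: formnorm_le => v v1.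
apply: (le_trans (multilinear_bound _ lg gC)).
have C0 : 0 <= C.
  have : ((`|g (fun=> 0)|)%:E <= C%:E)%E.
    by apply: le_trans gC; apply: ereal_sup_ubound; exists (fun=> 0) => //= l; rewrite normr0.
  by rewrite lee_fin; exact: le_trans.
rewrite ler_wpM2l// -[in leRHS](card_ord k) -prodr_const; apply: ler_prod => i _.
by rewrite normr_ge0/= (le_trans (alam _))// ler_piMr.
Qed.

Lemma multilinear_comp k (g : kform V k) (a : V -> V) : linear a ->
  multilinear g -> multilinear (fun v => g (fun i => a (v i))).
Proof.
move=> la lg i v c x y /=.
have E z : (fun j => a (if j == i then z else v j)) =
    (fun j => if j == i then a z else a (v j)).
  by apply/funext => j; case: ifP.
by rewrite !E la; exact: lg.
Qed.

Lemma multilinearZ k (g : kform V k) c : multilinear g ->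
  multilinear (fun v => c * g v).
Proof. by move=> lg i v a x y /=; rewrite lg mulrDr mulrCA. Qed.

(** Composing the k-th derivative with [a] in each argument multiplies its norm by at most lam^k. In
    the Hoelder condition the m arguments give lam^m and the distance of the base points lam^al,
    together lam^s. *)
Lemma zolotarev_class_affine (s : R) (f : V -> R) (a : V -> V) (c : V) (lam : R) :
  0 < s -> zolotarev_class s f -> linear a -> 0 < lam ->
  (forall x, `|a x| <= lam * `|x|) ->
  zolotarev_class s (fun x => (lam `^ s)^-1 * f (a x + c)).
Proof.
move=> s0 [D [fE bD D3 D4] Dh] la lam0 alam.
have [sE al0 al1] := zorderE s0.
set m := zorder s in sE bD D3 D4 Dh *; set al := zexponent s in sE al0 al1 Dh *.
pose kap := (lam `^ s)^-1.
have kap0 : 0 < kap by rewrite invr_gt0 powR_gt0.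
have aB x y : a (x - y) = a x - a y.
  by have := la (-1) y x; rewrite !scaleN1r (addrC (- y)) (addrC (- a y)).
have lD k x : (k <= m)%N -> multilinear (D k x) by move=> km; case: (bD k x km).
have kbound k (g : kform V k) C : multilinear g -> (formnorm g <= C%:E)%E ->
    (formnorm (fun v => kap * g (fun i => a (v i)))%R <= (kap * (C * lam ^+ k))%:E)%E.
  move=> lg gC; apply: formnorm_le => v v1.
  rewrite normrM gtr0_norm// ler_wpM2l ?(ltW kap0)//.
  have := multilinear_bound v (multilinear_comp la lg) (formnorm_comp lg gC (ltW lam0) alam).
  move=> /le_trans; apply; rewrite ler_piMr//; last first.
    by apply: prodr_ile1 => i _; rewrite normr_ge0 v1.
  have C0 : 0 <= C.
    have : ((`|g (fun=> 0)|)%:E <= C%:E)%E.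
      by apply: le_trans gC; apply: ereal_sup_ubound; exists (fun=> 0) => //= l; rewrite normr0.
    by rewrite lee_fin; exact: le_trans.
  by rewrite mulr_ge0// exprn_ge0// ltW.
have acvg (P : set V) x : (\forall y \near a x + c, P y) -> \forall y \near x, P (a y + c).
  move=> /nbhs_ballP[r /= r0 Hr]; apply/nbhs_ballP; exists (r / lam); first exact: divr_gt0.
  move=> y; rewrite -ball_normE /= => xy; apply: Hr; rewrite -ball_normE /=.
  rewrite opprD addrACA subrr addr0 -aB (le_lt_trans (alam _))//.
  by rewrite mulrC -ltr_pdivlMr.
pose DD k x v := kap * D k (a x + c) (fun i => a (v i)).
exists DD.
  split.
  - by move=> x v; rewrite /DD fE.
  - move=> k x km; have [lg bg] := bD k (a x + c) km; split.
      exact: (multilinearZ kap (multilinear_comp la lg)).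
    have n0 : (0 <= formnorm (D k (a x + c)%R))%E.
      apply: (@le_trans _ _ (`|D k (a x + c) (fun=> 0)|%R)%:E); first by rewrite lee_fin.
      by apply: ereal_sup_ubound; exists (fun=> 0) => //= i; rewrite normr0.
    have gC : (formnorm (D k (a x + c)%R) <= (fine (formnorm (D k (a x + c)%R)))%:E)%E.
      by rewrite fineK// ge0_fin_numE.
    by apply: le_lt_trans (kbound _ _ _ lg gC) _; exact: ltry.
  - move=> k x e km e0.
    (* lam^(k+1): k factors from the arguments and one from the increment a h. *)
    pose e' := e / (kap * lam ^+ k.+1).
    have c0 : 0 < kap * lam ^+ k.+1 by rewrite mulr_gt0 ?exprn_gt0.
    have N := D3 k (a x + c) e' km (divr_gt0 e0 c0).
    have [r /= r0 Hr] : exists2 r : R, 0 < r & ball (0 : V) r `<=` (fun h =>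
      (formnorm (fun v => (D k (a x + c + h) v - D k (a x + c) v - D k.+1 (a x + c) (vcons h v))%R)
        <= (e' * `|h|)%:E)%E).
      by have /nbhs_ballP[r /= r0 Hr] := N; exists r.
    apply/nbhs_ballP; exists (r / lam); first exact: divr_gt0.
    move=> h; rewrite -ball_normE /= sub0r normrN => hr.
    have ahr : ball (0 : V) r (a h).
      rewrite -ball_normE /= sub0r normrN (le_lt_trans (alam _))//.
      by rewrite mulrC -ltr_pdivlMr.
    have lG := multilinearB (multilinearB (lD k (a x + c + a h) (ltnW km)) (lD k (a x + c) (ltnW km)))
      (multilinear_vcons (a h) (lD k.+1 (a x + c) km)).
    have := kbound _ _ _ lG (Hr _ ahr).
    have -> : (fun v : 'I_k -> V => kap * (D k (a x + c + a h) (fun i => a (v i)) -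
        D k (a x + c) (fun i => a (v i)) - D k.+1 (a x + c) (vcons (a h) (fun i => a (v i)))))
      = (fun v => DD k (x + h) v - DD k x v - DD k.+1 x (vcons h v)).
      apply/funext => v; rewrite /DD -!mulrBr.
      have -> : a (x + h) + c = a x + c + a h.
        have := la 1 x h; rewrite !scale1r => ->; by rewrite addrAC.
      have -> // : (fun i => a (vcons h v i)) = vcons (a h) (fun i => a (v i)).
      by apply/funext => i; rewrite /vcons; case: unliftP.
    move=> /le_trans; apply; rewrite lee_fin.
    have -> : e * `|h| = kap * (e' * (lam * `|h|) * lam ^+ k).
      rewrite -[in LHS](divfK (lt0r_neq0 c0) e) -/e' exprS.
      by ring.
    rewrite ler_wpM2l ?(ltW kap0)// ler_wpM2r ?exprn_ge0 ?(ltW lam0)//.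
    by rewrite ler_wpM2l// divr_ge0// ltW.
  - move=> x e e0; have c0 : 0 < kap * lam ^+ m by rewrite mulr_gt0 ?exprn_gt0.
    have := acvg _ x (D4 (a x + c) _ (divr_gt0 e0 c0)); apply: filterS => y Hy.
    have := kbound _ _ _ (multilinearB (lD m (a y + c) (leqnn m)) (lD m (a x + c) (leqnn m))) Hy.
    have -> : (fun v : 'I_m -> V => kap * (D m (a y + c) (fun i => a (v i)) -
        D m (a x + c) (fun i => a (v i)))) = (fun v => DD m y v - DD m x v).
      by apply/funext => v; rewrite mulrBr.
    move=> /le_trans; apply; rewrite lee_fin.
    by rewrite mulrCA divfK// gt_eqF.
move=> x y.
have := kbound _ _ _ (multilinearB (lD m (a x + c) (leqnn m)) (lD m (a y + c) (leqnn m))) (Dh _ _).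
have -> : (fun v : 'I_m -> V => kap * (D m (a x + c) (fun i => a (v i)) -
    D m (a y + c) (fun i => a (v i)))) = (fun v => DD m x v - DD m y v).
  by apply/funext => v; rewrite mulrBr.
move=> /le_trans; apply; rewrite lee_fin.
rewrite opprD addrACA subrr addr0 -aB.
have lamE : lam `^ s = lam `^ al * lam ^+ m.
  rewrite -powR_mulrn ?ltW// -powRD; first by rewrite addrC -sE.
  by rewrite lt0r_neq0 ?implybT.
rewrite /kap ler_pdivrMl ?powR_gt0// lamE mulrAC ler_wpM2r ?exprn_ge0 ?(ltW lam0)//.
rewrite -powRM ?(ltW lam0)// ge0_ler_powR ?nnegrE ?(ltW al0)//.
by rewrite mulr_ge0// ltW.
Qed.

End affine_substitution.

Section power_order.
Context {R : realType}.

(** Substituting t = y^(1/al) reduces to x <= K y on (0, 1]; a positive x is refuted at y = x / (2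
    K). *)
Lemma powR_le0 (x K al : R) : 0 < al ->
  (forall t, 0 < t -> t <= 1 -> x <= K * t `^ al) -> x <= 0.
Proof.
move=> al0 H; have H' y : 0 < y -> y <= 1 -> x <= K * y.
  move=> y0 y1; have := H (y `^ al^-1); rewrite powR_gt0// => /(_ isT).
  rewrite -powRrM mulVf ?gt_eqF// powRr1 ?(ltW y0)//; apply.
  apply: (@le_trans _ _ (1 `^ al^-1)); last by rewrite powR1.
  apply: ge0_ler_powR => //; rewrite ?nnegrE ?(ltW y0)//.
  by rewrite invr_ge0 ltW.
rewrite leNgt; apply/negP => x0.
have K0 : 0 < K.
  by have := H' 1 ltr01 (lexx _); rewrite mulr1; apply: lt_le_trans.
have xK : x <= K by have := H' 1 ltr01 (lexx _); rewrite mulr1.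
have q0 : 0 < x / (2 * K) by rewrite divr_gt0// mulr_gt0.
have xK2 : x / (2 * K) <= 1.
  by rewrite ler_pdivrMr ?mulr_gt0// mul1r (le_trans xK)// ler_peMl ?ler1n// ltW.
have := H' _ q0 xK2; have -> : K * (x / (2 * K)) = x / 2.
  by field; rewrite gt_eqF.
by rewrite leNgt ltr_pdivrMr// mulr_natr mulr2n ltrDl x0.
Qed.

(** Subtracting the terms below j and dividing by t^j leaves c j, higher powers of t that are at
    most t <= t^al, and a remainder of order t^(s-j) <= t^al. This one estimate serves both the
    measurability of the Taylor terms and the equality of Taylor moments. *)
Lemma expansion_coef (s t F C : R) (c : nat -> R) j : 0 < s -> 0 < t -> t <= 1 ->
  0 <= C -> `|F - \sum_(i < (zorder s).+1) t ^+ i * c i| <= C * t `^ s ->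
  (j <= zorder s)%N ->
  `|(t ^+ j)^-1 * (F - \sum_(i < j) t ^+ i * c i) - c j| <=
  (C + \sum_(i < (zorder s).+1) `|c i|) * t `^ zexponent s.
Proof.
move=> s0 t0 t1 C0 FC jm; have [sE al0 al1] := zorderE s0.
set m := zorder s in sE jm FC *; set al := zexponent s in sE al0 al1 *.
have tj0 : 0 < t ^+ j by rewrite exprn_gt0.
have talE : t `^ s = t ^+ j * t `^ (s - j%:R).
  by rewrite -powR_mulrn ?(ltW t0)// -powRD ?subrKC// lt0r_neq0 ?implybT.
have tal : t `^ (s - j%:R) <= t `^ al.
  by rewrite ger_powR ?t0// sE addrAC lerDr subr_ge0 ler_nat.
have t1al : t <= t `^ al by rewrite -{1}(powRr1 (ltW t0)) ger_powR ?t0.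
have split_sum : \sum_(i < m.+1) t ^+ i * c i = \sum_(i < j) t ^+ i * c i +
    t ^+ j * c j + \sum_(j.+1 <= i < m.+1) t ^+ i * c i.
  rewrite -!(big_mkord xpredT (fun i => t ^+ i * c i)).
  rewrite (big_cat_nat (n := j.+1)) ?ltnS//=.
  by rewrite big_nat_recr.
have -> : (t ^+ j)^-1 * (F - \sum_(i < j) t ^+ i * c i) - c j =
    (t ^+ j)^-1 * (F - \sum_(i < m.+1) t ^+ i * c i) +
    (t ^+ j)^-1 * \sum_(j.+1 <= i < m.+1) t ^+ i * c i.
  rewrite -mulrDr split_sum; apply: (mulfI (lt0r_neq0 tj0)).
  by rewrite mulrBr !mulrA mulfV ?lt0r_neq0// !mul1r; ring.
rewrite (le_trans (ler_normD _ _))// mulrDl lerD//.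
  rewrite normrM gtr0_norm ?invr_gt0// ler_pdivrMl// (le_trans FC)// talE.
  by rewrite mulrCA ler_wpM2l ?(ltW tj0)// ler_wpM2l.
rewrite normrM gtr0_norm ?invr_gt0// ler_pdivrMl//.
rewrite (le_trans (ler_norm_sum _ _ _))// mulrA mulr_sumr mulr_suml.
rewrite -(big_mkord xpredT (fun i => t ^+ j * `|c i| * t `^ al)).
rewrite [leRHS](big_cat_nat (n := j.+1)) ?ltnS//= ler_wpDl//.
  by apply: sumr_ge0 => i _; rewrite !mulr_ge0 ?powR_ge0// ltW.
rewrite ler_sum_nat// => i /andP[ji im].
rewrite normrM ger0_norm ?exprn_ge0 ?(ltW t0)// mulrAC ler_wpM2r//.
rewrite -(subnKC (ltnW ji)) exprD ler_wpM2l ?(ltW tj0)//.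
apply: le_trans t1al.
rewrite -[leRHS]expr1 ler_wiXn2l ?(ltW t0)// subn_gt0//.
Qed.

Lemma expansion_coef0 (s C : R) (c : nat -> R) : 0 < s -> 0 <= C ->
  (forall t, 0 < t -> t <= 1 ->
    `|\sum_(i < (zorder s).+1) t ^+ i * c i| <= C * t `^ s) ->
  forall j, (j <= zorder s)%N -> c j = 0.
Proof.
move=> s0 C0 H; have [_ al0 _] := zorderE s0.
elim/ltn_ind => j IH jm.
apply/eqP; rewrite -normr_le0; apply: (powR_le0 (K := C + \sum_(i < (zorder s).+1) `|c i|) al0) => t t0 t1.
have := expansion_coef (F := 0) (c := c) s0 t0 t1 C0 _ jm.
rewrite sub0r normrN => /(_ (H t t0 t1)).
rewrite big1 ?subr0 ?mulr0 ?sub0r ?normrN// => i _.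
by rewrite (IH i) ?mulr0// (leq_trans _ jm)// ltnW.
Qed.

End power_order.

(** * Integrals of test functions and comparison under a coupling *)

Section integral_tools.
Context d (T : measurableType d) (R : realType) (mu : {measure set T -> \bar R}).
Local Open Scope ereal_scope.

(* No measurability: the integral of a nonnegative function is a lower integral.
   The operator norm of a difference of operators need not be measurable. *)
Lemma ge0_le_lower_integral (D : set T) (f g : T -> \bar R) :
  (forall x, D x -> 0 <= f x) -> (forall x, D x -> f x <= g x) ->
  \int[mu]_(x in D) f x <= \int[mu]_(x in D) g x.
Proof.
move=> f0 fg; have g0 x : D x -> 0 <= g x by move=> Dx; rewrite (le_trans (f0 x Dx)) ?fg.
rewrite !ge0_integralE//; apply: ge_ereal_sup => _ [h /= hf <-].
apply: ereal_sup_ubound; exists h => // x.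
apply: (le_trans (hf x)); rewrite /patch; case: ifPn => // xD.
by apply: fg; rewrite inE in xD.
Qed.

Lemma Rintegral_EFin (f : T -> R) : mu.-integrable setT (EFin \o f) ->
  \int[mu]_x (f x)%:E = (\int[mu]_x f x)%R%:E.
Proof. by move=> fi; rewrite /Rintegral fineK//; exact: integrable_fin_num. Qed.

Lemma ge0_integrableP (f : T -> R) : measurable_fun setT f ->
  (forall x, 0 <= f x)%R -> \int[mu]_x (f x)%:E < +oo ->
  mu.-integrable setT (EFin \o f).
Proof.
move=> mf f0 foo; apply/integrableP; split; first exact/measurable_EFinP.
by under eq_integral => x _ do rewrite /= ger0_norm//.
Qed.

Lemma Rintegral_sum (I : Type) (r : seq I) (P : pred I) (h : I -> T -> R) :
  (forall i, P i -> mu.-integrable setT (EFin \o h i)) ->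
  (\int[mu]_x (\sum_(i <- r | P i) h i x) = \sum_(i <- r | P i) \int[mu]_x h i x)%R.
Proof.
move=> hi; elim: r => [|i r IH].
  rewrite big_nil; under eq_Rintegral do rewrite big_nil.
  by rewrite Rintegral_cst// mul0r.
rewrite big_cons; under eq_Rintegral do rewrite big_cons.
case: ifPn => // Pi; rewrite RintegralD//; [by rewrite IH|exact: hi|].
rewrite (_ : EFin \o _ = fun x => \sum_(i <- r | P i) (EFin \o h i) x).
  by apply: integrable_sum.
by apply/funext => x; rewrite /= sumEFin.
Qed.

End integral_tools.

Section test_functions_theory.
Context {R : realType} (B : ambient R).
Variable s : R.
Hypothesis s0 : 0 < s.
Implicit Types f : carrier B -> R.

(** For separable Banach B a test function is continuous and hence Borel, so that both cases share
    one description; in D[0,1] it is continuous for the uniform norm, and measurability is a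
    requirement. *)
Lemma test_functionsP f : test_functions s f <->
  @zolotarev_class R (carrier B) s f /\ measurable_fun setT f.
Proof.
case: B f => [V sV|] f //=; split => [fs|[]//]; split => //.
apply: (measurability _ (RGenOpens.measurableE R)) => _ [_ [a [b ->]] <-].
rewrite setTI; apply: ambient_open_measurable; apply/ambient_openP => /=.
have [D Df _] := fs.
have : open `]a, b[%classic by exact: interval_open.
by apply: open_comp => x _; exact: (tower_continuous Df).
Qed.

Lemma test_affine f (a : carrier B -> carrier B) c lam :
  test_functions s f -> linear a -> measurable_fun setT a -> 0 < lam ->
  (forall x, `|a x| <= lam * `|x|) ->
  test_functions s (fun x => (lam `^ s)^-1 * f (a x + c)).
Proof.
move=> /test_functionsP[fs mf] la ma lam0 alam; apply/test_functionsP; split.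
  exact: zolotarev_class_affine.
apply: measurable_funM => //; apply: (measurableT_comp mf).
by apply: measurable_funD_amb.
Qed.

Definition smoment d (T : measurableType d) (m : probability T R) (U : T -> carrier B) :=
  (\int[m]_w (`|U w| `^ s)%:E)%E.

Section on_probability_space.
Context d (T : measurableType d) (m : probability T R).
Implicit Types U V : T -> carrier B.

Lemma measurable_norm_powR U : measurable_fun setT U ->
  measurable_fun setT (fun w => `|U w| `^ s).
Proof.
move=> mU; apply: (measurableT_comp (@measurable_powR R s)).
exact: measurable_fun_norm_comp.
Qed.

Lemma integrable_norm_powR U : measurable_fun setT U -> (smoment m U < +oo)%E ->
  m.-integrable setT (EFin \o (fun w => `|U w| `^ s)).
Proof.
move=> mU; apply: ge0_integrableP; first exact: measurable_norm_powR.
by move=> w; exact: powR_ge0.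
Qed.

Lemma integrable_growth U (g : carrier B -> R) C : measurable_fun setT U ->
  (smoment m U < +oo)%E -> measurable_fun setT g ->
  (forall x, `|g x| <= C * (1 + `|x| `^ s)) ->
  m.-integrable setT (EFin \o (g \o U)).
Proof.
move=> mU iU mg gC.
apply: (@le_integrable _ _ _ _ _ measurableT _
  (EFin \o (fun w => C * (1 + `|U w| `^ s)))) => //.
- by apply/measurable_EFinP; exact: (measurableT_comp mg).
- by move=> w _ /=; rewrite lee_fin (le_trans (gC _))// ler_norm.
pose h w := `|U w| `^ s.
have -> : EFin \o (fun w => C * (1 + h w)) =
    (fun w => C%:E * (cst 1 \+ (EFin \o h)) w)%E.
  by apply/funext => w /=; rewrite EFinM EFinD.
apply: integrableZl => //; apply: integrableD => //.
  by apply: finite_measure_integrable_cst.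
exact: integrable_norm_powR.
Qed.

Lemma integrable_test f U : test_functions s f -> measurable_fun setT U ->
  (smoment m U < +oo)%E -> m.-integrable setT (EFin \o (f \o U)).
Proof.
move=> /test_functionsP[[D Df Dh] mf] mU iU.
have [C _ fC] := taylor_growth s0 Df Dh; exact: integrable_growth fC.
Qed.

End on_probability_space.

Section one_test_function.
Variables (f : carrier B -> R) (D : forall k, carrier B -> kform (carrier B) k).
Arguments D : clear implicits.
Hypothesis mf : measurable_fun setT f.
Hypothesis Df : derivative_tower (zorder s) f D.
Hypothesis Dh : forall x y, (formnorm (fun v => D (zorder s) x v - D (zorder s) y v)%R
                 <= (`|x - y| `^ zexponent s)%:E)%E.
Local Notation m := (zorder s).
Local Notation c := (taylor_term D).

Lemma taylor_ray t x : 0 < t ->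
  `|f (t *: x) - \sum_(i < m.+1) t ^+ i * c i x| <=
  (1 + m%:R) * `|x| `^ s * t `^ s.
Proof.
move=> t0; have := taylor_rem_bound s0 Df Dh (t *: x).
rewrite normrZ gtr0_norm// powRM ?(ltW t0)// (mulrC (t `^ s)) mulrA.
congr (`|_ - _| <= _); apply: eq_bigr => i _.
by rewrite (taylor_termZ Df)// -ltnS.
Qed.

(** A bounded form on D[0,1] is continuous for the uniform norm, which gives no Borel measurability
    for d_sk. By induction on j, the term is the pointwise limit along t = 1/(n+1) of t^(-j) times
    f(t x) minus its lower Taylor terms, and these are measurable. *)
Lemma measurable_taylor_term j : (j <= m)%N -> measurable_fun setT (c j).
Proof.
elim/ltn_ind: j => j IH jm; have [_ al0 _] := zorderE s0.
pose t n : R := n.+1%:R^-1.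
have t0 n : 0 < t n by rewrite invr_gt0.
have t1 n : t n <= 1 by rewrite invf_le1 ?ler1n.
pose h n x := (t n ^+ j)^-1 * (f (t n *: x) - \sum_(i < j) t n ^+ i * c i x).
apply: (@measurable_fun_cvg _ _ _ _ h) => //.
  move=> n; apply: measurable_funM => //; apply: measurable_funB.
    by apply: (measurableT_comp mf); exact: measurable_funZ_amb.
  apply: measurable_sum => i; apply: measurable_funM => //.
  by apply: IH => //; rewrite (leq_trans _ jm)// ltnW.
move=> x _; apply/cvgrPdist_le => e e0.
pose K := (1 + m%:R) * `|x| `^ s + \sum_(i < m.+1) `|c i x|.
have K0 : 0 <= K.
  by rewrite addr_ge0 ?mulr_ge0 ?addr_ge0 ?powR_ge0// sumr_ge0.
have Kb n : `|c j x - h n x| <= K * t n `^ zexponent s.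
  rewrite distrC; apply: (expansion_coef (c := c^~ x) s0 (t0 n) (t1 n) _ (taylor_ray x (t0 n)) jm).
  by rewrite mulr_ge0 ?addr_ge0 ?powR_ge0.
have q0 : 0 < (e / (K + 1)) `^ (zexponent s)^-1.
  by rewrite powR_gt0// divr_gt0// ltr_wpDl.
near=> n; apply: (le_trans (Kb n)).
have tn : t n < (e / (K + 1)) `^ (zexponent s)^-1.
  by near: n; exact: (near_infty_natSinv_lt (PosNum q0)).
have : t n `^ zexponent s <= e / (K + 1).
  have y0 : 0 < e / (K + 1) by rewrite divr_gt0// ltr_wpDl.
  move: (e / (K + 1)) y0 tn => y y0 tn.
  have -> : y = (y `^ (zexponent s)^-1) `^ zexponent s.
    by rewrite -powRrM mulVf ?gt_eqF// powRr1// ltW.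
  by rewrite ge0_ler_powR ?nnegrE ?powR_ge0 ?(ltW al0) ?(ltW (t0 n)) ?(ltW tn).
have K10 : 0 < K + 1 by rewrite ltr_wpDl.
rewrite (ler_pdivlMr _ _ K10) => H; apply: le_trans H.
by rewrite mulrDr mulr1 mulrC lerDl powR_ge0.
Unshelve. all: by end_near. Qed.

Section coupled.
Context d (T : measurableType d) (P : probability T R).
Implicit Types U V : T -> carrier B.

Lemma integrable_taylor_term j U : (j <= m)%N -> measurable_fun setT U ->
  (smoment P U < +oo)%E -> P.-integrable setT (EFin \o (c j \o U)).
Proof.
move=> jm mU iU; have [C C0 HC] := taylor_term_bound Df jm.
have [sE al0 al1] := zorderE s0.
apply: (integrable_growth (C := C) mU iU); first exact: measurable_taylor_term.
move=> x; apply: (le_trans (HC x)); rewrite ler_wpM2l//.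
have [x1|/ltW x1] := leP `|x| 1.
  by rewrite (le_trans (_ : _ <= 1)) ?lerDl ?powR_ge0// exprn_ile1.
rewrite -powR_mulrn// (@le_trans _ _ (`|x| `^ s))//; last by rewrite lerDr.
by rewrite ler_powR// sE (le_trans (_ : _ <= m%:R)) ?ler_nat// lerDl ltW.
Qed.

Lemma integrable_taylor_sum (e : 'I_m.+1 -> R) U : measurable_fun setT U ->
  (smoment P U < +oo)%E ->
  P.-integrable setT (EFin \o (fun w => \sum_i e i * c i (U w))).
Proof.
move=> mU iU.
have -> : EFin \o (fun w => \sum_i e i * c i (U w)) =
    (fun w => \sum_i ((e i)%:E * (EFin \o (c i \o U)) w)%E)%E.
  by apply/funext => w; rewrite /= -sumEFin.
apply: integrable_sum => // i _.
by apply: integrableZl => //; apply: integrable_taylor_term => //; rewrite -ltnS.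
Qed.

Lemma Rintegral_taylor_sum (e : 'I_m.+1 -> R) U : measurable_fun setT U ->
  (smoment P U < +oo)%E ->
  \int[P]_w (\sum_i e i * c i (U w)) = \sum_i e i * \int[P]_w (c i (U w)).
Proof.
move=> mU iU.
have iC (i : 'I_m.+1) : P.-integrable setT (EFin \o (c i \o U)).
  by apply: integrable_taylor_term => //; rewrite -ltnS.
rewrite Rintegral_sum => [|i _]; last first.
  rewrite (_ : EFin \o _ = (fun w => (e i)%:E * (EFin \o (c i \o U)) w)%E).
    exact: integrableZl.
  by apply/funext.
by apply: eq_bigr => i _; rewrite RintegralZl//; exact: iC.
Qed.

(** Equal Taylor moments allow f to be replaced by its Taylor remainder on both sides;
    [taylor_rem_diff] and the inequality relating e and C then bound the integrand pointwise. *)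
Lemma coupling_bound e C U V : 0 <= C ->
  (forall a h : R, 0 <= a -> 0 <= h ->
    (1 + m%:R) * (h `^ zexponent s * (a + h) ^+ m) <= e * a `^ s + C * h `^ s) ->
  measurable_fun setT U -> measurable_fun setT V ->
  (smoment P U < +oo)%E -> (smoment P V < +oo)%E ->
  (smoment P (fun w => V w - U w)%R < +oo)%E ->
  (forall j, (j <= m)%N -> \int[P]_w c j (U w) = \int[P]_w c j (V w)) ->
  `|\int[P]_w f (U w) - \int[P]_w f (V w)| <=
   e * \int[P]_w (`|V w| `^ s) + C * \int[P]_w (`|V w - U w| `^ s).
Proof.
move=> C0 HC mU mV iU iV iUV cUV.
have mB : measurable_fun setT (fun w => V w - U w) by exact: measurable_funB_amb.
have fU : P.-integrable setT (EFin \o (f \o U)).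
  by have [K _ fC] := taylor_growth s0 Df Dh; exact: integrable_growth fC.
have fV : P.-integrable setT (EFin \o (f \o V)).
  by have [K _ fC] := taylor_growth s0 Df Dh; exact: integrable_growth fC.
pose cs (W : T -> carrier B) w := \sum_(i < m.+1) 1 * c i (W w).
have csU : P.-integrable setT (EFin \o cs U) by exact: integrable_taylor_sum.
have csV : P.-integrable setT (EFin \o cs V) by exact: integrable_taylor_sum.
have remE W w : taylor_rem s f D (W w) = f (W w) - cs W w.
  by rewrite /taylor_rem /cs; congr (_ - _); apply: eq_bigr => i _; rewrite mul1r.
have -> : \int[P]_w f (U w) - \int[P]_w f (V w) =
    \int[P]_w (taylor_rem s f D (U w) - taylor_rem s f D (V w)).
  under [in RHS]eq_Rintegral do rewrite !remE.
  have iRU : P.-integrable setT (EFin \o (fun w => f (U w) - cs U w)).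
    by apply: (integrableB _ fU csU).
  have iRV : P.-integrable setT (EFin \o (fun w => f (V w) - cs V w)).
    by apply: (integrableB _ fV csV).
  rewrite RintegralB// [in RHS]RintegralB// [in X in _ = _ - X]RintegralB//.
  suff -> : \int[P]_w cs U w = \int[P]_w cs V w by ring.
  rewrite !Rintegral_taylor_sum//; apply: eq_bigr => i _.
  by rewrite cUV// -ltnS.
have iN := integrable_norm_powR.
have iR : P.-integrable setT (EFin \o (fun w => taylor_rem s f D (U w) - taylor_rem s f D (V w))).
  rewrite (_ : EFin \o _ = ((EFin \o (f \o U)) \- (EFin \o cs U)) \-
     ((EFin \o (f \o V)) \- (EFin \o cs V)))%E.
    by apply: integrableB => //; apply: integrableB.
  by apply/funext => w /=; rewrite !remE.
apply: (le_trans (le_normr_Rintegral measurableT iR)).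
have i1 := integrable_norm_powR mV iV.
have i2 := integrable_norm_powR mB iUV.
have i1' : P.-integrable setT (EFin \o (fun w => e * `|V w| `^ s)).
  by apply: (integrableZl measurableT e i1).
have i2' : P.-integrable setT (EFin \o (fun w => C * `|V w - U w| `^ s)).
  by apply: (integrableZl measurableT C i2).
rewrite -RintegralZl// -[X in _ <= _ + X]RintegralZl// -RintegralD//.
apply: le_Rintegral => //.
- exact: integrable_norm.
- exact: (integrableD measurableT i1' i2').
move=> w _; rewrite distrC (le_trans (taylor_rem_diff s0 Df Dh _ _))//.
exact: HC.
Qed.

End coupled.
End one_test_function.

(* Scaling f(t x) and letting t tend to 0 separates the Taylor coefficients. *)
Lemma zeta_taylor_moments (mu nu : probability (carrier B) R) Z :
  Ms s mu -> Ms s nu -> 0 <= Z ->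
  (forall f, test_functions s f -> `|\int[mu]_x f x - \int[nu]_x f x| <= Z) ->
  forall f D, measurable_fun setT f -> derivative_tower (zorder s) f D ->
  (forall x y, (formnorm (fun v => D (zorder s) x v - D (zorder s) y v)%R
                 <= (`|x - y| `^ zexponent s)%:E)%E) ->
  forall j, (j <= zorder s)%N ->
    \int[mu]_x taylor_term D j x = \int[nu]_x taylor_term D j x.
Proof.
move=> mus nus Z0 HZ f D mf Df Dh j jm; apply/eqP; rewrite -subr_eq0; apply/eqP.
have fs : test_functions s f.
  by apply/test_functionsP; split => //; exists D.
have mid : measurable_fun setT (@id (carrier B)) by exact: measurable_id.
(* [Z] comes from the test function t^(-s) f(t x), which bounds the difference of the integrals of
   f(t x) by Z t^s; the rest collects the two Taylor remainders. *)
pose K := Z + (1 + (zorder s)%:R) *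
  (\int[mu]_x (`|x| `^ s) + \int[nu]_x (`|x| `^ s)).
have I0 (la : probability (carrier B) R) : 0 <= \int[la]_x (`|x| `^ s).
  by apply: Rintegral_ge0 => x _; exact: powR_ge0.
have K0 : 0 <= K by rewrite addr_ge0// mulr_ge0// ?addr_ge0.
apply: (expansion_coef0 (c := fun j => \int[mu]_x taylor_term D j x -
  \int[nu]_x taylor_term D j x) s0 K0 _ jm) => t t0 t1.
pose cs (x : carrier B) := \sum_(i < (zorder s).+1) t ^+ i * taylor_term D i x.
have ft_test := test_affine (a := fun x => t *: x) 0 fs _ (@measurable_fun_ambZ R B t) t0 _.
have {ft_test} tt : test_functions s (fun x => (t `^ s)^-1 * f (t *: x)).
  have := ft_test; under [X in test_functions s X]eq_fun do rewrite addr0.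
  apply; first by move=> b x y; rewrite scalerDr !scalerA mulrC.
  by move=> x; rewrite normrZ gtr0_norm.
have ts0 : 0 < t `^ s by rewrite powR_gt0.
have iq (la : probability (carrier B) R) : Ms s la ->
    la.-integrable setT (EFin \o (fun x => (t `^ s)^-1 * f (t *: x))).
  by move=> las; exact: (integrable_test tt mid las).
have ift (la : probability (carrier B) R) : Ms s la ->
    la.-integrable setT (EFin \o (fun x => f (t *: x))).
  move=> las; have := integrableZl measurableT (t `^ s) (iq la las).
  congr (_.-integrable _ _); apply/funext => x /=.
  by rewrite -EFinM mulrA mulfV ?mul1r// lt0r_neq0.
have ics (la : probability (carrier B) R) : Ms s la ->
    la.-integrable setT (EFin \o cs).
  by move=> las; exact: (integrable_taylor_sum mf Df Dh (fun i => t ^+ i) mid las).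
have Hla (la : probability (carrier B) R) : Ms s la ->
    `|\int[la]_x f (t *: x) - \sum_(i < (zorder s).+1) t ^+ i * \int[la]_x taylor_term D i x| <=
    (1 + (zorder s)%:R) * t `^ s * \int[la]_x (`|x| `^ s).
  move=> las.
  rewrite -(Rintegral_taylor_sum mf Df Dh (fun i => t ^+ i) mid las).
  have iB : la.-integrable setT (EFin \o (fun x => f (t *: x) - cs x)).
    by apply: (integrableB _ (ift la las) (ics la las)).
  rewrite -RintegralB//; [|exact: ift|exact: ics].
  apply: (le_trans (le_normr_Rintegral measurableT iB)).
  have i1 := integrable_norm_powR mid las.
  rewrite -RintegralZl//; apply: le_Rintegral => //.
  - exact: integrable_norm.
  - by apply: (integrableZl measurableT _ i1).
  move=> x _; rewrite mulrAC; exact: (taylor_ray Df Dh).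
have Hz := HZ _ tt.
rewrite RintegralZl// in Hz; last exact: ift.
rewrite [X in _ - X]RintegralZl// in Hz; last exact: ift.
rewrite -mulrBr normrM gtr0_norm ?invr_gt0// ler_pdivrMl// in Hz.
under eq_bigr do rewrite mulrBr.
rewrite sumrB.
have h1 := Hla mu mus; have h2 := Hla nu nus.
rewrite distrC in h1.
set a := \int[mu]_x f (t *: x) in Hz h1; set b := \int[nu]_x f (t *: x) in Hz h2.
set p := \sum_(i < _) _ in h1 *; set q := \sum_(i < _) _ in h2 *.
have -> : p - q = (p - a) + (a - b) + (b - q) by ring.
rewrite (le_trans (ler_normD _ _))// (le_trans (lerD (ler_normD _ _) h2))//.
rewrite (le_trans (lerD (lerD h1 Hz) (lexx _)))//.
by rewrite /K; lra.
Qed.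

End test_functions_theory.

(** * Product laws *)

Section boxes.
Context d (T : measurableType d) (R : realType).

Definition box n (E : 'I_n -> set T) : set (n.-tuple T) :=
  [set t | forall i, E i (tnth t i)].

Lemma measurable_box n (E : 'I_n -> set T) :
  (forall i, measurable (E i)) -> measurable (box E).
Proof.
move=> mE.
rewrite (_ : box E = \bigcap_i ((@tnth n T)^~ i @^-1` E i)); last first.
  by apply/seteqP; split => t /= H i; [move=> _|]; apply: H.
apply: fin_bigcap_measurable => // i _.
by rewrite -[X in measurable X]setTI; exact: measurable_tnth.
Qed.

Definition mboxes n : set (set (n.-tuple T)) :=
  [set X | exists2 E : 'I_n -> set T, (forall i, measurable (E i)) & X = box E].

Lemma mboxesT n : @mboxes n setT.
Proof. by exists (fun=> setT) => //; apply/seteqP; split. Qed.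

Lemma measurable_tuple_boxes n : @measurable _ (n.-tuple T) = <<s @mboxes n >>.
Proof.
apply/seteqP; split; last first.
  apply: smallest_sub; first exact: sigma_algebra_measurable.
  by move=> _ [E mE ->]; exact: measurable_box.
apply: smallest_sub; first exact: smallest_sigma_algebra.
rewrite -bigcup_seq => X [i /= _ [Y mY <-]]; apply: sub_sigma_algebra.
exists (fun j => if j == i then Y else setT); first by move=> j; case: ifP.
apply/seteqP; split => t /=.
  by move=> [_ Yt] j; case: eqP => // ->.
by move=> /(_ i); rewrite eqxx.
Qed.

Lemma iid_law_box (mu : probability T R) n (E : 'I_n -> set T) :
  (forall i, measurable (E i)) -> iid_law mu n (box E) = (\prod_i mu (E i))%E.
Proof.
elim: n E => [|n IH] E mE.
  rewrite big_ord0 (_ : box E = setT); first by rewrite /= diracT.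
  by apply/seteqP; split => // t _ [].
rewrite big_ord_recl -IH; last by move=> i; exact: mE.
rewrite -product_measure1E//; last by apply: measurable_box.
rewrite /= /pushforward; congr (product_measure1 _ _ _).
apply/seteqP; split => -[x t] /=.
  move=> H; split; first by have := H ord0.
  by move=> i; have := H (lift ord0 i); rewrite tnthS.
by move=> [Ex Et] i; case: (unliftP ord0 i) => [j ->|->] //; rewrite tnthS.
Qed.

End boxes.

Lemma pushforward_exists d1 d2 (T1 : measurableType d1) (T2 : measurableType d2)
    (R : realType) (m : {measure set T1 -> \bar R}) (f : T1 -> T2) :
  measurable_fun setT f -> exists m' : {measure set T2 -> \bar R},
    forall A, m' A = m (f @^-1` A).
Proof.
move=> mf; pose m' : {measure set T2 -> \bar R} := pushforward m f.
by exists (m' mf).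
Qed.

Section product_uniqueness.
Context d d' (Om : measurableType d) (T : measurableType d') (R : realType).
Variables (P : probability Om R) (La : probability T R).

(** For fixed E, the two measures of E x V, as functions of V, are finite measures on tuples that
    agree on boxes, a pi-system generating the tuple sigma-algebra. *)
Lemma product_iid_unique n (m : {measure set (Om * n.-tuple T) -> \bar R}) :
  (forall E (F : 'I_n -> set T), measurable E -> (forall i, measurable (F i)) ->
    m (E `*` box F) = (P E * \prod_i La (F i))%E) ->
  forall X, measurable X -> m X = (P \x iid_law La n)%E X.
Proof.
move=> mE X mX; apply/esym; apply: product_measure_unique => // E U mE' mU.
have PE0 : 0 <= fine (P E) by rewrite fine_ge0.
have mEE : measurable (E `*` [set: n.-tuple T]) by exact: measurableX.
have [m1 m1e] := pushforward_exists (mrestr m mEE) (@measurable_snd _ _ Om (n.-tuple T)).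
pose m2 : {measure set (n.-tuple T) -> \bar R} := mscale (NngNum PE0) (iid_law La n).
have m1E V : measurable V -> m1 V = m (E `*` V).
  move=> mV; rewrite m1e /mrestr; congr (m _).
  by apply/seteqP; split => -[x t] /=; [move=> [? [? _]]|move=> [? ?]].
have m2E V : m2 V = (P E * iid_law La n V)%E.
  by rewrite /m2 /= /mscale /= fineK// fin_num_measure.
rewrite -m1E// -m2E.
apply: (measure_unique (@mboxes _ T n) (fun=> setT)) => //.
- exact: measurable_tuple_boxes.
- move=> _ _ [F1 mF1 ->] [F2 mF2 ->]; exists (fun i => F1 i `&` F2 i).
    by move=> i; exact: measurableI.
  by apply/seteqP; split => t /=; [move=> [h1 h2] i|move=> h; split => i; have [] := h i].
- by move=> _; exact: mboxesT.
- by rewrite bigcup_const.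
- move=> _ [F mF ->]; rewrite m1E; last exact: measurable_box.
  by rewrite m2E mE// iid_law_box.
- move=> _; rewrite m1E//.
  rewrite (_ : setT = box (fun _ : 'I_n => [set: T])); last by apply/seteqP; split.
  rewrite mE// -iid_law_box//.
  rewrite -ge0_fin_numE ?mule_ge0// fin_numM//; apply: fin_num_measure => //.
  exact: measurable_box.
Qed.

Lemma product_iid_rect n E (F : 'I_n -> set T) : measurable E ->
  (forall i, measurable (F i)) ->
  (P \x iid_law La n)%E (E `*` box F) = (P E * \prod_i La (F i))%E.
Proof.
move=> mE mF; rewrite product_measure1E//; last exact: measurable_box.
by congr (_ * _)%E; exact: iid_law_box.
Qed.

Definition resample n (j : 'I_n) (t : n.-tuple T) (x : T) : n.-tuple T :=
  [tuple if i == j then x else tnth t i | i < n].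

Lemma measurable_resample n (j : 'I_n) :
  measurable_fun setT (fun p : (Om * n.-tuple T) * T => (p.1.1, resample j p.1.2 p.2)).
Proof.
apply: measurable_fun_pair => /=.
  by apply: (measurableT_comp measurable_fst); exact: measurable_fst.
apply/measurable_fun_tnthP => i.
rewrite (_ : _ \o _ = fun p : (Om * n.-tuple T) * T => if i == j then p.2 else tnth p.1.2 i); last first.
  by apply/funext => p /=; rewrite tnth_mktuple.
case: (i == j); first exact: measurable_snd.
apply: (measurableT_comp (measurable_tnth i)).
by apply: (measurableT_comp measurable_snd); exact: measurable_fst.
Qed.

(** Redrawing one coordinate keeps the law, as is seen on boxes. This exposes the j-th coordinate as
    a last factor, which Fubini can integrate with all the others frozen. *)
Lemma resample_law n (j : 'I_n) X : measurable X ->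
  ((P \x iid_law La n) \x La)%E
     ((fun p : (Om * n.-tuple T) * T => (p.1.1, resample j p.1.2 p.2)) @^-1` X) =
  (P \x iid_law La n)%E X.
Proof.
move=> mX.
pose phi := fun p : (Om * n.-tuple T) * T => (p.1.1, resample j p.1.2 p.2).
have mphi : measurable_fun setT phi by exact: measurable_resample.
have [m mE'] := pushforward_exists ((P \x iid_law La n) \x La)%E mphi.
rewrite -[LHS]mE'; apply: product_iid_unique => // E F mE mF.
rewrite mE'.
pose F' i := if i == j then setT else F i.
have mF' i : measurable (F' i) by rewrite /F'; case: ifP.
have -> : phi @^-1` (E `*` box F) = (E `*` box F') `*` F j.
  apply/seteqP; split => -[[w t] x] /=.
    move=> [Ew H]; split; [split => // i|].
      by have := H i; rewrite tnth_mktuple /F'; case: ifP.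
    by have := H j; rewrite tnth_mktuple eqxx.
  move=> [[Ew H] Fx]; split => // i; rewrite tnth_mktuple.
  by case: eqP => [->//|/eqP ij]; have := H i; rewrite /F' (negbTE ij).
transitivity ((P \x iid_law La n)%E (E `*` box F') * La (F j))%E.
  by apply: product_measure1E => //; apply: measurableX => //; exact: measurable_box.
transitivity (P E * \prod_i La (F' i) * La (F j))%E.
  by congr (_ * _)%E; exact: product_iid_rect.
rewrite -muleA; congr (_ * _)%E.
rewrite (bigD1 j)//= [in RHS](bigD1 j)//= muleC /F' eqxx.
rewrite probability_setT mul1e; congr (_ * _)%E.
by apply: eq_bigr => i /negbTE ->.
Qed.

End product_uniqueness.

Section image_laws.
Context d1 d2 (T1 : measurableType d1) (T2 : measurableType d2) (R : realType).
Variables (m1 : {measure set T1 -> \bar R}) (m2 : {measure set T2 -> \bar R}).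
Variable phi : T1 -> T2.
Hypothesis mphi : measurable_fun setT phi.
Hypothesis m12 : forall U, measurable U -> m2 U = m1 (phi @^-1` U).
Local Open Scope ereal_scope.

Let integral_push (f : T2 -> \bar R) :
  \int[m2]_x f x = \int[pushforward m1 phi]_x f x.
Proof.
pose m : {measure set T2 -> \bar R} := pushforward m1 phi.
rewrite (eq_measure_integral (m mphi))// => U mU _.
by rewrite m12.
Qed.

Lemma ge0_integral_law (f : T2 -> \bar R) : measurable_fun setT f ->
  (forall x, 0 <= f x) -> \int[m2]_x f x = \int[m1]_x f (phi x).
Proof.
by move=> mf f0; rewrite integral_push ge0_integral_pushforward.
Qed.

Lemma integrable_law_comp (f : T2 -> R) :
  m2.-integrable setT (EFin \o f) -> m1.-integrable setT (EFin \o (f \o phi)).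
Proof.
move=> /integrableP[/measurable_EFinP mf fi]; apply/integrableP; split.
  by apply/measurable_EFinP; exact: (measurableT_comp mf).
rewrite ge0_integral_law// in fi.
by apply/measurable_EFinP; exact: measurableT_comp.
Qed.

Lemma Rintegral_law (f : T2 -> R) :
  m2.-integrable setT (EFin \o f) -> (\int[m2]_x f x = \int[m1]_x f (phi x))%R.
Proof.
move=> fi; have fi' := integrable_law_comp fi.
move: (fi) => /integrableP[mf _].
rewrite /Rintegral; congr fine.
by rewrite integral_push (integral_pushforward mphi mf fi').
Qed.

End image_laws.

(** * Hybrid sums *)

Section paths.
Context {R : realType} (B : ambient R).

Definition path_generators : set (set (nat -> carrier B)) :=
  \bigcup_n preimage_set_system setT (fun x : nat -> carrier B => x n) measurable.

(** Alias carrying the sigma-algebra generated by the coordinates, so that the law of a whole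
    process is a [probability]. *)
Definition path_type : Type := nat -> carrier B.
HB.instance Definition _ := Pointed.on path_type.
HB.instance Definition _ :=
  Measurable.copy path_type (g_sigma_algebraType path_generators).

Lemma measurable_path_coord n : measurable_fun setT (fun x : path_type => x n).
Proof.
move=> _ U mU; apply: sub_sigma_algebra; exists n => //.
by exists U.
Qed.

Lemma measurable_fun_path d (T : measurableType d) (F : T -> path_type) :
  (forall n, measurable_fun setT (fun w => F w n)) -> measurable_fun setT F.
Proof.
move=> mF; apply: (@measurability _ _ T path_type setT F path_generators) => //.
move=> _ [_ [n _ [U mU <-]] <-]; rewrite !setTI.
by rewrite -[X in measurable X]setTI; exact: mF.
Qed.

End paths.

Section sums_of_powers.
Context {R : realType}.

(** With q = (sum of the c_i^s)^(1/s) every c_i is at most q, so the sum is at most n q. The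
    argument covers s < 1 and s >= 1 alike. *)
Lemma powR_sum_le (s : R) n (c : 'I_n -> R) : 0 < s -> (forall i, 0 <= c i) ->
  (\sum_i c i) `^ s <= n%:R `^ s * \sum_i (c i `^ s).
Proof.
move=> s0 c0; pose S := \sum_i (c i `^ s).
have S0 : 0 <= S by apply: sumr_ge0 => i _; exact: powR_ge0.
pose q := S `^ s^-1.
have qs : q `^ s = S by rewrite -powRrM mulVf ?gt_eqF// powRr1.
have cq i : c i <= q.
  rewrite -[leLHS]powRr1// -[X in _ `^ X](mulfV (lt0r_neq0 s0)) powRrM.
  rewrite ge0_ler_powR ?nnegrE ?powR_ge0 ?invr_ge0 ?(ltW s0)//.
  by rewrite /S (bigD1 i)//= lerDl sumr_ge0// => j _; exact: powR_ge0.
rewrite -/S -qs -powRM ?powR_ge0// ge0_ler_powR ?nnegrE ?mulr_ge0 ?powR_ge0 ?(ltW s0)//.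
  exact: sumr_ge0.
rewrite mulr_natl -[in leRHS](card_ord n) -sumr_const.
by apply: ler_sum => i _; exact: cq.
Qed.

Lemma powR_sumD_le (s : R) n (c : 'I_n -> R) e : 0 < s -> (forall i, 0 <= c i) ->
  0 <= e -> (\sum_i c i + e) `^ s <= n.+1%:R `^ s * (\sum_i (c i `^ s) + e `^ s).
Proof.
move=> s0 c0 e0; pose c' i := if unlift ord0 i is Some j then c j else e.
have c'0 i : 0 <= c' i by rewrite /c'; case: unlift.
have := powR_sum_le s0 c'0; rewrite !big_ord_recl /c' unlift_none.
by under eq_bigr do rewrite liftK; under [X in _ * (_ + X)]eq_bigr do rewrite liftK; rewrite addrC [e `^ s + _]addrC.
Qed.

End sums_of_powers.

Lemma integral_cst_probability d (T : measurableType d) (R : realType)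
  (P : probability T R) (k : R) : (\int[P]_x k%:E = k%:E)%E.
Proof.
rewrite integral_cst//; transitivity (k%:E * 1)%E; last by rewrite mule1.
by congr (_ * _)%E; exact: probability_setT.
Qed.

Lemma Rintegral_cst_probability d (T : measurableType d) (R : realType)
  (P : probability T R) (k : R) : \int[P]_x k = k.
Proof. by rewrite /Rintegral integral_cst_probability. Qed.

Section operator_action.
Context {R : realType} (B : ambient R) (s : R).
Hypothesis s0 : 0 < s.

Lemma measurable_op (a : operator B) : measurable_fun setT a.
Proof.
by apply: (@measurable_fun_op_app _ _ _ _ (fun=> a) id) => //; exact: measurable_cst.
Qed.

(** For opn a > 0 this is the rescaled test function of [test_affine]; for opn a = 0 no rescaling is
    possible, but a x + k is constant and the two integrals coincide. *)
Lemma affine_diff (mu nu : probability (carrier B) R) z f (a : operator B) k :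
  Ms s mu -> Ms s nu -> test_functions s f ->
  (forall g, test_functions s g -> `|\int[mu]_x g x - \int[nu]_x g x| <= z) ->
  `|\int[mu]_x f (a x + k) - \int[nu]_x f (a x + k)| <= opn a `^ s * z.
Proof.
move=> mus nus fs H; have := opn_ge0 a; rewrite le_eqVlt => /predU1P[a0|a0].
  have ak x : a x + k = k.
    rewrite (_ : a x = 0) ?add0r//; apply/eqP; rewrite -normr_le0.
    by have := le_opn a x; rewrite -a0 mul0r.
  rewrite -a0 powR0 ?gt_eqF// mul0r.
  under eq_Rintegral do rewrite ak.
  under [X in _ - X]eq_Rintegral do rewrite ak.
  by rewrite !Rintegral_cst_probability subrr normr0.
have as0 : 0 < opn a `^ s by rewrite powR_gt0.
have ts := test_affine s0 k fs (@op_linear _ _ a) (measurable_op a) a0 (le_opn a).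
have intf (la : probability (carrier B) R) : Ms s la ->
    la.-integrable setT (EFin \o (fun x => f (a x + k))).
  move=> las; have := integrable_test s0 ts (@measurable_id _ _ setT) las.
  move=> /(integrableZl measurableT (opn a `^ s)).
  congr (_.-integrable _ _); apply/funext => x /=.
  by rewrite -EFinM mulrA mulfV ?mul1r// gt_eqF.
have := H _ ts; rewrite RintegralZl//; last exact: intf.
rewrite [X in _ - X]RintegralZl//; last exact: intf.
by rewrite -mulrBr normrM gtr0_norm ?invr_gt0// ler_pdivrMl.
Qed.

End operator_action.

Section hybrids.
Context {R : realType} (B : ambient R) (s : R).
Hypothesis s0 : 0 < s.
Context d (Om : measurableType d) (P : probability Om R) (K : nat).
Variables (A : 'I_K -> Om -> operator B) (b : Om -> carrier B) (I : 'I_K -> Om -> nat).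
Hypotheses (mA : forall r, measurable_fun setT (A r))
  (mb : measurable_fun setT b) (mI : forall r, measurable_fun setT (I r)).

(* A path of (X_n) together with an independent point of law eta; [hybrid A b I S]
   takes the path at time I_r where [S r I_r] holds and the point elsewhere. *)
Definition sample : Type := (path_type B * carrier B)%type.
HB.instance Definition _ := Measurable.on sample.

Definition slot (c : bool) (i : nat) (x : sample) : carrier B :=
  if c then x.1 i else x.2.

Lemma measurable_slot c i : measurable_fun setT (slot c i).
Proof.
rewrite /slot; case: c => //=; last exact: measurable_snd.
by apply: (measurableT_comp (@measurable_path_coord R B i)); exact: measurable_fst.
Qed.

Definition hybrid (S : 'I_K -> nat -> bool) (p : Om * K.-tuple sample) : carrier B :=
  \sum_r A r p.1 (slot (S r (I r p.1)) (I r p.1) (tnth p.2 r)) + b p.1.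

Lemma measurable_hybrid_slot (S : nat -> bool) r : measurable_fun setT
  (fun p : Om * K.-tuple sample => slot (S (I r p.1)) (I r p.1) (tnth p.2 r)).
Proof.
apply: (@measurable_fun_countable_switch _ _ (Om * K.-tuple sample)%type _ nat
  (fun p => I r p.1) (fun i p => slot (S i) i (tnth p.2 r))) => i.
  rewrite (_ : _ @^-1` _ = fst @^-1` (I r @^-1` [set i]))//.
  rewrite -[X in measurable X]setTI; apply: measurable_fst => //.
  by rewrite -[X in measurable X]setTI; exact: mI.
apply: (measurableT_comp (measurable_slot _ _)).
by apply: (measurableT_comp (measurable_tnth r)); exact: measurable_snd.
Qed.

Lemma measurable_hybrid S : measurable_fun setT (hybrid S).
Proof.
apply: measurable_funD_amb; last first.
  by apply: (measurableT_comp mb); exact: measurable_fst.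
apply: measurable_fun_sum_amb => r; apply: measurable_fun_op_app.
  by apply: (measurableT_comp (mA r)); exact: measurable_fst.
exact: measurable_hybrid_slot.
Qed.

Variables (LX : probability (path_type B) R) (eta : probability (carrier B) R).

Definition sample_law : probability sample R := (LX \x eta)%E.

Definition hybrid_law : probability (Om * K.-tuple sample)%type R :=
  (P \x iid_law sample_law K)%E.

Local Notation Pi := hybrid_law.
Local Open Scope ereal_scope.

Lemma integral_coord (h : sample -> \bar R) r : measurable_fun setT h ->
  (forall x, 0 <= h x) ->
  \int[iid_law sample_law K]_t h (tnth t r) = \int[sample_law]_x h x.
Proof.
move=> mh h0.
apply/esym; apply: (ge0_integral_law (phi := fun t => tnth t r)) => //.
  exact: measurable_tnth.
move=> U mU.
have mE i : measurable (if i == r then U else [set: sample]) by case: ifP.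
transitivity (\prod_i sample_law (if i == r then U else [set: sample])).
  rewrite (bigD1 r)//= eqxx big1 ?mule1// => i /negbTE ->.
  exact: probability_setT.
apply/esym; rewrite -(iid_law_box sample_law mE).
congr (iid_law _ _ _); apply/seteqP; split => t /=; last first.
  by move=> /(_ r); rewrite eqxx.
by move=> Ut i; case: eqP => // ->.
Qed.

Lemma integral_hybrid_prod (g : Om -> \bar R) (h : sample -> \bar R) r :
  measurable_fun setT g -> (forall w, 0 <= g w) ->
  measurable_fun setT h -> (forall x, 0 <= h x) ->
  \int[Pi]_p (g p.1 * h (tnth p.2 r)) = \int[P]_w g w * \int[sample_law]_x h x.
Proof.
move=> mg g0 mh h0.
rewrite (fubini_tonelli1 (fun p => g p.1 * h (tnth p.2 r)))/=; last 2 first.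
- apply: emeasurable_funM; first by apply: (measurableT_comp mg); exact: measurable_fst.
  apply: (measurableT_comp mh).
  by apply: (measurableT_comp (measurable_tnth r)); exact: measurable_snd.
- by move=> p; exact: mule_ge0.
under eq_integral => w _.
  rewrite /fubini_F /= ge0_integralZl//; last by apply: (measurableT_comp mh); exact: measurable_tnth.
  rewrite integral_coord//.
  over.
rewrite ge0_integralZr//.
exact: integral_ge0.
Qed.

Lemma integral_hybrid_fst (g : Om -> \bar R) : measurable_fun setT g ->
  (forall w, 0 <= g w) -> \int[Pi]_p g p.1 = \int[P]_w g w.
Proof.
move=> mg g0; apply/esym; apply: ge0_integral_law => // U mU.
transitivity (P U * iid_law sample_law K setT).
  by rewrite (probability_setT (iid_law sample_law K)) mule1.
transitivity (Pi (U `*` [set: K.-tuple sample])).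
  by apply/esym; exact: product_measure1E.
by congr (product_measure1 _ _ _); apply/seteqP; split => x //= [].
Qed.

Local Close Scope ereal_scope.
Variable mu : nat -> probability (carrier B) R.
Hypothesis mu_law : forall i U, measurable U ->
  mu i U = LX ((fun x : path_type B => x i) @^-1` U).
Hypotheses (mu_Ms : forall i, Ms s (mu i)) (eta_Ms : Ms s eta).

Lemma slot_law c i U : measurable U ->
  (if c then mu i else eta) U = sample_law (slot c i @^-1` U).
Proof.
move=> mU; case: c; rewrite /slot /=.
  rewrite mu_law//; set V := (fun x : path_type B => x i) @^-1` U.
  have mV : measurable V.
    by rewrite -[X in measurable X]setTI; exact: measurable_path_coord.
  transitivity (LX V * eta setT)%E; first by rewrite (probability_setT eta) mule1.
  transitivity ((LX \x eta)%E (V `*` [set: carrier B])).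
    by apply/esym; exact: product_measure1E.
  by congr (product_measure1 _ _ _); apply/seteqP; split => x //= [].
transitivity (LX setT * eta U)%E; first by rewrite (probability_setT LX) mul1e.
transitivity ((LX \x eta)%E ([set: path_type B] `*` U)).
  by apply/esym; exact: product_measure1E.
by congr (product_measure1 _ _ _); apply/seteqP; split => x //= [].
Qed.

Lemma slot_Ms (c : bool) i : Ms s (if c then mu i else eta).
Proof. by case: c. Qed.

Lemma smoment_slot c i : (smoment s sample_law (slot c i) < +oo)%E.
Proof.
rewrite /smoment -(ge0_integral_law (measurable_slot c i) (slot_law c i)
  (f := fun x => (`|x| `^ s)%:E)).
- exact: slot_Ms.
- apply/measurable_EFinP; exact: (measurable_norm_powR s (@measurable_id _ (carrier B) setT)).
- by move=> x; rewrite lee_fin powR_ge0.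
Qed.

Variable n : nat.
Hypothesis I_le : forall r w, (I r w <= n)%N.

(** Dominates every slot whose time is below N by a function of the sample alone, so that a random
    index can be estimated and independence of the coefficients still used. *)
Definition envelope N (x : sample) : R :=
  \sum_(i < N) `|slot true i x| `^ s + `|slot false 0 x| `^ s.

Lemma envelope_ge0 N x : 0 <= envelope N x.
Proof. by rewrite addr_ge0 ?powR_ge0// sumr_ge0// => i _; exact: powR_ge0. Qed.

Lemma measurable_envelope N : measurable_fun setT (envelope N).
Proof.
apply: measurable_funD; last exact: (measurable_norm_powR s (measurable_slot _ _)).
by apply: measurable_sum => i; exact: (measurable_norm_powR s (measurable_slot _ _)).
Qed.

Lemma integral_envelope N : (\int[sample_law]_x (envelope N x)%:E < +oo)%E.
Proof.
under eq_integral do rewrite EFinD -sumEFin.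
have m1 c i : measurable_fun setT (fun x => (`|slot c i x| `^ s)%:E).
  by apply/measurable_EFinP; exact: (measurable_norm_powR s (measurable_slot _ _)).
have m2 : measurable_fun setT (fun x => (\sum_(i < N) (`|slot true i x| `^ s)%:E)%E).
  by apply: emeasurable_sum => i.
rewrite ge0_integralD//; last by move=> x _; apply: sume_ge0 => i _; rewrite lee_fin powR_ge0.
rewrite lte_add_pinfty//; last exact: smoment_slot.
rewrite ge0_integral_sum//.
by apply: lte_sum_pinfty => i _; exact: smoment_slot.
Qed.

Lemma slot_envelope c i N x : (~~ c || (i < N)%N) -> `|slot c i x| `^ s <= envelope N x.
Proof.
case: c => /= iN; last by rewrite /envelope /= lerDr sumr_ge0// => j _; exact: powR_ge0.
rewrite /envelope (bigD1 (Ordinal iN))//= -addrA lerDl addr_ge0 ?powR_ge0//.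
by rewrite sumr_ge0// => j _; exact: powR_ge0.
Qed.

Hypothesis A_moment : forall r, (\int[P]_w (opn (A r w) `^ s)%:E < +oo)%E.
Hypothesis b_moment : (\int[P]_w (`|b w| `^ s)%:E < +oo)%E.

Lemma smoment_hybrid S : (smoment s Pi (hybrid S) < +oo)%E.
Proof.
pose g (p : Om * K.-tuple sample) : R := K.+1%:R `^ s *
  (\sum_r opn (A r p.1) `^ s * envelope n.+1 (tnth p.2 r) + `|b p.1| `^ s).
have mopn r : measurable_fun setT (fun w => (opn (A r w) `^ s)%:E).
  apply/measurable_EFinP; apply: (measurableT_comp (@measurable_powR R s)).
  exact: measurable_fun_opn_comp.
have menv : measurable_fun setT (fun x => (envelope n.+1 x)%:E).
  by apply/measurable_EFinP; exact: measurable_envelope.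
have mterm r : measurable_fun setT (fun p : Om * K.-tuple sample =>
    ((opn (A r p.1) `^ s)%:E * (envelope n.+1 (tnth p.2 r))%:E)%E).
  apply: emeasurable_funM; first by apply: (measurableT_comp (mopn r)); exact: measurable_fst.
  apply: (measurableT_comp menv).
  by apply: (measurableT_comp (measurable_tnth r)); exact: measurable_snd.
have mbs : measurable_fun setT (fun p : Om * K.-tuple sample => (`|b p.1| `^ s)%:E).
  apply/measurable_EFinP; apply: (measurable_norm_powR s).
  by apply: (measurableT_comp mb); exact: measurable_fst.
apply: (@le_lt_trans _ _ (\int[Pi]_p (g p)%:E)%E).
  apply: ge0_le_lower_integral => p _; rewrite lee_fin ?powR_ge0//.
  apply: (@le_trans _ _ ((\sum_r opn (A r p.1) * `|slot (S r (I r p.1)) (I r p.1) (tnth p.2 r)| + `|b p.1|) `^ s)).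
    rewrite ge0_ler_powR ?nnegrE ?(ltW s0) ?addr_ge0 ?sumr_ge0//.
      by move=> r _; rewrite mulr_ge0 ?opn_ge0.
    rewrite (le_trans (ler_normD _ _))// lerD2r (le_trans (ler_norm_sum _ _ _))//.
    by apply: ler_sum => r _; exact: le_opn.
  rewrite (le_trans (powR_sumD_le s0 _ _))//.
    by move=> r; rewrite mulr_ge0 ?opn_ge0.
  rewrite ler_wpM2l ?powR_ge0// lerD2r; apply: ler_sum => r _.
  rewrite powRM ?opn_ge0// ler_wpM2l ?powR_ge0// slot_envelope//.
  by rewrite ltnS I_le orbT.
under eq_integral do rewrite EFinM EFinD -sumEFin.
rewrite ge0_integralZl//; last 2 first.
- apply: emeasurable_funD => //.
  by apply: emeasurable_sum => r; exact: mterm.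
- move=> p _; rewrite adde_ge0 ?lee_fin ?powR_ge0// sume_ge0// => r _.
  by rewrite lee_fin mulr_ge0 ?powR_ge0 ?envelope_ge0.
rewrite lte_mul_pinfty ?lee_fin ?powR_ge0//.
rewrite ge0_integralD//; last 2 first.
- move=> p _; rewrite sume_ge0// => r _.
  by rewrite lee_fin mulr_ge0 ?powR_ge0 ?envelope_ge0.
- by apply: emeasurable_sum => r; exact: mterm.
rewrite lte_add_pinfty//.
  rewrite ge0_integral_sum//; last first.
    by move=> r p _; rewrite lee_fin mulr_ge0 ?powR_ge0 ?envelope_ge0.
  apply: lte_sum_pinfty => r _.
  have g0 w : (0 <= (opn (A r w) `^ s)%:E)%E by rewrite lee_fin powR_ge0.
  have h0 x : (0 <= (envelope n.+1 x)%:E)%E by rewrite lee_fin envelope_ge0.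
  have := integral_hybrid_prod r (mopn r) g0 menv h0.
  rewrite -[X in X = _ -> _]/(\int[Pi]_p (opn (A r p.1) `^ s * envelope n.+1 (tnth p.2 r))%:E)%E => ->.
  rewrite lte_mul_pinfty ?integral_ge0//; last exact: integral_envelope.
  by rewrite ge0_fin_numE// integral_ge0.
rewrite (integral_hybrid_fst (g := fun w => (`|b w| `^ s)%:E))//.
by apply/measurable_EFinP; exact: (measurable_norm_powR s).
Qed.

Lemma integrable_test_hybrid f S : test_functions s f ->
  Pi.-integrable setT (EFin \o (f \o hybrid S)).
Proof.
by move=> fs; apply: (integrable_test s0 fs (measurable_hybrid S)); exact: smoment_hybrid.
Qed.

Definition rest (S : 'I_K -> nat -> bool) j (p : Om * K.-tuple sample) : carrier B :=
  \sum_(r | r != j) A r p.1 (slot (S r (I r p.1)) (I r p.1) (tnth p.2 r)) + b p.1.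

Lemma hybrid_resample S j p x : hybrid S (p.1, resample j p.2 x) =
  A j p.1 (slot (S j (I j p.1)) (I j p.1) x) + rest S j p.
Proof.
rewrite /hybrid (bigD1 j)//= tnth_mktuple eqxx -addrA; congr (_ + (_ + _)).
by apply: eq_bigr => r rj; rewrite tnth_mktuple (negbTE rj).
Qed.

(** With all but the j-th sample frozen, both hybrids apply the same affine map y -> a y + k to
    their j-th slot. They differ only where S j and S' j disagree at I_j, and there [affine_diff]
    compares mu (I_j) with eta. *)
Lemma hybrid_step f (S S' : 'I_K -> nat -> bool) j (z : nat -> R) :
  test_functions s f -> (forall r, r != j -> S r = S' r) -> (forall i, 0 <= z i) ->
  (forall i, (i <= n)%N -> S j i != S' j i -> forall g, test_functions s g ->
     `|\int[mu i]_x g x - \int[eta]_x g x| <= z i) ->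
  (`|\int[Pi]_p f (hybrid S p) - \int[Pi]_p f (hybrid S' p)|%:E <=
   \int[P]_w (opn (A j w) `^ s * z (I j w))%:E)%E.
Proof.
move=> fs SS' z0 Hz.
have [iS iS'] := (integrable_test_hybrid S fs, integrable_test_hybrid S' fs).
pose De p := f (hybrid S p) - f (hybrid S' p).
have iD : Pi.-integrable setT (EFin \o De) by apply: (integrableB _ iS iS').
have restE p : rest S j p = rest S' j p.
  by rewrite /rest; congr (_ + _); apply: eq_bigr => r /SS' ->.
rewrite -RintegralB//.
(* The j-th sample is redrawn, which leaves the integral unchanged and makes it the inner variable
   of a Fubini integral. *)
pose phi := fun p : (Om * K.-tuple sample) * sample => (p.1.1, resample j p.1.2 p.2).
have mphi : measurable_fun setT phi by exact: measurable_resample.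
have Plaw U : measurable U -> Pi U = ((Pi \x sample_law) (phi @^-1` U))%E.
  by move=> mU; apply/esym; exact: resample_law.
have iDphi := integrable_law_comp mphi Plaw iD.
rewrite (Rintegral_law mphi Plaw iD).
have nuM := slot_Ms.
have mslot := measurable_slot.
have inner p : (`|\int[sample_law]_x (De (phi (p, x)))%:E| <=
    (opn (A j p.1) `^ s * z (I j p.1))%:E)%E.
  have fphi S0 x : f (hybrid S0 (phi (p, x))) =
      f (A j p.1 (slot (S0 j (I j p.1)) (I j p.1) x) + rest S0 j p).
    by rewrite /phi hybrid_resample.
  set i := I j p.1 in fphi *; set a := A j p.1 in fphi *.
  pose nu c := if c then mu i else eta.
  have inu c k : (nu c).-integrable setT (EFin \o (fun y => f (a y + k))).
    have mak : measurable_fun setT (fun y => a y + k).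
      by apply: measurable_funD_amb; [exact: measurable_op|exact: measurable_cst].
    apply: (integrable_test s0 fs mak).
    apply: (@le_lt_trans _ _ (\int[nu c]_y (2 `^ s * opn a `^ s * `|y| `^ s + 2 `^ s * `|k| `^ s)%:E)%E).
      apply: ge0_le_lower_integral => y _; rewrite lee_fin ?powR_ge0//.
      apply: (@le_trans _ _ ((opn a * `|y| + `|k|) `^ s)).
        rewrite ge0_ler_powR ?nnegrE ?(ltW s0) ?addr_ge0 ?mulr_ge0 ?opn_ge0//.
        by rewrite (le_trans (ler_normD _ _))// lerD2r le_opn.
      rewrite (le_trans (powRD_le s0 _ _)) ?mulr_ge0 ?opn_ge0//.
      by rewrite powRM ?opn_ge0// mulrDr mulrA.
    have my : measurable_fun setT (fun y : carrier B => (`|y| `^ s)%:E).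
      by apply/measurable_EFinP; exact: (measurable_norm_powR s (@measurable_id _ (carrier B) setT)).
    under eq_integral do rewrite EFinD EFinM.
    rewrite ge0_integralD//; last 2 first.
    - by move=> y _; rewrite mule_ge0// lee_fin ?mulr_ge0 ?powR_ge0.
    - by apply: emeasurable_funM.
    rewrite lte_add_pinfty//.
      rewrite ge0_integralZl//; last by rewrite lee_fin mulr_ge0 ?powR_ge0.
      rewrite lte_mul_pinfty ?lee_fin ?mulr_ge0 ?powR_ge0//.
      exact: (slot_Ms c i).
    by rewrite integral_cst_probability ltry.
  have eqnu c k : \int[nu c]_y f (a y + k) = \int[sample_law]_x f (a (slot c i x) + k).
    by apply: (Rintegral_law (measurable_slot c i) (slot_law c i)); exact: inu.
  have islot c k : sample_law.-integrable setT (EFin \o (fun x => f (a (slot c i x) + k))).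
    by apply: (integrable_law_comp (measurable_slot c i) (slot_law c i) (inu c k)).
  rewrite (eq_integral (fun x => (f (a (slot (S j i) i x) + rest S j p) -
      f (a (slot (S' j i) i x) + rest S j p))%:E)); last first.
    by move=> x _; rewrite /De !fphi restE.
  rewrite Rintegral_EFin; last by apply: (integrableB _ (islot _ _) (islot _ _)).
  rewrite RintegralB//.
  rewrite -!eqnu abse_EFin lee_fin.
  have [->|Sne] := eqVneq (S j i) (S' j i).
    by rewrite subrr normr0 mulr_ge0 ?powR_ge0.
  have Hd := affine_diff s0 a (rest S j p) (mu_Ms i) eta_Ms fs (Hz i (I_le j p.1) Sne).
  move: Sne; rewrite /nu; case: (S j i); case: (S' j i) => // _.
  by rewrite distrC.
have FE : (\int[Pi \x sample_law]_p (De (phi p))%:E =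
    \int[Pi]_p \int[sample_law]_x (De (phi (p, x)))%:E)%E.
  by rewrite -(integral12_prod_meas1 iDphi).
rewrite -abse_EFin -(Rintegral_EFin iDphi) FE.
apply: (@le_trans _ _ (\int[Pi]_p `|\int[sample_law]_x (De (phi (p, x)))%:E|)%E).
  apply: le_abse_integral => //.
  exact: (measurable_fubini_F iDphi).
rewrite -(integral_hybrid_fst (g := fun w => (opn (A j w) `^ s * z (I j w))%:E)).
- by apply: ge0_le_lower_integral => p _ //; exact: abse_ge0.
- apply/measurable_EFinP; apply: measurable_funM.
    apply: (measurableT_comp (@measurable_powR R s)).
    exact: measurable_fun_opn_comp.
  by apply: (measurableT_comp _ (mI j)).
- by move=> w; rewrite lee_fin mulr_ge0 ?powR_ge0.
Qed.

End hybrids.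

(** * The contraction argument *)

Section contraction_sequence.
Context {R : realType}.

(* The diagonal coefficient a n n need not vanish: it is absorbed because the row
   sums are at most q < 1. *)
Lemma contraction_cvg0 (z : nat -> R) (a : nat -> nat -> R) (q : R) :
  (forall n, 0 <= z n) -> (forall n i, 0 <= a n i) -> q < 1 ->
  (\forall n \near \oo, \sum_(i < n.+1) a n i <= q) ->
  (forall l e, 0 < e -> \forall n \near \oo, \sum_(i < l) a n i <= e) ->
  (forall e, 0 < e -> \forall n \near \oo, z n <= \sum_(i < n.+1) a n i * z i + e) ->
  forall e, 0 < e -> \forall n \near \oo, z n <= e.
Proof.
move=> z0 a0 q1 aq al zle.
have q1' : 0 < 1 - q by rewrite subr_gt0.
have q0 : 0 <= q.
  have [n _ /(_ n (leqnn n))] := aq; apply: le_trans.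
  by apply: sumr_ge0 => i _.
have [M M0 zM] : exists2 M, 0 < M & forall n, z n <= M.
  have [N _ HN] := filterI aq (zle 1 ltr01).
  (* Beyond N a new maximum satisfies z n <= q z n + 1 and is therefore at most 1/(1 - q). *)
  pose M := \sum_(i < N) z i + (1 - q)^-1.
  have M0 : 0 < M by rewrite ltr_wpDl ?invr_gt0// sumr_ge0.
  exists M => //; elim/ltn_ind => n IH.
  have [nN|Nn] := ltnP n N.
    by rewrite /M (bigD1 (Ordinal nN))//= -addrA lerDl addr_ge0 ?invr_ge0 ?(ltW q1')// sumr_ge0.
  rewrite leNgt; apply/negP => Mz; have [/= h1 h2] := HN n Nn.
  have : z n <= q * z n + 1.
    apply: (le_trans h2); rewrite lerD2r.
    apply: (@le_trans _ _ ((\sum_(i < n.+1) a n i) * z n)); last by rewrite ler_wpM2r.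
    rewrite mulr_suml; apply: ler_sum => i _; rewrite ler_wpM2l//.
    have := ltn_ord i; rewrite ltnS leq_eqVlt => /predU1P[->//|/IH/le_trans]; apply.
    exact: ltW.
  rewrite -lerBlDl -{1}(mul1r (z n)) -mulrBl mulrC -ler_pdivlMr// div1r.
  by apply/negP; rewrite -ltNge (le_lt_trans _ Mz)// /M lerDr sumr_ge0.
(* A factor strictly between q and 1: each pass improves an eventual bound b to q' b. The slack (q'
   - q) b = (1 - q) b / 2 pays for the first l terms and for the error, each at most (1 - q) b /
   4. *)
pose q' := (1 + q) / 2.
have qq' : q < q' by rewrite /q'; lra.
have q'1 : q' < 1 by rewrite /q'; lra.
have q'0 : 0 < q' by rewrite /q'; lra.
have step b : 0 < b -> (\forall n \near \oo, z n <= b) -> \forall n \near \oo, z n <= q' * b.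
  move=> b0 [l _ Hl]; pose e := (1 - q) * b / 4.
  have e0 : 0 < e by rewrite divr_gt0// mulr_gt0.
  near=> n.
  have h1 : \sum_(i < n.+1) a n i <= q by near: n; exact: aq.
  have h2 : \sum_(i < l) a n i <= e / M by near: n; apply: al; exact: divr_gt0.
  have h3 : z n <= \sum_(i < n.+1) a n i * z i + e by near: n; exact: zle.
  have ln : (l <= n)%N by near: n; exact: nbhs_infty_ge.
  apply: (le_trans h3).
  apply: (@le_trans _ _ ((\sum_(i < l) a n i) * M + (\sum_(i < n.+1) a n i) * b + e)).
    rewrite lerD2r !mulr_suml.
    rewrite -(big_mkord xpredT (fun i => a n i * z i)) -(big_mkord xpredT (fun i => a n i * M)).
    rewrite -(big_mkord xpredT (fun i => a n i * b)).
    rewrite (big_cat_nat (n := l))//=; last exact: leqW.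
    rewrite lerD//; first by apply: ler_sum => i _; rewrite ler_wpM2l.
    rewrite [leRHS](big_cat_nat (n := l))//=; last exact: leqW.
    rewrite ler_wpDl//.
      by apply: sumr_ge0 => i _; rewrite mulr_ge0// ltW.
    by apply: ler_sum_nat => i /andP[li _]; rewrite ler_wpM2l// Hl.
  have h4 : (\sum_(i < l) a n i) * M <= e by rewrite -ler_pdivlMr.
  have h5 : (\sum_(i < n.+1) a n i) * b <= q * b by rewrite ler_wpM2r// ltW.
  by rewrite (le_trans (lerD (lerD h4 h5) (lexx _)))// /e /q'; lra.
have iter k : \forall n \near \oo, z n <= q' ^+ k * M.
  elim: k => [|k IH]; first by apply: nearW => n; rewrite expr0 mul1r.
  by rewrite exprS -mulrA; apply: step => //; rewrite mulr_gt0// exprn_gt0.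
move=> e e0.
have : q' ^+ k @[k --> \oo] --> (0 : R) by apply: cvg_expr; rewrite gtr0_norm.
move=> /cvgr_dist_le/(_ (e / M) (divr_gt0 e0 M0))[k _ /(_ k (leqnn k))].
rewrite /= sub0r normrN ger0_norm ?exprn_ge0 ?(ltW q'0)// ler_pdivlMr// => qk.
by apply: filterS (iter k) => n /le_trans; apply.
Unshelve. all: by end_near. Qed.

End contraction_sequence.

Section telescope.
Context {R : realType} (B : ambient R) (s : R).
Hypothesis s0 : 0 < s.
Context d (Om : measurableType d) (P : probability Om R) (K : nat).
Variables (A : 'I_K -> Om -> operator B) (b : Om -> carrier B) (I : 'I_K -> Om -> nat).
Hypotheses (mA : forall r, measurable_fun setT (A r))
  (mb : measurable_fun setT b) (mI : forall r, measurable_fun setT (I r)).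
Variables (LX : probability (path_type B) R) (eta : probability (carrier B) R).
Variable mu : nat -> probability (carrier B) R.
Hypothesis mu_law : forall i U, measurable U ->
  mu i U = LX ((fun x : path_type B => x i) @^-1` U).
Hypotheses (mu_Ms : forall i, Ms s (mu i)) (eta_Ms : Ms s eta).
Variables n n0 : nat.
Hypothesis I_le : forall r w, (I r w <= n)%N.
Hypothesis A_moment : forall r, (\int[P]_w (opn (A r w) `^ s)%:E < +oo)%E.
Hypothesis b_moment : (\int[P]_w (`|b w| `^ s)%:E < +oo)%E.
Local Notation Pi := (hybrid_law P K LX eta).

(** Interpolates from Q_n at j = 0 to the full recursion at j = K; times below n0 always read the
    path. *)
Definition below j (r : 'I_K) (i : nat) := ((i < n0) || (r < j))%N.

Lemma hybrid_telescope f (z : nat -> R) :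
  test_functions s f -> (forall i, 0 <= z i) ->
  (forall i, (n0 <= i <= n)%N -> forall g, test_functions s g ->
     `|\int[mu i]_x g x - \int[eta]_x g x| <= z i) ->
  (`|\int[Pi]_p f (hybrid A b I (below K) p) - \int[Pi]_p f (hybrid A b I (below 0) p)|%:E <=
   \sum_r \int[P]_w (opn (A r w) `^ s * z (I r w))%:E)%E.
Proof.
move=> fs z0 Hz.
have H j : (j <= K)%N ->
  (`|\int[Pi]_p f (hybrid A b I (below j) p) - \int[Pi]_p f (hybrid A b I (below 0) p)|%:E <=
   \sum_(r < K | (r < j)%N) \int[P]_w (opn (A r w) `^ s * z (I r w))%:E)%E.
  elim: j => [_|j IH jK]; first by rewrite subrr normr0 big_pred0.
  rewrite (bigD1 (Ordinal jK))/=; last exact: ltnSn.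
  apply: (@le_trans _ _ (`|\int[Pi]_p f (hybrid A b I (below j.+1) p) - \int[Pi]_p f (hybrid A b I (below j) p)|%:E +
    `|\int[Pi]_p f (hybrid A b I (below j) p) - \int[Pi]_p f (hybrid A b I (below 0) p)|%:E)%E).
    by rewrite -EFinD lee_fin ler_distD.
  apply: leeD; last first.
    apply: (le_trans (IH (ltnW jK))); rewrite le_eqVlt; apply/orP; left; apply/eqP.
    by apply: eq_bigl => r; rewrite ltnS -val_eqE /= andbC ltn_neqAle.
  apply: (hybrid_step s0 mA mb mI mu_law mu_Ms eta_Ms I_le A_moment b_moment fs _ z0).
    move=> r rj; apply/funext => i; rewrite /below; congr (_ || _).
    by rewrite ltnS leq_eqVlt; rewrite -val_eqE /= in rj; rewrite (negbTE rj).
  move=> i i_n; rewrite /below /= ltnSn ltnn orbT orbF.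
  by case: ltnP => // n0i _; apply: Hz; rewrite n0i.
apply: (le_trans (H K (leqnn K))); rewrite le_eqVlt; apply/orP; left; apply/eqP.
by apply: eq_bigl => r; rewrite ltn_ord.
Qed.

(** Splitting by the value of the index produces the coefficients a_{n,i} of the recursive
    inequality. *)
Lemma integral_index_split (z : nat -> R) r : (forall i, 0 <= z i) ->
  (\int[P]_w (opn (A r w) `^ s * z (I r w))%:E =
   \sum_(i < n.+1) \int[P]_w (opn (A r w) `^ s * \1_[set w | I r w = i] w)%:E * (z i)%:E)%E.
Proof.
move=> z0.
have mopn : measurable_fun setT (fun w => opn (A r w) `^ s).
  apply: (measurableT_comp (@measurable_powR R s)).
  exact: measurable_fun_opn_comp.
have mi (i : nat) : measurable [set w | I r w = i].
  rewrite (_ : [set w | _] = I r @^-1` [set i])//.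
  by rewrite -[X in measurable X]setTI; exact: (mI r).
have mterm i : measurable_fun setT (fun w => (opn (A r w) `^ s * \1_[set w | I r w = i] w)%:E).
  by apply/measurable_EFinP; apply: measurable_funM => //; exact: measurable_indic.
have t0 (i : nat) w : (0 <= (opn (A r w) `^ s * \1_[set w | I r w = i] w)%:E)%E.
  by rewrite lee_fin mulr_ge0 ?powR_ge0.
under [RHS]eq_bigr => i _.
  rewrite -ge0_integralZr//; last by rewrite lee_fin.
  over.
rewrite -ge0_integral_sum//; last 2 first.
- by move=> i; apply: emeasurable_funM.
- by move=> i w _; rewrite mule_ge0// lee_fin.
apply: eq_integral => w _.
have iw : (I r w < n.+1)%N by rewrite ltnS.
rewrite (bigD1 (Ordinal iw))//= indicE mem_set//= mulr1 big1 ?adde0//.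
move=> i iI; rewrite indicE memNset ?mulr0 ?mul0e//= => Ii.
by move: iI; rewrite -val_eqE /= Ii eqxx.
Qed.

End telescope.

(** * Passage to the limit coefficients *)

Section limit_coefficients.
Context {R : realType} (B : ambient R) (s : R).
Hypothesis s0 : 0 < s.
Context d (Om : measurableType d) (P : probability Om R).

(** The vector is normalised first, so that the factor |z|^s is taken out of the integral of a
    measurable function; the lower integral of the operator norm is only compared with the value at
    a unit vector. *)
Lemma integral_op_diff_le (a a' : Om -> operator B) (de : R) z :
  measurable_fun setT a -> measurable_fun setT a' ->
  (\int[P]_w (opnorm (fun x => a w x - a' w x)%R `^ s) <= de%:E)%E ->
  (\int[P]_w (`|a w z - a' w z| `^ s)%:E <= (de * `|z| `^ s)%:E)%E.
Proof.
move=> ma ma' H; have [->|z0] := eqVneq z 0.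
  under eq_integral do rewrite !op0 subrr normr0 powR0 ?gt_eqF//.
  by rewrite integral0 normr0 powR0 ?gt_eqF// mulr0.
have nz : 0 < `|z| by rewrite normr_gt0.
pose u := `|z|^-1 *: z.
have zE : z = `|z| *: u by rewrite /u scalerA mulfV ?scale1r// gt_eqF.
have mu : measurable_fun setT (fun w => (`|a w u - a' w u| `^ s)%:E).
  apply/measurable_EFinP; apply: (measurable_norm_powR s).
  apply: measurable_funB_amb.
    by apply: measurable_fun_op_app => //; exact: measurable_cst.
  by apply: measurable_fun_op_app => //; exact: measurable_cst.
rewrite (eq_integral (fun w => (`|z| `^ s)%:E * (`|a w u - a' w u| `^ s)%:E)%E); last first.
  by move=> w _; rewrite {1 2}zE !opZ -scalerBr normrZ normr_id powRM// EFinM.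
rewrite ge0_integralZl// mulrC EFinM lee_wpmul2l ?lee_fin ?powR_ge0//.
apply: le_trans H; apply: ge0_le_lower_integral => w _; rewrite ?lee_fin ?powR_ge0//.
rewrite -poweR_EFin gt0_ler_poweR ?(ltW s0) ?in_itv/= ?leey ?lee_fin ?normr_ge0 ?opnorm_ge0//.
apply: ereal_sup_ubound; exists u => //=.
by rewrite /u normrZ normfV normr_id mulVf// gt_eqF.
Qed.

Variable K : nat.
Variables (A : 'I_K -> Om -> operator B) (b : Om -> carrier B) (I : 'I_K -> Om -> nat).
Hypotheses (mA : forall r, measurable_fun setT (A r))
  (mb : measurable_fun setT b) (mI : forall r, measurable_fun setT (I r)).
Variables (Al : 'I_K -> Om -> operator B) (bl : Om -> carrier B).
Hypotheses (mAl : forall r, measurable_fun setT (Al r)) (mbl : measurable_fun setT bl).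
Variables (LX : probability (path_type B) R) (eta : probability (carrier B) R).
Variable mu : nat -> probability (carrier B) R.
Hypothesis mu_law : forall i U, measurable U ->
  mu i U = LX ((fun x : path_type B => x i) @^-1` U).
Hypotheses (mu_Ms : forall i, Ms s (mu i)) (eta_Ms : Ms s eta).
Variables (n0 : nat).
Local Notation Pi := (hybrid_law P K LX eta).

(** [hybrid A b I initial] is Q_n. With the limit coefficients, [never] gives the right side of the
    fixed-point equation, where only the points of law eta are read. *)
Definition initial : 'I_K -> nat -> bool := fun _ i => (i < n0)%N.
Definition never : 'I_K -> nat -> bool := fun _ _ => false.

Definition envelope_mean : R :=
  fine (\int[sample_law LX eta]_x (envelope s n0 x)%:E)%E.

(** Does not depend on n. The factor (K+1)^s splits the sum of K+1 terms, 2^s splits the r-th term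
    into a change of operator and a part with I_r < n0, and 2 * 2^s accounts for the two slots in
    the latter; the final 1 stands for b. *)
Definition limit_constant : R := K.+1%:R `^ s *
  (K%:R * (2 `^ s * (envelope_mean + 2 * 2 `^ s * envelope_mean)) + 1).

(** Both sums use the same w and the same points Y_r of law eta. Up to sign, their difference is the
    sum of (A_r - Al_r) Y_r, of A_r (X_{I_r} - Y_r) on I_r < n0, and of b - bl. *)
Lemma limit_distance de :
  (\int[P]_w (`|b w - bl w| `^ s)%:E <= de%:E)%E ->
  (forall r, (\int[P]_w (opnorm (fun x => A r w x - Al r w x)%R `^ s) <= de%:E)%E) ->
  (forall r, (\int[P]_w (opn (A r w) `^ s * \1_[set w | (I r w < n0)%N] w)%:E <= de%:E)%E) ->
  (smoment s Pi (fun p => hybrid Al bl I never p - hybrid A b I initial p)%R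
    <= (limit_constant * de)%:E)%E.
Proof.
move=> Hb HA HI.
pose E := (\int[sample_law LX eta]_x (envelope s n0 x)%:E)%E.
have E0 : (0 <= E)%E by apply: integral_ge0 => x _; rewrite lee_fin envelope_ge0.
have Efin : E = (fine E)%:E.
  by rewrite fineK// ge0_fin_numE//; exact: (integral_envelope mu_law mu_Ms eta_Ms).
pose g1 r (p : Om * K.-tuple (sample B)) :=
  `|A r p.1 (tnth p.2 r).2 - Al r p.1 (tnth p.2 r).2| `^ s.
pose g2 r (p : Om * K.-tuple (sample B)) :=
  opn (A r p.1) `^ s * \1_[set w | (I r w < n0)%N] p.1 * envelope s n0 (tnth p.2 r).
pose g3 (p : Om * K.-tuple (sample B)) := `|b p.1 - bl p.1| `^ s.
have pw p : `|hybrid Al bl I never p - hybrid A b I initial p| `^ s <=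
    K.+1%:R `^ s * (\sum_r (2 `^ s * (g1 r p + 2 * 2 `^ s * g2 r p)) + g3 p).
  pose a r := `|A r p.1 (tnth p.2 r).2 - Al r p.1 (tnth p.2 r).2| +
    opn (A r p.1) * \1_[set w | (I r w < n0)%N] p.1 * (`|slot true (I r p.1) (tnth p.2 r)| + `|(tnth p.2 r).2|).
  have a0 r : 0 <= a r.
    by rewrite addr_ge0// mulr_ge0 ?addr_ge0// mulr_ge0 ?opn_ge0.
  apply: (@le_trans _ _ ((\sum_r a r + `|b p.1 - bl p.1|) `^ s)).
    rewrite ge0_ler_powR ?nnegrE ?(ltW s0) ?addr_ge0 ?sumr_ge0//.
    rewrite distrC /hybrid opprD addrACA -sumrB.
    apply: (le_trans (ler_normD _ _)); rewrite lerD2r.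
    apply: (le_trans (ler_norm_sum _ _ _)); apply: ler_sum => r _.
    rewrite /a /never /initial /slot /=.
    case: ifPn => In0.
      rewrite indicE mem_set//= mulr1.
      rewrite -(subrK (A r p.1 (tnth p.2 r).2) (A r p.1 ((tnth p.2 r).1 (I r p.1)))) -opB.
      rewrite -addrA addrC (le_trans (ler_normD _ _))// lerD2l.
      apply: (le_trans (le_opn _ _)); rewrite ler_wpM2l ?opn_ge0//.
      exact: ler_normB.
    by rewrite lerDl mulr_ge0 ?addr_ge0// mulr_ge0 ?opn_ge0.
  apply: (le_trans (powR_sumD_le s0 _ _)) => //.
  rewrite ler_wpM2l ?powR_ge0// lerD2r; apply: ler_sum => r _.
  apply: (le_trans (powRD_le s0 _ _)) => //.
    by rewrite mulr_ge0 ?addr_ge0// mulr_ge0 ?opn_ge0.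
  rewrite ler_wpM2l ?powR_ge0// lerD2l /g2 indicE.
  have [In0|In0] := boolP (p.1 \in _); last first.
    by rewrite !mulr0 !mul0r powR0 ?gt_eqF// mulr0.
  rewrite !mulr1 powRM ?opn_ge0 ?addr_ge0// mulrCA ler_wpM2l ?powR_ge0//.
  apply: (le_trans (powRD_le s0 _ _)) => //.
  rewrite (mulrC 2) -mulrA ler_wpM2l ?powR_ge0// mulr2n mulrDl !mul1r lerD//.
    by apply: slot_envelope; move/set_mem: In0 => /= ->.
  exact: (slot_envelope s (c := false) (i := 0)).
have m2 r : measurable_fun setT (fun p : Om * K.-tuple (sample B) => tnth p.2 r).
  by apply: (measurableT_comp (measurable_tnth r)); exact: measurable_snd.
have mz r : measurable_fun setT (fun p : Om * K.-tuple (sample B) => (tnth p.2 r).2).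
  by apply: (measurableT_comp _ (m2 r)); exact: measurable_snd.
have m1 r : measurable_fun setT (g1 r).
  apply: (measurable_norm_powR s); apply: measurable_funB_amb.
    by apply: measurable_fun_op_app => //; apply: (measurableT_comp (mA r)); exact: measurable_fst.
  by apply: measurable_fun_op_app => //; apply: (measurableT_comp (mAl r)); exact: measurable_fst.
have mIs r : measurable [set w | (I r w < n0)%N].
  rewrite (_ : [set w | _] = I r @^-1` [set i | (i < n0)%N])//.
  by rewrite -[X in measurable X]setTI; exact: (mI r).
have mc r : measurable_fun setT (fun w => (opn (A r w) `^ s * \1_[set w | (I r w < n0)%N] w)%:E).
  apply/measurable_EFinP; apply: measurable_funM; last exact: measurable_indic.
  apply: (measurableT_comp (@measurable_powR R s)).
  exact: measurable_fun_opn_comp.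
have menv : measurable_fun setT (fun x => (@envelope R B s n0 x)%:E).
  by apply/measurable_EFinP; exact: measurable_envelope.
have mg2 r : measurable_fun setT (g2 r).
  apply/measurable_EFinP.
  apply: (emeasurable_funM (f := fun p => (opn (A r p.1) `^ s * \1_[set w | (I r w < n0)%N] p.1)%:E)
     (g := fun p => (envelope s n0 (tnth p.2 r))%:E)).
    by apply: (measurableT_comp (mc r)); exact: measurable_fst.
  exact: (measurableT_comp menv (m2 r)).
have mbb : measurable_fun setT (fun w => (`|b w - bl w| `^ s)%:E).
  by apply/measurable_EFinP; apply: (measurable_norm_powR s); exact: measurable_funB_amb.
have mg3 : measurable_fun setT g3.
  apply/measurable_EFinP; apply: (measurableT_comp mbb); exact: measurable_fst.
have g20 r p : 0 <= g2 r p by rewrite !mulr_ge0 ?powR_ge0 ?envelope_ge0.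
have de0 : 0 <= de.
  rewrite -lee_fin; apply: le_trans Hb.
  by apply: integral_ge0 => w _; rewrite lee_fin powR_ge0.
have I1 r : (\int[Pi]_p (g1 r p)%:E <= (de * fine E)%:E)%E.
  (* The coefficients are integrated first, with the point of law eta frozen, because
     [integral_op_diff_le] concerns a deterministic vector. *)
  rewrite (fubini_tonelli2 (fun p => (g1 r p)%:E)); last 2 first.
  - exact/measurable_EFinP.
  - by move=> p; rewrite lee_fin powR_ge0.
  apply: (@le_trans _ _ (\int[iid_law (sample_law LX eta) K]_t (de%:E * (envelope s n0 (tnth t r))%:E))%E).
    apply: ge0_le_lower_integral => t _.
      by apply: integral_ge0 => w _; rewrite lee_fin powR_ge0.
    have := integral_op_diff_le (tnth t r).2 (mA r) (mAl r) (HA r).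
    move=> /le_trans; apply.
    rewrite -EFinM lee_fin ler_wpM2l//.
    exact: (slot_envelope s (c := false) (i := 0)).
  rewrite ge0_integralZl//; last 2 first.
  - by apply: (measurableT_comp menv); exact: measurable_tnth.
  - by move=> t _; rewrite lee_fin envelope_ge0.
  rewrite (integral_coord LX eta r menv); last by move=> x; rewrite lee_fin envelope_ge0.
  by rewrite EFinM -Efin.
have I2 r : (\int[Pi]_p (g2 r p)%:E <= (de * fine E)%:E)%E.
  have c0 w : (0 <= (opn (A r w) `^ s * \1_[set w | (I r w < n0)%N] w)%:E)%E.
    by rewrite lee_fin mulr_ge0 ?powR_ge0.
  have e0 x : (0 <= (@envelope R B s n0 x)%:E)%E by rewrite lee_fin envelope_ge0.
  have := integral_hybrid_prod P LX eta r (mc r) c0 menv e0.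
  rewrite -[X in X = _ -> _]/(\int[Pi]_p (g2 r p)%:E)%E => ->.
  by rewrite -/E EFinM -Efin lee_wpmul2r.
have I3 : (\int[Pi]_p (g3 p)%:E <= de%:E)%E.
  rewrite (integral_hybrid_fst P K LX eta (g := fun w => (`|b w - bl w| `^ s)%:E))//.
apply: (@le_trans _ _ (\int[Pi]_p ((K.+1%:R `^ s)%:E * (\sum_r ((2 `^ s)%:E *
   ((g1 r p)%:E + (2 * 2 `^ s)%:E * (g2 r p)%:E)) + (g3 p)%:E)))%E).
  apply: ge0_le_lower_integral => p _; first by rewrite lee_fin powR_ge0.
  by have := pw p; rewrite -lee_fin EFinM EFinD -sumEFin.
have c20 : 0 <= 2 * 2 `^ s :> R by apply: mulr_ge0 => //; exact: powR_ge0.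
have gg0 r p : 0 <= g1 r p + 2 * 2 `^ s * g2 r p.
  by apply: addr_ge0; [exact: powR_ge0|apply: mulr_ge0 => //; apply: mulr_ge0 => //; exact: powR_ge0].
have t0 r p : (0 <= (2 `^ s)%:E * ((g1 r p)%:E + (2 * 2 `^ s)%:E * (g2 r p)%:E))%E.
  rewrite -[X in (_ <= X)%E]/((2 `^ s * (g1 r p + 2 * 2 `^ s * g2 r p))%:E) lee_fin.
  by apply: mulr_ge0 => //; exact: powR_ge0.
have mt r : measurable_fun setT (fun p => ((2 `^ s)%:E * ((g1 r p)%:E + (2 * 2 `^ s)%:E * (g2 r p)%:E))%E).
  apply: emeasurable_funM => //.
  by apply: emeasurable_funD; [exact/measurable_EFinP|apply: emeasurable_funM => //; exact/measurable_EFinP].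
rewrite ge0_integralZl//; last 2 first.
- by apply: emeasurable_funD; [exact: emeasurable_sum|exact/measurable_EFinP].
- by move=> p _; rewrite adde_ge0 ?lee_fin ?powR_ge0// sume_ge0.
rewrite /limit_constant /envelope_mean -/E -mulrA [X in (_ <= X)%E]EFinM lee_wpmul2l ?lee_fin ?powR_ge0//.
rewrite ge0_integralD//; last 3 first.
- exact: emeasurable_sum.
- by move=> p _; rewrite lee_fin powR_ge0.
- exact/measurable_EFinP.
  rewrite ge0_integral_sum// (mulrDl _ 1 de) mul1r [X in (_ <= X)%E]EFinD leeD// -(mulrA K%:R).
  have KE (x : R) : K%:R * x = \sum_(r < K) x by rewrite sumr_const card_ord mulr_natl.
  rewrite KE -sumEFin.
  apply: lee_sum => r _.
  rewrite ge0_integralZl//; last 2 first.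
  - by apply: emeasurable_funD; [exact/measurable_EFinP|apply: emeasurable_funM => //; exact/measurable_EFinP].
  - move=> p _.
    rewrite -[X in (_ <= X)%E]/((g1 r p + 2 * 2 `^ s * g2 r p)%:E) lee_fin.
    exact: gg0.
  rewrite -(mulrA (2 `^ s)) [X in (_ <= X)%E]EFinM lee_wpmul2l ?lee_fin ?powR_ge0//.
  rewrite ge0_integralD//; last 4 first.
  - by move=> p _; rewrite lee_fin powR_ge0.
  - exact/measurable_EFinP.
  - by move=> p _; rewrite mule_ge0 ?lee_fin.
  - by apply: emeasurable_funM => //; exact/measurable_EFinP.
  rewrite ge0_integralZl//; last 2 first.
  - exact/measurable_EFinP.
  - by move=> p _; rewrite lee_fin g20.
  rewrite (mulrDl (fine E) _ de) [X in (_ <= X)%E]EFinD leeD//; first by rewrite mulrC.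
  rewrite -(mulrA (2 * 2 `^ s)) (mulrC _ de) [X in (_ <= X)%E]EFinM.
  by rewrite lee_wpmul2l ?lee_fin.
by move=> p _; rewrite sume_ge0.
Qed.

End limit_coefficients.

Section perturbed_coefficients.
Context {R : realType} (B : ambient R) (s : R).
Hypothesis s0 : 0 < s.
Context d (Om : measurableType d) (P : probability Om R).

(** If opn a <= (1 + t) opn a', the left side is not positive. Otherwise opn a <= (1 + 1/t) (opn a -
    opn a'), and the last difference is at most the norm of a - a'. That norm is kept alone on the
    right because it need not be measurable when the operators are random. *)
Lemma opn_powR_perturbed (a a' : operator B) t : 0 < t ->
  ((opn a `^ s - (1 + t) `^ s * opn a' `^ s)%:E <=
   ((1 + t^-1) `^ s)%:E * opnorm (fun x => a x - a' x)%R `^ s)%E.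
Proof.
move=> t0; set D := opnorm _.
have aD : ((opn a - opn a')%:E <= D)%E.
  rewrite EFinB leeBlDl// -opnormE; apply: ge_ereal_sup => _ [x /= x1 <-].
  apply: (@le_trans _ _ (`|a' x|%:E + `|a x - a' x|%:E)%E).
    by rewrite -EFinD lee_fin -{1}(subrK (a' x) (a x)) addrC ler_normD.
  apply: leeD; last by apply: ereal_sup_ubound; exists x.
  rewrite lee_fin (le_trans (le_opn _ _))// -[leRHS]mulr1 ler_wpM2l ?opn_ge0//.
have D0 : (0 <= D)%E by exact: opnorm_ge0.
have [aa'|aa'] := leP (opn a) ((1 + t) * opn a').
  apply: (@le_trans _ _ 0%E).
    rewrite lee_fin subr_le0 -powRM ?opn_ge0 ?addr_ge0 ?(ltW t0)//.
    by rewrite ge0_ler_powR ?nnegrE ?(ltW s0) ?opn_ge0 ?mulr_ge0 ?opn_ge0 ?addr_ge0 ?(ltW t0).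
  by rewrite mule_ge0 ?lee_fin ?powR_ge0 ?poweR_ge0.
apply: (@le_trans _ _ (opn a `^ s)%:E).
  by rewrite lee_fin lerBlDr lerDl mulr_ge0 ?powR_ge0.
have : (opn a <= (1 + t^-1) * (opn a - opn a')).
  rewrite mulrDl mul1r -lerBlDl opprB addrC subrK ler_pdivlMl//.
  by move: aa'; rewrite mulrDl mul1r -ltrBrDl => /ltW.
move=> h; have [Dy|Dfin] := eqVneq D +oo%E.
  rewrite Dy poweRyr ?gt_eqF// gt0_muley ?leey// lte_fin powR_gt0//.
  by rewrite addr_gt0 ?invr_gt0.
have DE : D = (fine D)%:E by rewrite fineK// ge0_fin_numE// ltey.
rewrite DE in aD D0 *; rewrite poweR_EFin -EFinM lee_fin -powRM//; last first.
  by rewrite addr_ge0 ?invr_ge0 ?(ltW t0).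
have tt : 0 < 1 + t^-1 by rewrite addr_gt0 ?invr_gt0.
rewrite ge0_ler_powR ?nnegrE ?(ltW s0) ?opn_ge0 ?mulr_ge0 ?(ltW tt)//.
by rewrite (le_trans h)// ler_wpM2l ?(ltW tt)//.
Qed.

Lemma perturbed_op_moment (a a' : Om -> operator B) t de :
  measurable_fun setT a -> measurable_fun setT a' -> 0 < t ->
  (\int[P]_w (opnorm (fun x => a w x - a' w x)%R `^ s) <= de%:E)%E ->
  (\int[P]_w (opn (a w) `^ s)%:E <= ((1 + t) `^ s)%:E * \int[P]_w (opn (a' w) `^ s)%:E
     + ((1 + t^-1) `^ s * de)%:E)%E.
Proof.
move=> ma ma' t0 H.
have mopn (c : Om -> operator B) : measurable_fun setT c ->
    measurable_fun setT (fun w => opn (c w) `^ s).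
  move=> mc; apply: (measurableT_comp (@measurable_powR R s)).
  exact: measurable_fun_opn_comp.
have T0 : 0 < (1 + t^-1) `^ s by rewrite powR_gt0// addr_gt0 ?invr_gt0.
(* A measurable minorant of the s-th power of the norm of the difference: its integral is additive
   and still at most [de]. *)
pose k w := Num.max 0 (((1 + t^-1) `^ s)^-1 * (opn (a w) `^ s - (1 + t) `^ s * opn (a' w) `^ s)).
have mk : measurable_fun setT k.
  apply: measurable_maxr => //; apply: measurable_funM => //.
  by apply: measurable_funB; [exact: mopn|apply: measurable_funM => //; exact: mopn].
have k0 w : 0 <= k w by rewrite /k le_max lexx.
have kH : (\int[P]_w (k w)%:E <= de%:E)%E.
  apply: le_trans H; apply: ge0_le_lower_integral => w _; first by rewrite lee_fin.
  rewrite EFin_max ge_max poweR_ge0/= EFinM -lee_pdivlMl ?invr_gt0//.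
  by rewrite invrK; exact: opn_powR_perturbed.
apply: (@le_trans _ _ (\int[P]_w (((1 + t) `^ s)%:E * (opn (a' w) `^ s)%:E +
    ((1 + t^-1) `^ s)%:E * (k w)%:E))%E).
  apply: ge0_le_lower_integral => w _; first by rewrite lee_fin powR_ge0.
  rewrite -[leRHS]/(((1 + t) `^ s * opn (a' w) `^ s + (1 + t^-1) `^ s * k w)%:E) lee_fin.
  rewrite -lerBlDl -ler_pdivrMl//.
  by rewrite /k le_max lexx orbT.
rewrite ge0_integralD//; last 4 first.
- by move=> w _; rewrite mule_ge0 ?lee_fin ?powR_ge0.
- by apply: emeasurable_funM => //; apply/measurable_EFinP; exact: mopn.
- by move=> w _; rewrite mule_ge0 ?lee_fin ?powR_ge0.
- by apply: emeasurable_funM => //; apply/measurable_EFinP.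
rewrite ge0_integralZl//; last 3 first.
- by apply/measurable_EFinP; exact: mopn.
- by move=> w _; rewrite lee_fin powR_ge0.
- by rewrite lee_fin powR_ge0.
rewrite leeD2l// ge0_integralZl//; last 3 first.
- exact/measurable_EFinP.
- by move=> w _; rewrite lee_fin.
- by rewrite lee_fin ltW.
by rewrite EFinM lee_wpmul2l// lee_fin ltW.
Qed.

Lemma perturbed_row_sum K (Al : 'I_K -> Om -> operator B) :
  (forall r, measurable_fun setT (Al r)) ->
  (\sum_r \int[P]_w (opn (Al r w) `^ s)%:E < 1)%E ->
  exists q, exists de, [/\ 0 < de, q < 1 & forall A : 'I_K -> Om -> operator B,
    (forall r, measurable_fun setT (A r)) ->
    (forall r, (\int[P]_w (opnorm (fun x => A r w x - Al r w x)%R `^ s) <= de%:E)%E) ->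
    (\sum_r \int[P]_w (opn (A r w) `^ s)%:E <= q%:E)%E].
Proof.
move=> mAl L1; pose L := (\sum_r \int[P]_w (opn (Al r w) `^ s)%:E)%E.
have {}L1 : (L < 1)%E := L1.
have L0 : (0 <= L)%E.
  by apply: sume_ge0 => r _; apply: integral_ge0 => w _; rewrite lee_fin powR_ge0.
have LE : L = (fine L)%:E by rewrite fineK// ge0_fin_numE// (lt_trans L1)// ltry.
have l0 : 0 <= fine L by rewrite -lee_fin -LE.
have l1 : fine L < 1 by rewrite -lte_fin -LE.
(* [c] exceeds 1 while c L < 1, and t is chosen with (1 + t)^s = c. The perturbed row sum is then at
   most c L plus an error, and [de] limits the error to half of the gap 1 - c L. *)
pose c := 2 / (1 + fine L).
have dl : 0 < 1 + fine L by lra.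
have c1 : 1 < c by rewrite /c ltr_pdivlMr//; lra.
have cl : c * fine L < 1 by rewrite /c mulrAC ltr_pdivrMr//; lra.
pose t := c `^ s^-1 - 1.
have t0 : 0 < t.
  rewrite /t subr_gt0; apply: (@le_lt_trans _ _ (1 `^ s^-1)); first by rewrite powR1.
  rewrite gt0_ltr_powR ?nnegrE ?invr_gt0//.
  by rewrite ltW// (lt_trans ltr01).
have tc : (1 + t) `^ s = c.
  by rewrite /t addrC subrK -powRrM mulVf ?gt_eqF// powRr1// ltW// (lt_trans ltr01).
pose T := (1 + t^-1) `^ s.
have T0 : 0 < T by rewrite powR_gt0// addr_gt0 ?invr_gt0.
pose de := (1 - c * fine L) / 2 / (K.+1%:R * T).
have cl2 : 0 < (1 - c * fine L) / 2 by rewrite divr_gt0// subr_gt0.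
exists ((1 + c * fine L) / 2), de; split.
- by rewrite /de divr_gt0// mulr_gt0.
- lra.
move=> A mA HA.
apply: (@le_trans _ _ (\sum_(r < K) (c%:E * \int[P]_w (opn (Al r w) `^ s)%:E + (T * de)%:E))%E).
  by apply: lee_sum => r _; rewrite -tc; exact: perturbed_op_moment.
rewrite big_split/= -ge0_sume_distrr; last first.
  by move=> r _; apply: integral_ge0 => w _; rewrite lee_fin powR_ge0.
rewrite -/L {1}LE -EFinM sumEFin -EFinD lee_fin sumr_const card_ord -[_ *+ K]mulr_natl.
have : K%:R * (T * de) <= (1 - c * fine L) / 2.
  have -> : T * de = (1 - c * fine L) / 2 / K.+1%:R.
    have E (x k u : R) : k != 0 -> u != 0 -> u * (x / (k * u)) = x / k.
      by move=> k0 u0; field; rewrite k0 u0.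
    by rewrite /de E// gt_eqF.
  by rewrite mulrCA ler_piMr ?(ltW cl2)// ler_pdivrMr// mul1r ler_nat.
lra.
Qed.

End perturbed_coefficients.

(** * Laws of the recursion and of the fixed point *)

Lemma law_exists d1 d2 (T1 : measurableType d1) (T2 : measurableType d2)
    (R : realType) (P : probability T1 R) (f : T1 -> T2) :
  measurable_fun setT f -> exists Q : probability T2 R, forall U, Q U = P (f @^-1` U).
Proof.
move=> mf; have Pf : f \in mfun by apply/mem_set.
by exists (distribution P (mfun_Sub Pf)).
Qed.

Lemma big_option_setT (R : realType) (K : nat) (F : option 'I_K -> \bar R) :
  (\prod_(o in [set: option 'I_K]%SET) F o = F None * \prod_r F (Some r))%E.
Proof.
rewrite (bigD1 None)//=; last by rewrite inE.
congr (_ * _)%E.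
rewrite (reindex_omap (Some : 'I_K -> option 'I_K) id)/=; last first.
  by case=> [r|] //; rewrite andbF.
by apply: eq_bigl => r; rewrite inE eqxx.
Qed.

Section coordinatewise_maps.
Context d1 d1' d2 d2' (Om : measurableType d1) (T : measurableType d1')
  (Om' : measurableType d2) (T' : measurableType d2') (R : realType).
Variables (P : probability Om R) (La : probability T R).
Variables (P' : probability Om' R) (La' : probability T' R).
Variables (f : Om -> Om') (h : T -> T').
Hypotheses (mf : measurable_fun setT f) (mh : measurable_fun setT h).
Hypothesis P'E : forall U, measurable U -> P' U = P (f @^-1` U).
Hypothesis La'E : forall U, measurable U -> La' U = La (h @^-1` U).

Definition map_coords n (p : Om * n.-tuple T) : Om' * n.-tuple T' :=
  (f p.1, [tuple h (tnth p.2 i) | i < n]).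

Lemma measurable_map_coords n : measurable_fun setT (@map_coords n).
Proof.
apply: measurable_fun_pair => /=; first by apply: (measurableT_comp mf); exact: measurable_fst.
apply/measurable_fun_tnthP => i.
rewrite (_ : _ \o _ = fun p : Om * n.-tuple T => h (tnth p.2 i)); last first.
  by apply/funext => p /=; rewrite tnth_mktuple.
apply: (measurableT_comp mh); apply: (measurableT_comp (measurable_tnth i)).
exact: measurable_snd.
Qed.

Lemma map_coords_law n X : measurable X ->
  (P' \x iid_law La' n)%E X = (P \x iid_law La n)%E (@map_coords n @^-1` X).
Proof.
move=> mX.
have [m mE] := pushforward_exists (P \x iid_law La n)%E (@measurable_map_coords n).
apply/esym; rewrite -[LHS]mE; apply: product_iid_unique => // E F mE' mF; rewrite mE.
have mh' i : measurable (h @^-1` F i) by rewrite -[X in measurable X]setTI; exact: mh.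
have mf' : measurable (f @^-1` E) by rewrite -[X in measurable X]setTI; exact: mf.
transitivity ((P \x iid_law La n)%E ((f @^-1` E) `*` box (fun i => h @^-1` F i))).
  congr (product_measure1 _ _ _); apply/seteqP; split => -[w t] /= [Ew H]; split => // i.
    by have := H i; rewrite tnth_mktuple.
  by rewrite tnth_mktuple; exact: H.
rewrite product_iid_rect// -P'E//; congr (_ * _)%E.
by apply: eq_bigr => i _; rewrite La'E.
Qed.

End coordinatewise_maps.

Section recursion_laws.
Context {R : realType} (B : ambient R).
Context d (Omega : measurableType d) (P : probability Omega R) (K : nat).
Variables (A : 'I_K -> {RV P >-> operator B}) (b : {RV P >-> carrier B}).
Variable (I : 'I_K -> {RV P >-> nat}).
Variables (LX : probability (path_type B) R) (eta : probability (carrier B) R).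
Local Notation Pi := (hybrid_law P K LX eta).

Definition coefficient_generators : set (set Omega) :=
  (\bigcup_r preimage_set_system setT (A r) measurable) `|`
      preimage_set_system setT b measurable `|`
      (\bigcup_r preimage_set_system setT (I r) measurable).

Let Om0 := g_sigma_algebraType coefficient_generators.

Lemma coefficient_generators_measurable E : <<s coefficient_generators >> E -> measurable E.
Proof.
apply: smallest_sub; first exact: sigma_algebra_measurable.
move=> _ [[[r _ [U mU <-]]|[U mU <-]]|[r _ [U mU <-]]]; exact: measurable_funPT.
Qed.

Definition always : 'I_K -> nat -> bool := fun _ _ => true.

(* Independence makes the joint law of coefficients and copies a product only on
   the sigma-algebra generated by the coefficients, hence the detour through Om0. *)
Lemma recursion_law (Xcopy : 'I_K -> nat -> {RV P >-> carrier B}) U :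
  (forall r E, path_events E -> P [set w | E (fun n => Xcopy r n w)] = LX E) ->
  independent P (fun o : option 'I_K =>
       match o with
       | None => coefficient_events A b I
       | Some r => process_events (Xcopy r)
       end) ->
  measurable U ->
  P (recursion_rhs A b I Xcopy @^-1` U) = Pi (hybrid A b I always @^-1` U).
Proof.
move=> XL ind mU.
have mid : measurable_fun setT (fun w : Omega => w : Om0).
  by move=> _ V mV; rewrite setTI; exact: coefficient_generators_measurable.
have mA r : measurable_fun setT (fun w : Om0 => A r w).
  by move=> _ V mV; apply: sub_sigma_algebra; left; left; exists r => //; exists V.
have mb : measurable_fun setT (fun w : Om0 => b w).
  by move=> _ V mV; apply: sub_sigma_algebra; left; right; exists V.
have mI r : measurable_fun setT (fun w : Om0 => I r w).
  by move=> _ V mV; apply: sub_sigma_algebra; right; exists r => //; exists V.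
have [P0 P0E] := law_exists P mid.
pose Psi (p : Om0 * K.-tuple (path_type B)) : carrier B :=
  \sum_r A r p.1 (tnth p.2 r (I r p.1)) + b p.1.
(* Each path is completed by the dummy point 0, so that measurability of [Psi] follows from that of
   [hybrid], which does not read the point under [always]. *)
have mpad : measurable_fun setT (fun x : path_type B => (x, 0) : sample B).
  by apply: measurable_fun_pair => //; exact: measurable_cst.
have mPsi : measurable_fun setT Psi.
  have mp := @measurable_map_coords _ _ _ _ Om0 (path_type B) Om0 (sample B)
    id _ (@measurable_id _ _ _) mpad K.
  have mh := measurable_hybrid mA mb mI always.
  rewrite (_ : Psi = hybrid (fun r => A r) b (fun r => I r) always \o map_coords id (fun x : path_type B => (x, 0) : sample B) (n := K)).
    exact: (measurableT_comp mh mp).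
  apply/funext => p; rewrite /Psi /hybrid /=; congr (_ + _).
  by apply: eq_bigr => r _; rewrite tnth_mktuple.
pose copies (w : Omega) : Om0 * K.-tuple (path_type B) :=
  (w : Om0, [tuple (fun n => Xcopy r n w) : path_type B | r < K]).
have mcopy r : measurable_fun setT (fun w => (fun n => Xcopy r n w) : path_type B).
  by apply: measurable_fun_path => n.
have mcopies : measurable_fun setT copies.
  apply: measurable_fun_pair => //=.
  apply/measurable_fun_tnthP => r.
  rewrite (_ : _ \o _ = fun w => (fun n => Xcopy r n w) : path_type B)//.
  by apply/funext => w /=; rewrite tnth_mktuple.
have [m mE] := pushforward_exists P mcopies.
have mlaw V : measurable V -> m V = (P0 \x iid_law LX K)%E V.
  apply: product_iid_unique => E F mE' mF; rewrite mE.
  (* Events in the sigma-algebras of the coefficients and of the K copies; their independence is the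
     product rule on boxes. *)
  pose ev o := match o with None => E : set Omega
    | Some r => [set w | F r (fun n => Xcopy r n w)] end.
  have mev o : match o with
       | None => coefficient_events A b I
       | Some r => process_events (Xcopy r)
       end (ev o).
    case: o => [r|] //=.
    pose G := \bigcup_n preimage_set_system setT (Xcopy r n) measurable.
    have mG : measurable_fun setT (fun w : g_sigma_algebraType G => (fun n => Xcopy r n w) : path_type B).
      apply: measurable_fun_path => n _ W mW; apply: sub_sigma_algebra.
      by exists n => //; exists W.
    by have := mG measurableT _ (mF r); rewrite setTI.
  have := ind [set: option 'I_K]%SET ev mev.
  rewrite big_option_setT => PE; transitivity (P (\bigcap_(i in [set` [set: option 'I_K]%SET]) ev i)).
    congr (P _); apply/seteqP; split => w /=.
      by move=> [Ew Hw] [r|] _ //=; have := Hw r; rewrite tnth_mktuple.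
    move=> H; have {}H o : ev o w by apply: H; rewrite /= inE.
    split; first exact: (H None).
    by move=> r; rewrite tnth_mktuple; exact: (H (Some r)).
  rewrite PE -P0E; congr (_ * _)%E; apply: eq_bigr => r _.
  by apply: XL; exact: mF.
have Psi_law : measurable (Psi @^-1` U) by rewrite -[X in measurable X]setTI; exact: mPsi.
transitivity (m (Psi @^-1` U)).
  rewrite mE; congr (P _); apply/seteqP; split => w; rewrite /recursion_rhs /Psi /=;
    by under [X in U (X + _) -> _]eq_bigr => r _ do [rewrite ?tnth_mktuple]; 
       under [X in _ -> U (X + _)]eq_bigr => r _ do [rewrite ?tnth_mktuple].
rewrite mlaw//.
(* Passage to the full space: the coefficients regain the sigma-algebra of Omega, and a point of law
   eta is adjoined to each path. *)
rewrite (map_coords_law (h := fst) (P := P) (La := sample_law LX eta) mid measurable_fst)//; last first.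
  move=> V mV; transitivity (LX V * eta setT)%E; first by rewrite (probability_setT eta) mule1.
  transitivity ((LX \x eta)%E (V `*` [set: carrier B])).
    by apply/esym; exact: product_measure1E.
  by congr (product_measure1 _ _ _); apply/seteqP; split => x //= [].
suff -> : hybrid A b I always = Psi \o map_coords (id : Omega -> Om0) fst (n := K) by [].
apply/funext => p; rewrite /hybrid /Psi /=; congr (_ + _).
by apply: eq_bigr => r _; rewrite tnth_mktuple.
Qed.

Lemma limit_law U : measurable U ->
  smoothing A b eta U = Pi (hybrid A b I (@never K) @^-1` U).
Proof.
move=> mU; rewrite /smoothing.
pose Psi (p : Omega * K.-tuple (carrier B)) : carrier B :=
  \sum_r A r p.1 (tnth p.2 r) + b p.1.
have mPsi : measurable_fun setT Psi.
  apply: measurable_funD_amb; last by apply: measurableT_comp => //; exact: measurable_fst.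
  apply: measurable_fun_sum_amb => r; apply: measurable_fun_op_app.
    by apply: (measurableT_comp (g := fst)) => //; exact: measurable_fst.
  by apply: (measurableT_comp (measurable_tnth r)); exact: measurable_snd.
have mPU : measurable (Psi @^-1` U) by rewrite -[X in measurable X]setTI; exact: mPsi.
rewrite -/(Psi @^-1` U).
transitivity (Pi (map_coords id snd (n := K) @^-1` (Psi @^-1` U))).
  apply: map_coords_law => // V mV.
  transitivity (LX setT * eta V)%E; first by rewrite (probability_setT LX) mul1e.
  transitivity ((LX \x eta)%E ([set: path_type B] `*` V)).
    by apply/esym; exact: product_measure1E.
  by congr (product_measure1 _ _ _); apply/seteqP; split => x //= [].
suff -> : hybrid A b I (@never K) = Psi \o map_coords (id : Omega -> Omega) snd (n := K) by [].
apply/funext => p; rewrite /hybrid /Psi /=; congr (_ + _).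
by apply: eq_bigr => r _; rewrite tnth_mktuple.
Qed.

End recursion_laws.

(** * The inequality for zeta_s *)

Section zeta_distance.
Context {R : realType} (B : ambient R) (s : R).
Hypothesis s0 : 0 < s.
Implicit Types (mu nu : probability (carrier B) R).

(** The equality of moments that a coupling estimate uses: only Taylor forms of test functions
    enter, and for these [zeta_taylor_moments] provides it. *)
Definition taylor_matched mu nu : Prop :=
  forall (f : carrier B -> R) (D : forall k, carrier B -> kform (carrier B) k),
  measurable_fun setT f -> derivative_tower (zorder s) f D ->
  (forall x y, (formnorm (fun v => D (zorder s) x v - D (zorder s) y v)%R
                 <= (`|x - y| `^ zexponent s)%:E)%E) ->
  forall j, (j <= zorder s)%N ->
    \int[mu]_x taylor_term D j x = \int[nu]_x taylor_term D j x.

Lemma Ms_at_taylor_matched mu nu : Ms s nu -> Ms_at s nu mu -> taylor_matched mu nu.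
Proof.
move=> nus [mus munu] f D mf Df Dh [|j] jm.
  have E (la : probability (carrier B) R) : \int[la]_x taylor_term D 0 x = f 0.
    rewrite -[RHS](Rintegral_cst_probability la (f 0)).
    by apply: eq_Rintegral => x _; rewrite /taylor_term fact0 divr1; have [-> _ _ _] := Df.
  by rewrite !E.
have int (la : probability (carrier B) R) : Ms s la ->
    la.-integrable setT (EFin \o (fun x => D j.+1 0 (fun=> x))).
  move=> las; have := integrable_taylor_term s0 mf Df Dh jm (@measurable_id _ _ setT) las.
  move=> /(integrableZl measurableT j.+1`!%:R).
  congr (_.-integrable _ _); apply/funext => x /=.
  by rewrite -EFinM /taylor_term mulrCA mulfV ?mulr1// pnatr_eq0 -lt0n fact_gt0.
have E (la : probability (carrier B) R) : Ms s la -> \int[la]_x taylor_term D j.+1 x =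
    fine (\int[la]_x (D j.+1 0 (fun=> x))%:E)%E / j.+1`!%:R.
  by move=> las; rewrite -RintegralZr//; exact: int.
rewrite !E// munu//.
by have [_ /(_ j.+1 0 jm)] := Df.
Qed.

Lemma zeta_le mu nu M : Ms s mu -> Ms s nu ->
  (forall f, test_functions s f -> (`|\int[mu]_x f x - \int[nu]_x f x|%:E <= M)%E) ->
  (zeta s mu nu <= M)%E.
Proof.
move=> mus nus H; apply: ge_ereal_sup => _ [f fs <-].
have iN (la : probability (carrier B) R) : Ms s la -> la.-integrable setT (EFin \o f).
  by move=> las; apply: (integrable_test s0 fs (@measurable_id _ _ setT)).
by rewrite !Rintegral_EFin; [exact: H|exact: iN..].
Qed.

Lemma le_zeta mu nu f : Ms s mu -> Ms s nu -> test_functions s f ->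
  (`|\int[mu]_x f x - \int[nu]_x f x|%:E <= zeta s mu nu)%E.
Proof.
move=> mus nus fs.
have iN (la : probability (carrier B) R) : Ms s la -> la.-integrable setT (EFin \o f).
  by move=> las; apply: (integrable_test s0 fs (@measurable_id _ _ setT)).
apply: ereal_sup_ubound; exists f => //.
by rewrite !Rintegral_EFin; [|exact: iN..].
Qed.

(** The zero function is a test function, so the supremum is not over the empty set. *)
Lemma zeta_ge0 mu nu : Ms s mu -> Ms s nu -> (0 <= zeta s mu nu)%E.
Proof.
move=> mus nus.
have f0 : test_functions s (fun _ : carrier B => 0 : R).
  have fn k (g : kform (carrier B) k) e : 0 <= e -> (forall v, g v = 0) -> (formnorm g <= e%:E)%E.
    by move=> e0 g0; apply: formnorm_le => h _; rewrite g0 normr0.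
  apply/test_functionsP; split; last exact: measurable_cst.
  exists (fun _ _ _ => 0); last by move=> x y; apply: fn => [|v]; rewrite ?powR_ge0 ?subrr.
  split => //.
  - move=> k x _; split; last by apply: le_lt_trans (fn _ _ 0 (lexx 0) _) (ltry 0).
    by move=> i v a y z /=; rewrite mulr0 addr0.
  - move=> k x e _ e0; near=> h; apply: fn => [|v]; last by rewrite !subr0.
    by rewrite mulr_ge0// ltW.
  - by move=> x e e0; near=> y; apply: fn => [|v]; rewrite ?subrr ?(ltW e0).
by apply: le_trans (le_zeta mus nus f0); rewrite lee_fin.
Unshelve. all: by end_near. Qed.

(** The coupling estimate for the independent coupling of mu and nu, with e = 1. *)
Lemma zeta_lty mu nu : Ms s mu -> Ms s nu -> taylor_matched mu nu ->
  (zeta s mu nu < +oo)%E.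
Proof.
move=> mus nus munu; have [C C0 HC] := remainder_young s0 ltr01.
pose pr := (mu \x nu)%E : probability (carrier B * carrier B)%type R.
have law1 U : measurable U -> mu U = pr (fst @^-1` U).
  move=> mU; transitivity (mu U * nu setT)%E; first by rewrite (probability_setT nu) mule1.
  transitivity ((mu \x nu)%E (U `*` [set: carrier B])).
    by apply/esym; exact: product_measure1E.
  by congr (product_measure1 _ _ _); apply/seteqP; split => x //= [].
have law2 U : measurable U -> nu U = pr (snd @^-1` U).
  move=> mU; transitivity (mu setT * nu U)%E; first by rewrite (probability_setT mu) mul1e.
  transitivity ((mu \x nu)%E ([set: carrier B] `*` U)).
    by apply/esym; exact: product_measure1E.
  by congr (product_measure1 _ _ _); apply/seteqP; split => x //= [].
have m1 := @measurable_fst _ _ (carrier B) (carrier B).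
have m2 := @measurable_snd _ _ (carrier B) (carrier B).
have mn : measurable_fun setT (fun x : carrier B => (`|x| `^ s)%:E).
  by apply/measurable_EFinP; exact: (measurable_norm_powR s (@measurable_id _ _ setT)).
have n0 (x : carrier B) : (0 <= (`|x| `^ s)%:E)%E by rewrite lee_fin powR_ge0.
have s1 : (smoment s pr fst < +oo)%E.
  by rewrite /smoment -(ge0_integral_law m1 law1 mn n0).
have s2 : (smoment s pr snd < +oo)%E.
  by rewrite /smoment -(ge0_integral_law m2 law2 mn n0).
have s3 : (smoment s pr (fun p => p.2 - p.1)%R < +oo)%E.
  apply: (@le_lt_trans _ _ (\int[pr]_p ((2 `^ s)%:E * ((`|p.2| `^ s)%:E + (`|p.1| `^ s)%:E)))%E).
    apply: ge0_le_lower_integral => p _; first by rewrite lee_fin powR_ge0.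
    rewrite -EFinD -EFinM lee_fin (le_trans _ (powRD_le s0 _ _))//.
    by rewrite ge0_ler_powR ?nnegrE ?(ltW s0) ?addr_ge0// ler_normB.
  have mn1 : measurable_fun setT (fun p : carrier B * carrier B => (`|p.1| `^ s)%:E).
    exact: (measurableT_comp mn m1).
  have mn2 : measurable_fun setT (fun p : carrier B * carrier B => (`|p.2| `^ s)%:E).
    exact: (measurableT_comp mn m2).
  rewrite ge0_integralZl//; last 2 first.
  - exact: emeasurable_funD.
  - by move=> p _; rewrite adde_ge0.
  rewrite lte_mul_pinfty ?lee_fin ?powR_ge0//.
  rewrite ge0_integralD//.
  by apply: lte_add_pinfty; [exact: s2|exact: s1].
have := @zeta_le mu nu _ mus nus.
move=> /(_ (1 * \int[pr]_w (`|w.2| `^ s) + C * \int[pr]_w (`|w.2 - w.1| `^ s))%:E) H.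
apply: (@le_lt_trans _ _ _ _ _ (H _)); last exact: ltry.
move=> f fs; have /test_functionsP[[D Df Dh] mf] := fs.
have iN (la : probability (carrier B) R) : Ms s la -> la.-integrable setT (EFin \o f).
  by move=> las; apply: (integrable_test s0 fs (@measurable_id _ _ setT)).
rewrite (Rintegral_law m1 law1 (iN _ mus)) (Rintegral_law m2 law2 (iN _ nus)) lee_fin.
apply: (coupling_bound s0 mf Df Dh C0 HC m1 m2 s1 s2 s3) => j jm.
have iT (la : probability (carrier B) R) : Ms s la -> la.-integrable setT (EFin \o taylor_term D j).
  by move=> las; apply: (integrable_taylor_term s0 mf Df Dh jm (@measurable_id _ _ setT) las).
rewrite -(Rintegral_law m1 law1 (iT _ mus)) -(Rintegral_law m2 law2 (iT _ nus)).
exact: (munu f D mf Df Dh j jm).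
Qed.

End zeta_distance.

Section one_step.
Context {R : realType} (B : ambient R) (s : R).
Hypothesis s0 : 0 < s.
Context d (Om : measurableType d) (P : probability Om R) (K : nat).
Variables (A : 'I_K -> Om -> operator B) (b : Om -> carrier B) (I : 'I_K -> Om -> nat).
Hypotheses (mA : forall r, measurable_fun setT (A r))
  (mb : measurable_fun setT b) (mI : forall r, measurable_fun setT (I r)).
Variables (Al : 'I_K -> Om -> operator B) (bl : Om -> carrier B).
Hypotheses (mAl : forall r, measurable_fun setT (Al r)) (mbl : measurable_fun setT bl).
Variables (LX : probability (path_type B) R) (eta : probability (carrier B) R).
Variable mu : nat -> probability (carrier B) R.
Hypothesis mu_law : forall i U, measurable U ->
  mu i U = LX ((fun x : path_type B => x i) @^-1` U).
Hypotheses (mu_Ms : forall i, Ms s (mu i)) (eta_Ms : Ms s eta).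
Variables n n0 : nat.
Hypothesis I_le : forall r w, (I r w <= n)%N.
Hypothesis A_moment : forall r, (\int[P]_w (opn (A r w) `^ s)%:E < +oo)%E.
Hypothesis b_moment : (\int[P]_w (`|b w| `^ s)%:E < +oo)%E.
Hypothesis Al_moment : forall r, (\int[P]_w (opn (Al r w) `^ s)%:E < +oo)%E.
Hypothesis bl_moment : (\int[P]_w (`|bl w| `^ s)%:E < +oo)%E.
Local Notation Pi := (hybrid_law P K LX eta).
Hypothesis mu_recursion : forall U, measurable U ->
  mu n U = Pi (hybrid A b I (@always K) @^-1` U).
Hypothesis eta_recursion : forall U, measurable U ->
  eta U = Pi (hybrid Al bl I (@never K) @^-1` U).
Hypothesis mu_matched : taylor_matched s (mu n) eta.
Variable z : nat -> R.
Hypothesis z0 : forall i, 0 <= z i.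
Hypothesis mu_z : forall i, (n0 <= i <= n)%N -> forall g, test_functions s g ->
  `|\int[mu i]_x g x - \int[eta]_x g x| <= z i.

(** The right side still contains z n, through I_r = n; it is absorbed only in [contraction_cvg0].
    The error term does not involve n except through the admissible [de]. *)
Lemma one_step e C de : 0 <= C ->
  (forall a h : R, 0 <= a -> 0 <= h ->
    (1 + (zorder s)%:R) * (h `^ zexponent s * (a + h) ^+ zorder s) <=
    e * a `^ s + C * h `^ s) ->
  (\int[P]_w (`|b w - bl w| `^ s)%:E <= de%:E)%E ->
  (forall r, (\int[P]_w (opnorm (fun x => A r w x - Al r w x)%R `^ s) <= de%:E)%E) ->
  (forall r, (\int[P]_w (opn (A r w) `^ s * \1_[set w | (I r w < n0)%N] w)%:E <= de%:E)%E) ->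
  (zeta s (mu n) eta <= \sum_r \int[P]_w (opn (A r w) `^ s * z (I r w))%:E +
    (e * \int[eta]_x (`|x| `^ s) + C * (limit_constant s K LX eta n0 * de))%:E)%E.
Proof.
move=> C0 HC Hb HA HI.
set T := (\sum_r _)%E.
have Ilt r w : (I r w < n.+1)%N by rewrite ltnS.
have mS S := measurable_hybrid mA mb mI S.
have mSl := measurable_hybrid mAl mbl mI (@never K).
have T0 : (0 <= T)%E.
  apply: sume_ge0 => r _; apply: integral_ge0 => w _.
  by rewrite lee_fin mulr_ge0 ?powR_ge0.
(* The values z i are bounded over the finite range of I_r, so T is finite by the moments of the
   A_r. *)
have Tfin : T = (fine T)%:E.
  rewrite fineK// ge0_fin_numE//; apply: lte_sum_pinfty => r _.
  apply: (@le_lt_trans _ _ (\int[P]_w ((\sum_(i < n.+1) z i)%:E * (opn (A r w) `^ s)%:E))%E).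
    apply: ge0_le_lower_integral => w _; first by rewrite lee_fin mulr_ge0 ?powR_ge0.
    rewrite -EFinM lee_fin mulrC ler_wpM2r ?powR_ge0//.
    by rewrite (bigD1 (Ordinal (Ilt r w)))//= lerDl sumr_ge0.
  rewrite ge0_integralZl//; last 3 first.
  - apply/measurable_EFinP; apply: (measurableT_comp (@measurable_powR R s)).
    exact: measurable_fun_opn_comp.
  - by move=> w _; rewrite lee_fin powR_ge0.
  - by rewrite lee_fin sumr_ge0.
  apply: lte_mul_pinfty; [by rewrite lee_fin sumr_ge0|by []|exact: A_moment].
have belowK : @below K n0 K = @always K.
  by apply/funext => r; apply/funext => i; rewrite /below ltn_ord orbT.
have below0 : @below K n0 0 = @initial K n0.
  by apply/funext => r; apply/funext => i; rewrite /below orbF.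
have tele f (fs : test_functions s f) :=
  hybrid_telescope s0 mA mb mI mu_law mu_Ms eta_Ms I_le A_moment b_moment fs z0 mu_z.
have H0M := smoment_hybrid s0 mA mb mu_law mu_Ms eta_Ms I_le A_moment b_moment
  (@initial K n0).
have HlM := smoment_hybrid s0 mAl mbl mu_law mu_Ms eta_Ms I_le Al_moment bl_moment
  (@never K).
have [nu nuE] := law_exists Pi (mS (@initial K n0)).
have nuE' U : measurable U -> nu U = Pi (hybrid A b I (@initial K n0) @^-1` U) by [].
have nus : Ms s nu.
  have mn : measurable_fun setT (fun x : carrier B => (`|x| `^ s)%:E).
    by apply/measurable_EFinP; exact: (measurable_norm_powR s (@measurable_id _ _ setT)).
  have n00 (x : carrier B) : (0 <= (`|x| `^ s)%:E)%E by rewrite lee_fin powR_ge0.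
  by apply: le_lt_trans H0M; rewrite (ge0_integral_law (mS _) nuE' mn n00).
have iN (la : probability (carrier B) R) f : Ms s la -> test_functions s f ->
    la.-integrable setT (EFin \o f).
  by move=> las fs; apply: (integrable_test s0 fs (@measurable_id _ _ setT)).
have mu_nu f : test_functions s f -> `|\int[mu n]_x f x - \int[nu]_x f x| <= fine T.
  move=> fs; rewrite -lee_fin -Tfin; have := tele f fs; rewrite belowK below0.
  by rewrite (Rintegral_law (mS _) mu_recursion (iN _ _ (mu_Ms n) fs))
     (Rintegral_law (mS _) nuE' (iN _ _ nus fs)).
(* [fine T] bounds the difference for all test functions at once, so mu n and nu have equal Taylor
   moments, and those of mu n match eta by hypothesis. *)
have nu_eta : taylor_matched s nu eta.
  move=> f D mf Df Dh j jm.
  rewrite -(zeta_taylor_moments s0 (mu_Ms n) nus (fine_ge0 T0) mu_nu mf Df Dh jm).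
  exact: (mu_matched mf Df Dh jm).
apply: (zeta_le s0) => // f fs; have /test_functionsP[[D Df Dh] mf] := fs.
apply: (@le_trans _ _ (`|\int[mu n]_x f x - \int[nu]_x f x|%:E + `|\int[nu]_x f x - \int[eta]_x f x|%:E)%E).
  by rewrite -EFinD lee_fin ler_distD.
rewrite leeD//; first by rewrite Tfin lee_fin mu_nu.
have LD := limit_distance s0 mA mb mI mAl mbl mu_law mu_Ms eta_Ms Hb HA HI.
rewrite lee_fin (Rintegral_law (mS _) nuE' (iN _ _ nus fs)).
rewrite (Rintegral_law mSl eta_recursion (iN _ _ eta_Ms fs)).
apply: (le_trans (coupling_bound s0 mf Df Dh C0 HC (mS _) mSl H0M HlM (le_lt_trans LD (ltry _)) _)).
  move=> j jm.
  have iT (la : probability (carrier B) R) : Ms s la -> la.-integrable setT (EFin \o taylor_term D j).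
    by move=> las; apply: (integrable_taylor_term s0 mf Df Dh jm (@measurable_id _ _ setT) las).
  rewrite -(Rintegral_law mSl eta_recursion (iT _ eta_Ms)).
  rewrite -(Rintegral_law (mS _) nuE' (iT _ nus)).
  exact: (nu_eta f D mf Df Dh j jm).
apply: lerD.
  rewrite (Rintegral_law mSl eta_recursion (f := fun x => `|x| `^ s))//.
  by apply: (integrable_norm_powR (@measurable_id _ _ setT)).
rewrite ler_wpM2l//.
have mD : measurable_fun setT (fun p => hybrid Al bl I (@never K) p - hybrid A b I (@initial K n0) p).
  by apply: measurable_funB_amb.
have iD := integrable_norm_powR mD (le_lt_trans LD (ltry _)).
by rewrite -lee_fin -(Rintegral_EFin iD); exact: LD.
Qed.

End one_step.

(** * Convergence of the distances to zero *)

Section vanishing.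
Context {R : realType}.
Local Open Scope ereal_scope.

Lemma cvge0P (u : nat -> \bar R) : (forall n, 0 <= u n) ->
  (u n @[n --> \oo] --> 0) <-> (forall e : R, (0 < e)%R -> \forall n \near \oo, u n <= e%:E).
Proof.
move=> u0; split => [/fine_cvgP[ufin uc] e e0|H].
  have := @cvgr_dist_le _ _ _ _ _ _ _ uc e e0; move=> uc'.
  near=> n.
  have fn : u n \is a fin_num by near: n.
  rewrite -(fineK fn) lee_fin.
  have : (`|0 - fine (u n)| <= e)%R by near: n; exact: uc'.
  by rewrite sub0r normrN ger0_norm// fine_ge0.
apply/fine_cvgP; split.
  by apply: filterS (H _ ltr01) => n un; rewrite ge0_fin_numE// (le_lt_trans un)// ltry.
apply/cvgrPdist_le => e e0; apply: filterS (H e e0) => n un /=.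
rewrite sub0r normrN ger0_norm ?fine_ge0// -lee_fin fineK//.
by rewrite ge0_fin_numE// (le_lt_trans un)// ltry.
Unshelve. all: by end_near. Qed.

Lemma poweR_le_cancel (x : \bar R) (p e : R) : (0 < p)%R -> (0 < e)%R -> 0 <= x ->
  x `^ p <= (e `^ p)%:E -> x <= e%:E.
Proof.
move=> p0 e0; case: x => [x| |]//; last first.
  by move=> _; rewrite poweRyr ?gt_eqF// leye_eq.
rewrite poweR_EFin !lee_fin => x0; apply: contraTT; rewrite -!ltNge => ex.
by rewrite gt0_ltr_powR ?nnegrE// ltW.
Qed.

End vanishing.

Section moments.
Context {R : realType} {B : ambient R} (s : R).
Hypothesis s0 : 0 < s.
Context d (T : measurableType d) (P : probability T R).

Lemma min_exponent_gt0 : 0 < Num.min 1 s^-1.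
Proof. by rewrite lt_min ltr01 invr_gt0. Qed.

Lemma norm_s_lty (X : T -> carrier B) : (norm_s P s X < +oo)%E -> (smoment s P X < +oo)%E.
Proof. by apply: lty_poweRy; rewrite gt_eqF// min_exponent_gt0. Qed.

Lemma opnorm_s_lty (A : T -> operator B) : (opnorm_s P s (fun w => A w) < +oo)%E ->
  (\int[P]_w (opn (A w) `^ s)%:E < +oo)%E.
Proof.
move=> /lty_poweRy; rewrite gt_eqF ?min_exponent_gt0// => /(_ isT).
by under eq_integral do rewrite opnormE poweR_EFin.
Qed.

Lemma zeta_congr (mu nu nu' : probability (carrier B) R) :
  (forall U, measurable U -> nu U = nu' U) -> zeta s mu nu = zeta s mu nu'.
Proof.
move=> E; rewrite /zeta; congr (ereal_sup _); apply: eq_imagel => f _.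
congr (`|_ - _|)%E; apply: eq_measure_integral => U mU _; exact: E.
Qed.

End moments.

Theorem proposition19 (R : realType) (B : ambient R) (s : R) (s_gt0 : 0 < s)
  (K n0 : nat) (K_ge1 : (1 <= K)%N)
  (d : measure_display) (Omega : measurableType d) (P : probability Omega R)
  (X : nat -> {RV P >-> carrier B})
  (A : nat -> 'I_K -> {RV P >-> operator B})
  (b : nat -> {RV P >-> carrier B})
  (I : nat -> 'I_K -> {RV P >-> nat})
  (I_le : forall n r w, (I n r w <= n)%N)
  (Xcopy : 'I_K -> nat -> {RV P >-> carrier B})
  (Xcopy_law : forall r, same_process_law X (Xcopy r))
  (indep : forall n, (n0 <= n)%N ->
     independent P (fun o : option 'I_K =>
       match o with
       | None => coefficient_events (A n) (b n) (I n)
       | Some r => process_events (Xcopy r)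
       end))
  (recurrence : forall n, (n0 <= n)%N ->
     forall U : set (carrier B), measurable U ->
       P (X n @^-1` U) = P (recursion_rhs (A n) (b n) (I n) Xcopy @^-1` U))
  (* (C1) *)
  (X_moment : forall n, (n < n0)%N -> (norm_s P s (X n) < +oo)%E)
  (A_moment : forall n r, (opnorm_s P s (fun w => A n r w) < +oo)%E)
  (b_moment : forall n, (norm_s P s (b n) < +oo)%E)
  (Alim : 'I_K -> {RV P >-> operator B}) (blim : {RV P >-> carrier B})
  (gamma_cvg : coefficient_distance s n0 (A n) (b n) (I n) Alim blim
     @[n --> \oo] --> 0%E)
  (index_cvg : forall (l : nat) (r : 'I_K),
     (\int[P]_(w in [set w | (I n r w <= l)%N \/ I n r w = n])
        (opnorm (A n r w) `^ s))%E @[n --> \oo] --> 0%E)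
  (* (C2) *)
  (L_lt1 : (\sum_(r < K) \int[P]_w (opnorm (Alim r w) `^ s) < 1)%E)
  (* (C3) *)
  (eta : probability (carrier B) R) (eta_Ms : Ms s eta)
  (eta_fixed : forall U : set (carrier B), measurable U ->
     smoothing Alim blim eta U = eta U)
  (X_Ms : forall n, (n0 <= n)%N -> Ms_at s eta (distribution P (X n)))
  (d' : measure_display) (Omega' : measurableType d')
  (P' : probability Omega' R) (Y : {RV P' >-> carrier B})
  (Y_law : forall U : set (carrier B), measurable U ->
     distribution P' Y U = eta U) :
  zeta s (distribution P (X n)) (distribution P' Y) @[n --> \oo] --> 0%E.
Proof.
have L1 : (\sum_r \int[P]_w (opn (Alim r w) `^ s)%:E < 1)%E.
  by move: L_lt1; under eq_bigr do under eq_integral do rewrite opnormE poweR_EFin.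
have Alim_moment r : (\int[P]_w (opn (Alim r w) `^ s)%:E < +oo)%E.
  apply: le_lt_trans (lt_trans L1 (ltry _)); rewrite (bigD1 r)//= leeDl// sume_ge0// => r' _.
  by apply: integral_ge0 => w _; rewrite lee_fin powR_ge0.
have A_mom n r : (\int[P]_w (opn (A n r w) `^ s)%:E < +oo)%E.
  exact: (opnorm_s_lty s_gt0).
have b_mom n : (\int[P]_w (`|b n w| `^ s)%:E < +oo)%E by exact: (norm_s_lty s_gt0).
pose p := Num.min 1 s^-1.
have p0 : 0 < p by exact: min_exponent_gt0.
have mAl r : measurable_fun setT (Alim r) by [].
have mA n r : measurable_fun setT (A n r) by [].
pose mu i : probability (carrier B) R := distribution P (X i).
have mu_Ms i : Ms s (mu i).
  have [i0|n0i] := ltnP i n0; last by have [] := X_Ms i n0i.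
  have iX := norm_s_lty s_gt0 (X_moment i i0).
  apply: le_lt_trans iX; rewrite /Ms /mu.
  have mn : measurable_fun setT (fun x : carrier B => (`|x| `^ s)%:E).
    by apply/measurable_EFinP; exact: (measurable_norm_powR s (@measurable_id _ _ setT)).
  have n00 (x : carrier B) : (0 <= (`|x| `^ s)%:E)%E by rewrite lee_fin powR_ge0.
  by rewrite (ge0_integral_law (m1 := P) (m2 := distribution P (X i)) (phi := X i) _ _ mn n00).
have [LX LXE] := law_exists P
  (@measurable_fun_path _ B _ _ (fun w n => X n w) (fun n => @measurable_funPT _ _ _ _ (X n))).
have mu_law i U : measurable U -> mu i U = LX ((fun x : path_type B => x i) @^-1` U).
  by move=> _; rewrite LXE.
(* gamma(n) is built from norms with the outer exponent p = min(1, 1/s); comparing it with e^p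
   removes this exponent. *)
have gam e : 0 < e -> \forall n \near \oo,
    (\int[P]_w (`|b n w - blim w| `^ s)%:E <= e%:E)%E /\
    forall r, (\int[P]_w (opnorm (fun x => A n r w x - Alim r w x)%R `^ s) <= e%:E)%E.
  move=> e0.
  have n1 (Z : Omega -> carrier B) : (0 <= norm_s P s Z)%E by exact: poweR_ge0.
  have n2 (Z : Omega -> carrier B -> carrier B) : (0 <= opnorm_s P s Z)%E by exact: poweR_ge0.
  have := gamma_cvg; move=> /cvge0P H.
  have {}H := H _ (e `^ p) (powR_gt0 p e0).
  have g0 n : (0 <= coefficient_distance s n0 (A n) (b n) (I n) Alim blim)%E.
    by rewrite adde_ge0// sume_ge0// => r _; rewrite adde_ge0.
  apply: filterS (H g0) => n gn; split.
    apply: (poweR_le_cancel p0 e0); last first.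
      apply: le_trans gn; rewrite /coefficient_distance leeDl// sume_ge0// => r _.
      by rewrite adde_ge0.
    by apply: integral_ge0 => w _; rewrite lee_fin powR_ge0.
  move=> r; apply: (poweR_le_cancel p0 e0).
    by apply: integral_ge0 => w _; exact: poweR_ge0.
  apply: le_trans gn; rewrite /coefficient_distance (bigD1 r)//= addeCA -addeA.
  rewrite leeDl// adde_ge0// adde_ge0// sume_ge0// => r' _.
  by rewrite adde_ge0.
(* The limit inherits its finite s-th moment from a single b^(N) with E|b^(N) - b|^s <= 1. *)
have bl_mom : (\int[P]_w (`|blim w| `^ s)%:E < +oo)%E.
  have [N _ /(_ N (leqnn N))[bN _]] := gam _ ltr01.
  have mb1 : measurable_fun setT (fun w => (`|b N w| `^ s)%:E).
    by apply/measurable_EFinP; exact: (measurable_norm_powR s).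
  have mb2 : measurable_fun setT (fun w => (`|b N w - blim w| `^ s)%:E).
    by apply/measurable_EFinP; apply: (measurable_norm_powR s); exact: measurable_funB_amb.
  apply: (@le_lt_trans _ _ (\int[P]_w ((2 `^ s)%:E * ((`|b N w| `^ s)%:E + (`|b N w - blim w| `^ s)%:E)))%E).
    apply: ge0_le_lower_integral => w _; first by rewrite lee_fin powR_ge0.
    rewrite -EFinD -EFinM lee_fin (le_trans _ (powRD_le s_gt0 _ _))//.
    rewrite ge0_ler_powR ?nnegrE ?(ltW s_gt0) ?addr_ge0//.
    by rewrite -{1}(subKr (b N w) (blim w)) ler_normB.
  rewrite ge0_integralZl//; last 2 first.
  - exact: emeasurable_funD.
  - by move=> w _; rewrite adde_ge0 ?lee_fin ?powR_ge0.
  apply: lte_mul_pinfty; [by rewrite lee_fin powR_ge0|by []|].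
  rewrite ge0_integralD//.
  by apply: lte_add_pinfty; [exact: b_mom|exact: le_lt_trans bN (ltry _)].
(* Stated for any S inside the event I_r <= l, in order to cover both I_r < n0 and I_r = i for fixed
   i. *)
have idx l e : 0 < e -> \forall n \near \oo, forall r (S : set Omega),
    (forall w, S w -> (I n r w <= l)%N) ->
    (\int[P]_w (opn (A n r w) `^ s * \1_S w)%:E <= e%:E)%E.
  move=> e0.
  have H r : \forall n \near \oo, (\int[P]_(w in [set w | (I n r w <= l)%N \/ I n r w = n])
        (opnorm (A n r w) `^ s) <= e%:E)%E.
    by have /cvge0P := index_cvg l r; apply=> // n; apply: integral_ge0 => w _; exact: poweR_ge0.
  have : \forall n \near \oo, forall r, (\int[P]_(w in [set w | (I n r w <= l)%N \/ I n r w = n])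
        (opnorm (A n r w) `^ s) <= e%:E)%E.
    by apply: filter_forall.
  apply: filterS => n Hn r S Sl; apply: le_trans (Hn r).
  rewrite [leRHS]integral_mkcond; apply: ge0_le_lower_integral => w _.
    by rewrite lee_fin mulr_ge0 ?powR_ge0.
  rewrite indicE patchE; have [wS|_] := boolP (w \in S).
    by rewrite mem_set/=; [rewrite mulr1 opnormE poweR_EFin|left; apply: Sl; exact/set_mem].
  by rewrite mulr0; case: ifP => // _; exact: poweR_ge0.
have [q [de [de0 q1 Hq]]] := perturbed_row_sum s_gt0 mAl L1.
pose c n r i : \bar R := (\int[P]_w (opn (A n r w) `^ s * \1_[set w | I n r w = i] w)%:E)%E.
have c0 n r i : (0 <= c n r i)%E.
  by apply: integral_ge0 => w _; rewrite lee_fin mulr_ge0 ?powR_ge0.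
have cE n r i : c n r i = (fine (c n r i))%:E.
  rewrite fineK// ge0_fin_numE//; apply: le_lt_trans (A_mom n r).
  apply: ge0_le_lower_integral => w _; first by rewrite lee_fin mulr_ge0 ?powR_ge0.
  by rewrite lee_fin -[leRHS]mulr1 ler_wpM2l ?powR_ge0// indicE lern1 leq_b1.
pose a n i : R := \sum_r fine (c n r i).
have a0 n i : 0 <= a n i by apply: sumr_ge0 => r _; exact: fine_ge0.
have splitE n z : (forall i, 0 <= z i) ->
    (\sum_r \int[P]_w (opn (A n r w) `^ s * z (I n r w))%:E = (\sum_(i < n.+1) a n i * z i)%:E)%E.
  move=> z0.
  under eq_bigr => r _.
    rewrite (integral_index_split s P (mA n) (fun r => @measurable_funPT _ _ _ _ (I n r)) (I_le n) r z0).
    under eq_bigr => i _ do rewrite -/(c n r i) cE -EFinM.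
    rewrite sumEFin.
    over.
  rewrite sumEFin exchange_big/=; congr (_%:E); apply: eq_bigr => i _.
  by rewrite mulr_suml.
have matched n : (n0 <= n)%N -> taylor_matched s (mu n) eta.
  by move=> n0n; apply: Ms_at_taylor_matched => //; exact: X_Ms.
(* The value is 0 below n0, where zeta_s may be infinite; these indices are never replaced, so z has
   to bound the distances only for i >= n0. *)
pose z i := if (i < n0)%N then 0 else fine (zeta s (mu i) eta).
have zetaE i : (n0 <= i)%N -> zeta s (mu i) eta = (z i)%:E.
  move=> n0i; rewrite /z ltnNge n0i/= fineK// ge0_fin_numE.
    by apply: zeta_lty => //; exact: matched.
  exact: zeta_ge0.
have z0 i : 0 <= z i.
  by rewrite /z; case: ifP => // _; apply: fine_ge0; exact: zeta_ge0.
have main : forall e, 0 < e -> \forall n \near \oo, z n <= e.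
  apply: (contraction_cvg0 (a := a) (q := q)) => //.
  - apply: filterS (gam _ de0) => n [_ /(Hq _ (mA n))].
    move=> /(le_trans _) H; rewrite -lee_fin; apply: H.
    have := splitE n (fun=> 1) (fun=> ler01).
    under eq_bigr do under eq_integral do rewrite mulr1.
    by under [X in _ = X%:E -> _]eq_bigr do rewrite mulr1; move=> ->.
  - move=> l e e0; pose e' := e / (l.+1%:R * K.+1%:R).
    have e'0 : 0 < e' by rewrite divr_gt0 ?mulr_gt0.
    have H : \forall n \near \oo, forall i : 'I_l, forall r, fine (c n r i) <= e'.
      apply: filter_forall => i; apply: filterS (idx i e' e'0) => n Hn r.
      by rewrite -lee_fin -cE; apply: Hn => w /= ->.
    apply: filterS H => n Hn.
    apply: (@le_trans _ _ (\sum_(i < l) \sum_(r < K) e')).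
      by apply: ler_sum => i _; apply: ler_sum => r _; exact: Hn.
    rewrite !sumr_const !card_ord -mulrnA -[_ *+ _]mulr_natl natrM /e' mulrCA.
    rewrite ler_piMr ?(ltW e0)// ler_pdivrMr ?mulr_gt0// mul1r mulrC.
    by rewrite ler_pM// ler_nat.
  - move=> e e0; set M := \int[eta]_x (`|x| `^ s).
    have M0 : 0 <= M by apply: Rintegral_ge0 => x _; exact: powR_ge0.
    (* Order of choice: e1 fixes C by [remainder_young], then de' is taken small against C and the
       limit constant, and n comes last. *)
    pose e1 := e / 2 / (M + 1).
    have e10 : 0 < e1 by rewrite !divr_gt0// ltr_wpDl.
    have [C C0 HC] := remainder_young s_gt0 e10.
    pose LC := limit_constant s K LX eta n0.
    pose de' := e / 2 / (`|C * LC| + 1).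
    have de'0 : 0 < de' by rewrite !divr_gt0// ltr_wpDl.
    near=> n.
    have n0n : (n0 <= n)%N by near: n; exact: nbhs_infty_ge.
    have [gb gA] : (\int[P]_w (`|b n w - blim w| `^ s)%:E <= de'%:E)%E /\
      forall r, (\int[P]_w (opnorm (fun x => A n r w x - Alim r w x)%R `^ s) <= de'%:E)%E.
      by near: n; exact: gam.
    have gI r : (\int[P]_w (opn (A n r w) `^ s * \1_[set w | (I n r w < n0)%N] w)%:E <= de'%:E)%E.
      have H : forall r (S : set Omega), (forall w, S w -> (I n r w <= n0)%N) ->
        (\int[P]_w (opn (A n r w) `^ s * \1_S w)%:E <= de'%:E)%E by near: n; exact: idx.
      by apply: H => w /ltnW.
    have rec U : measurable U -> mu n U =
        hybrid_law P K LX eta (hybrid (fun r => A n r) (b n) (fun r => I n r) (@always K) @^-1` U).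
      move=> mU; rewrite -(recursion_law (LX := LX) eta _ (indep n n0n) mU) -?recurrence//.
      by move=> r E mE; rewrite -Xcopy_law// LXE.
    have fix_ U : measurable U -> eta U =
        hybrid_law P K LX eta (hybrid (fun r => Alim r) blim (fun r => I n r) (@never K) @^-1` U).
      by move=> mU; rewrite -eta_fixed//; exact: limit_law.
    have zi i : (n0 <= i <= n)%N -> forall g, test_functions s g ->
        `|\int[mu i]_x g x - \int[eta]_x g x| <= z i.
      by move=> /andP[n0i _] g gs; rewrite -lee_fin -zetaE//; exact: le_zeta.
    have := one_step s_gt0 (mA n) (@measurable_funPT _ _ _ _ (b n))
      (fun r => @measurable_funPT _ _ _ _ (I n r)) mAl (@measurable_funPT _ _ _ _ blim)
      mu_law mu_Ms eta_Ms (I_le n) (A_mom n) (b_mom n) Alim_moment bl_mom rec fix_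
      (matched n n0n) z0 zi C0 HC gb gA gI.
    rewrite splitE// zetaE// -EFinD lee_fin => /le_trans; apply; rewrite lerD2l -/M -/LC.
    have h1 : e1 * M <= e / 2.
      by rewrite /e1 mulrAC -mulrA ler_piMr ?divr_ge0 ?(ltW e0)// ler_pdivrMr ?ltr_wpDl// mul1r lerDl.
    have h2 : C * (LC * de') <= e / 2.
      rewrite mulrA; apply: (@le_trans _ _ (`|C * LC| * de')).
        by rewrite ler_wpM2r ?(ltW de'0)// ler_norm.
      by rewrite /de' mulrCA ler_piMr ?divr_ge0 ?(ltW e0)// ler_pdivrMr ?ltr_wpDl// mul1r lerDl.
    by rewrite [leRHS]splitr lerD.
have -> : (fun n => zeta s (distribution P (X n)) (distribution P' Y)) =
    (fun n => zeta s (mu n) eta).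
  by apply/funext => n; apply: zeta_congr => U mU; exact: Y_law.
apply/cvge0P => [n|e e0]; first exact: zeta_ge0.
near=> n; rewrite zetaE; last by near: n; exact: nbhs_infty_ge.
by rewrite lee_fin; near: n; exact: main.
Unshelve. all: by end_near. Qed.
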